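(* Let $\mathcal E_*$ be a pointed model category, $\mathcal J$ a pointed weak lattice, $\widetilde Y:\mathcal J\to\operatorname{ho}(\mathcal E_* )$ a pointed functor, and $x\in\operatorname{Obj}\mathcal J$ with $|x|>n\ge k\ge2$. Let $\widetilde Y^x_k:\mathcal J^x_k\to\operatorname{ho}(\mathcal E_* )$ be the restriction of $\widetilde Y$, let $Y_k:\partial\mathcal J^x_k\to\mathcal E_*$ be a pointed Reedy fibrant functor lifting $\widetilde Y^x_k|_{\partial\mathcal J^x_k}$, and let $Y^x_{k-1}:\mathcal J^x_{k-1}\to\mathcal E_*$ be a pointed functor lifting $\widetilde Y^x_k|_{\mathcal J^x_{k-1}}$ which agrees with $Y_k$ on $\partial\mathcal J^x_{k-1}$. Then the total pointed higher homotopy operation $\langle Y^x_{k-1}\rangle$ separates into a sequence of $k-1$ pointed operations $\langle Y^x_{k-1}\rangle^{j+1}$ ($1\le j<k$), and the following are equivalent: (1) there is a pointed functor $Y^x_k:\mathcal J^x_k\to\mathcal E_*$ lifting $\widetilde Y^x_k$ and strictly extending $Y_k$ and $Y^x_{k-1}$; (2) the total pointed operation $\langle Y^x_{k-1}\rangle$ vanishes; (3) the associated sequence $\langle Y^x_{k-1}\rangle^{j+1}$ ($1\le j<k$) of separated pointed higher homotopy operations vanishes (so in particular each in turn is defined).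
   Context: **Weak lattices.** A weak lattice is a connected Reedy indexing category $\mathcal J$ with finite Hom-sets and a degree function $|\cdot|:\operatorname{Obj}\mathcal J\to\mathbb N$ such that there are finitely many objects in each degree, all non-identity morphisms strictly decrease degree, and every object maps to at least one object of degree $0$. For $x\in\operatorname{Obj}\mathcal J$, $\mathcal J^x$ is the full subcategory on the objects $t$ with $\mathcal J(x,t)\ne\emptyset$. For $k<|x|$, $\mathcal J^x_k$ is the full subcategory of $\mathcal J^x$ on $x$ and all its objects of degree $\le k$, and $\partial\mathcal J^x_k$ is its full subcategory on all objects other than $x$. **Pointed notions.** $\mathcal E_*$ is the category of objects of a model category under the terminal object $*$, with the inherited model structure; $*$ also denotes zero maps. $\mathcal J$ is pointed if its morphisms are partitioned, $\mathcal J(x,t)=\widetilde{\mathcal J}(x,t)\sqcup\overline{\mathcal J}(x,t)$, so that $\mathrm{Id}_x\in\overline{\mathcal J}(x,x)$ iff $x$ is a zero object of $\mathcal J$, and any composite $f\circ g$ with $f$ or $g$ in $\overline{\mathcal J}$ lies in $\overline{\mathcal J}$. A functor on $\mathcal J$ (or on a full subcategory) to $\mathcal E_*$ or $\operatorname{ho}(\mathcal E_* )$ is pointed if it sends every morphism in $\overline{\mathcal J}$ to the zero map. **Reduced matching objects.** For $Y$ pointed on $\partial\mathcal J^x_k$, $\mathbf M^x_k$ is the limit of $(f:x\to s)\mapsto Y(s)$ over the category of morphisms in $\mathcal J$ from $x$ to objects of degree $\le k$ (morphisms: commuting triangles under $x$), and $\overline{\mathbf M}^x_k$ is the pullback of $\mathbf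 M^x_k\to\prod_{|t|\le k}\prod_{\mathcal J(x,t)}Y(t)$ (inclusion) along the section $\prod_{|t|\le k}\prod_{\widetilde{\mathcal J}(x,t)}Y(t)\to\prod_{|t|\le k}\prod_{\mathcal J(x,t)}Y(t)$ which is zero on the factors indexed by $\overline{\mathcal J}$; the projection $\overline{\mathbf M}^x_k\to\prod_{|t|\le k}\prod_{\widetilde{\mathcal J}(x,t)}Y(t)$ is denoted $\overline{\operatorname{forget}}$. If $Y$ is a pointed functor on $\mathcal J^x_k$, $\overline{\operatorname m}^x_k:Y(x)\to\overline{\mathbf M}^x_k$ is the canonical map. $Y$ is pointed Reedy fibrant if each $\overline{\operatorname m}^s_{|s|-1}$ is a fibration (for $|s|=0$: $Y(s)$ is fibrant). **Conventions.** A functor into $\mathcal E_*$ lifts a functor into $\operatorname{ho}(\mathcal E_* )$ if it has the given composite with $\mathcal E_*\to\operatorname{ho}(\mathcal E_* )$. All objects $\widetilde Y(s)$ are fibrant and cofibrant; in particular $Y(x):=Y^x_{k-1}(x)$ is cofibrant; $\sim$ denotes (pointed) homotopy. $Y(t)$ denotes the common value of the given functors. **Notation for an object $y$** with $|y|>m\ge2$ ($y=x$ and $m=k$, or $y\in\partial\mathcal J^x_k$). Put $A^y_m=\prod_{|v|=m}\prod_{\widetilde{\mathcal J}(y,v)}Y(v)$, $B^y_m=\prod_{|t|<m}\prod_{\widetilde{\mathcal J}(y,t)}Y(t)$, $D^y_m=\prod_{|v|=m}\prod_{\widetilde{\mathcal J}(y,v)}\prod_{|u|<m}\prod_{\widetilde{\mathcal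 J}(v,u)}Y(u)$, $L^y_m=\prod_{|v|=m}\prod_{\widetilde{\mathcal J}(y,v)}\overline{\mathbf M}^v_{m-1}$. The map $\overline\Psi:B^y_m\to D^y_m$ has component at $(g:y\to v,f:v\to u)$ the projection to the factor indexed by $f\circ g$ if $f\circ g\in\widetilde{\mathcal J}$, and zero otherwise. There are maps $A^y_m\to L^y_m$ (product of the $\overline{\operatorname m}^v_{m-1}$) and $L^y_m\to D^y_m$ (product of the maps $\overline{\operatorname{forget}}$). Put $$\overline{\mathbf Q}^y_{m-1}=B^y_m\times_{D^y_m}L^y_m,\qquad \overline{\mathbf N}^y_{m-1}=\overline{\mathbf M}^y_{m-1}\times_{B^y_m}\overline{\mathbf Q}^y_{m-1},\qquad \overline{\mathbf P}^y_m=\overline{\mathbf Q}^y_{m-1}\times_{L^y_m}A^y_m,$$ so that $\overline{\mathbf M}^y_m\cong\overline{\mathbf N}^y_{m-1}\times_{\overline{\mathbf Q}^y_{m-1}}\overline{\mathbf P}^y_m$. **Separation grid $F^{\bullet,\bullet}_{y,m}$ (recursive in $m\ge2$).** *Column $0$:* $F^{0,m+1}_{y,m}=A^y_m$, $F^{0,m}_{y,m}=L^y_m$, $F^{0,1}_{y,m}=D^y_m$, and for $1\le j\le m-2$, $F^{0,j+1}_{y,m}=\prod_{|v|=m}\prod_{\widetilde{\mathcal J}(y,v)}\big(F^{j,m}_{v,m-1}\times G^{j,m}_{v,m-1}\big)$. The vertical maps $F^{0,i+1}\to F^{0,i}$ are: the map $A^y_m\to L^y_m$ given by the product of the maps $\overline{\operatorname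 m}^v_{m-1}:Y(v)\to\overline{\mathbf M}^v_{m-1}$; (for $m=2$) the map $L^y_m\to D^y_m$ given by the product of the maps $\overline{\operatorname{forget}}:\overline{\mathbf M}^v_{m-1}\to\prod_{|u|<m}\prod_{\widetilde{\mathcal J}(v,u)}Y(u)$; (for $m>2$) the product of the maps $\overline{\mathbf M}^v_{m-1}\to F^{m-2,m}_{v,m-1}\times G^{m-2,m}_{v,m-1}$ given by $\overline{\mathbf M}^v_{m-1}\to\overline{\mathbf P}^v_{m-1}\to F^{m-2,m}_{v,m-1}$ and $\overline{\mathbf M}^v_{m-1}\to\overline{\mathbf N}^v_{m-2}\to G^{m-2,m}_{v,m-1}$; and below that the products of the horizontal fibrations $F^{j,m}_{v,m-1}\to F^{j-1,m}_{v,m-1}$ and of the fibrations $G^{j,m}_{v,m-1}\to G^{j-1,m}_{v,m-1}$. *The objects $G^{j,m+1}_{y,m}$ ($0\le j\le m-1$):* $G^{j,m+1}_{y,m}=B^y_m\times_{D^y_m}F^{0,j+1}_{y,m}$ (pullback along $\overline\Psi$) for $0\le j\le m-2$ (so $G^{0,m+1}_{y,m}=B^y_m$), while $G^{m-1,m+1}_{y,m}$ is obtained by factoring $\overline{\mathbf N}^y_{m-1}\to\overline{\mathbf Q}^y_{m-1}\to G^{m-2,m+1}_{y,m}$ as an acyclic cofibration $\overline{\mathbf N}^y_{m-1}\to G^{m-1,m+1}_{y,m}$ followed by a fibration. *Column $1$:* factor $\overline\Psi:B^y_m\to D^y_m$ as an acyclic cofibration $\iota:B^y_m\to F^{1,1}_{y,m}$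 followed by a fibration $q_1:F^{1,1}_{y,m}\to F^{0,1}_{y,m}$; put $F^{1,i}_{y,m}=F^{1,1}_{y,m}\times_{F^{0,1}_{y,m}}F^{0,i}_{y,m}$ for $2\le i\le m+1$, and let $\varphi^1:\overline{\mathbf Q}^y_{m-1}\to B^y_m\xrightarrow{\iota}F^{1,1}_{y,m}$. *Column $j+1$ ($1\le j\le m-2$):* factor the induced map $\overline{\mathbf Q}^y_{m-1}\to F^{j,j+1}_{y,m}$ as an acyclic cofibration $\varphi^{j+1}:\overline{\mathbf Q}^y_{m-1}\to F^{j+1,j+1}_{y,m}$ followed by a fibration $q_{j+1}$; put $F^{j+1,i}_{y,m}=F^{j+1,j+1}_{y,m}\times_{F^{j,j+1}_{y,m}}F^{j,i}_{y,m}$ for $j+2\le i\le m+1$. The maps $\varphi^j$ and $\overline{\mathbf Q}^y_{m-1}\to L^y_m$ induce compatible maps from $\overline{\mathbf Q}^y_{m-1}$ to all $F^{j,i}_{y,m}$ with $i\le m$, and there is an induced map $\overline{\mathbf P}^y_m\to F^{m-1,m+1}_{y,m}$. **Maps in the grid for $(x,k)$.** Write $F^{j,i}=F^{j,i}_{x,k}$; $\gamma_k:\overline{\mathbf Q}^x_{k-1}\to F^{k-1,k}$ and $\Gamma_{k-1}:\overline{\mathbf Q}^x_{k-1}\to F^{1,k}$ are the induced maps; $\varphi^k=\mathrm{Id}_{\overline{\mathbf Q}^x_{k-1}}$, $q_k=\gamma_k$. Further $u_j:F^{j,k+1}\to F^{j-1,k+1}$, $p_j:F^{j,j+1}\to F^{j-1,j+1}$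 are horizontal maps, and $r_j:F^{j,j+1}\to F^{j,j}$, $\Phi^j:F^{j,k+1}\to F^{j,j+1}$, $\beta_j:F^{j,k+1}\to F^{j,j+2}$ are vertical (composite) maps. **Maps out of $Y(x)$.** $\sigma^x_{<k}:Y(x)\to B^x_k$ has components $Y^x_{k-1}(f)$. $\sigma^x_k:Y(x)\to A^x_k$ is a fixed map whose component at $g$ represents $\widetilde Y^x_k(g)$. $\eta_{k-1}:Y(x)\to\overline{\mathbf Q}^x_{k-1}$ is induced by $\sigma^x_{<k}$ and by the maps $Y(x)\to\overline{\mathbf M}^s_{k-1}$ (for $g\in\widetilde{\mathcal J}(x,s)$, $|s|=k$) with components $Y^x_{k-1}(f\circ g)$. **Total operation.** $\langle Y^x_{k-1}\rangle$ is the set of homotopy classes of maps $\theta:Y(x)\to F^{1,k}$ whose composite $\varphi$ with $F^{1,k}\to F^{1,1}$ satisfies $\varphi\sim\iota\circ\sigma^x_{<k}$ and $q_1\circ\varphi=$ the composite $Y(x)\xrightarrow{\sigma^x_k}A^x_k\to D^x_k$. It vanishes if it contains $[\Gamma_{k-1}\circ\eta_{k-1}]$. **Separated operations.** Put $\kappa_0=\sigma^x_k$. For $1\le j<k$, given $\kappa_{j-1}:Y(x)\to F^{j-1,k+1}$, the separated operation $\langle Y^x_{k-1}\rangle^{j+1}$ of order $j+1$ is the set of homotopy classes of maps $\theta:Y(x)\to F^{j,j+1}$ with $r_j\circ\theta\sim\varphi^j\circ\eta_{k-1}$ and $p_j\circ\theta=\beta_{j-1}\circ\kappa_{j-1}$.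 It vanishes at such a $\theta$ if $\theta\sim q_{j+1}\circ\varphi^{j+1}\circ\eta_{k-1}$. The pair $(\kappa_{j-1},\theta)$ determines a unique $\kappa_j:Y(x)\to F^{j,k+1}$ with $u_j\circ\kappa_j=\kappa_{j-1}$ and $\Phi^j\circ\kappa_j=\theta$; when the operation of order $j+1$ vanishes at $\theta$, the operation of order $j+2$ is defined using this $\kappa_j$. The sequence vanishes if maps $\theta$ can be chosen successively for $j=1,\dots,k-1$ so that each operation in turn is defined and vanishes at the chosen $\theta$. *)

(* Defs.v *)
From mathcomp Require Import all_boot.
From mathcomp Require Import boolp classical_sets cardinality.
From Stdlib Require Import Relation_Operators.

Set Implicit Arguments.
Unset Strict Implicit.
Unset Printing Implicit Defensive.

Local Open Scope classical_set_scope.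

Record cat_on (ob : Type) := CatOn {
  hom_ : ob -> ob -> Type;
  idm_ : forall a, hom_ a a;
  comp_ : forall a b c, hom_ b c -> hom_ a b -> hom_ a c;
  comp_idl_ : forall a b (f : hom_ a b), comp_ (idm_ b) f = f;
  comp_idr_ : forall a b (f : hom_ a b), comp_ f (idm_ a) = f;
  comp_assoc_ : forall a b c d (h : hom_ c d) (g : hom_ b c) (f : hom_ a b),
    comp_ h (comp_ g f) = comp_ (comp_ h g) f }.

Record category := Category { ob :> Type; cat_str : cat_on ob }.

Definition hom (C : category) (a b : C) : Type := hom_ (cat_str C) a b.
Definition idm (C : category) (a : C) : hom a a := idm_ (cat_str C) a.
Definition comp (C : category) (a b c : C) (g : hom b c) (f : hom a b) :
  hom a c := comp_ g f.

Notation "g ∘ f" := (comp g f) (at level 40, left associativity).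

(** A functor is given by its action on morphisms over a fixed object map
    [F0], so that equality of two functors with the same object map is equality
    of maps, with no transport along equalities of objects. *)
Record functor (C D : category) (F0 : C -> D) := Functor {
  fmap :> forall a b : C, hom a b -> hom (F0 a) (F0 b);
  fmap_id : forall a, fmap (idm a) = idm (F0 a);
  fmap_comp : forall a b c (g : hom b c) (f : hom a b),
    fmap (g ∘ f) = fmap g ∘ fmap f }.
Arguments functor C D F0 : clear implicits.

Definition full (C : category) (P : C -> Prop) : category :=
  @Category {t : C | P t}
    (@CatOn _ (fun s t => hom (sval s) (sval t)) (fun s => idm (sval s))
       (fun a b c g f => g ∘ f)
       (fun a b f => comp_idl_ f) (fun a b f => comp_idr_ f)
       (fun a b c d h g f => comp_assoc_ h g f)).

Section UniversalProperties.
Variable C : category.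

Definition is_iso (a b : C) (f : hom a b) : Prop :=
  exists g : hom b a, g ∘ f = idm a /\ f ∘ g = idm b.

Definition is_terminal (z : C) : Prop :=
  forall a, exists! f : hom a z, True.
Definition is_initial (z : C) : Prop :=
  forall a, exists! f : hom z a, True.
Definition is_zero (z : C) : Prop := is_terminal z /\ is_initial z.

Definition is_zero_map (a b : C) (f : hom a b) : Prop :=
  exists (z : C) (p : hom a z) (i : hom z b), is_zero z /\ f = i ∘ p.

Definition is_product (I : Type) (X : I -> C) (P : C)
    (pr : forall i, hom P (X i)) : Prop :=
  forall (T : C) (f : forall i, hom T (X i)),
    exists! h : hom T P, forall i, pr i ∘ h = f i.

Definition is_coproduct2 (a b s : C) (i1 : hom a s) (i2 : hom b s) : Prop :=
  forall (T : C) (f : hom a T) (g : hom b T),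
    exists! h : hom s T, h ∘ i1 = f /\ h ∘ i2 = g.
Definition is_product2 (a b p : C) (p1 : hom p a) (p2 : hom p b) : Prop :=
  forall (T : C) (f : hom T a) (g : hom T b),
    exists! h : hom T p, p1 ∘ h = f /\ p2 ∘ h = g.

Definition is_pullback (a b c p : C) (f : hom a c) (g : hom b c)
    (pa : hom p a) (pb : hom p b) : Prop :=
  f ∘ pa = g ∘ pb /\
  forall (T : C) (u : hom T a) (v : hom T b), f ∘ u = g ∘ v ->
    exists! h : hom T p, pa ∘ h = u /\ pb ∘ h = v.

Variables (I : category) (F0 : I -> C) (F : functor I C F0).

Definition is_cone (L : C) (c : forall i, hom L (F0 i)) : Prop :=
  forall i j (g : hom i j), F _ _ g ∘ c i = c j.
Definition is_limit (L : C) (c : forall i, hom L (F0 i)) : Prop :=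
  is_cone c /\
  forall (T : C) (d : forall i, hom T (F0 i)), is_cone d ->
    exists! h : hom T L, forall i, c i ∘ h = d i.

Definition is_cocone (L : C) (c : forall i, hom (F0 i) L) : Prop :=
  forall i j (g : hom i j), c j ∘ F _ _ g = c i.
Definition is_colimit (L : C) (c : forall i, hom (F0 i) L) : Prop :=
  is_cocone c /\
  forall (T : C) (d : forall i, hom (F0 i) T), is_cocone d ->
    exists! h : hom L T, forall i, h ∘ c i = d i.

End UniversalProperties.

Definition finite_category (I : category) : Prop :=
  finite_set [set: I] /\ forall i j : I, finite_set [set: hom i j].

Definition has_lifting (C : category) (a b c d : C)
    (i : hom a b) (p : hom c d) : Prop :=
  forall (u : hom a c) (v : hom b d), p ∘ u = v ∘ i ->
    exists h : hom b c, h ∘ i = u /\ p ∘ h = v.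

Definition is_retract (C : category) (a b c d : C)
    (f : hom a b) (g : hom c d) : Prop :=
  exists (s : hom a c) (r : hom c a) (s' : hom b d) (r' : hom d b),
    [/\ r ∘ s = idm a, r' ∘ s' = idm b, g ∘ s = s' ∘ f & f ∘ r = r' ∘ g].

Definition map_class (C : category) := forall a b : C, hom a b -> Prop.

(** Quillen's closed model categories (finite limits and colimits). *)
Record model_category := ModelCategory {
  mcat :> category;
  weq : map_class mcat;
  cof : map_class mcat;
  fib : map_class mcat;
  mc_limits : forall (I : category) (F0 : I -> mcat) (F : functor I mcat F0),
    finite_category I -> exists L (c : forall i, hom L (F0 i)), is_limit F c;
  mc_colimits : forall (I : category) (F0 : I -> mcat) (F : functor I mcat F0),
    finite_category I -> exists L (c : forall i, hom (F0 i) L), is_colimit F c;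
  mc_weq_comp : forall a b c (g : hom b c) (f : hom a b),
    weq f -> weq g -> weq (g ∘ f);
  mc_weq_left : forall a b c (g : hom b c) (f : hom a b),
    weq f -> weq (g ∘ f) -> weq g;
  mc_weq_right : forall a b c (g : hom b c) (f : hom a b),
    weq g -> weq (g ∘ f) -> weq f;
  mc_retract : forall a b c d (f : hom a b) (g : hom c d), is_retract f g ->
    [/\ weq g -> weq f, cof g -> cof f & fib g -> fib f];
  mc_lifting : forall a b c d (i : hom a b) (p : hom c d),
    cof i -> fib p -> weq i \/ weq p -> has_lifting i p;
  mc_factor_acof : forall a b (f : hom a b),
    exists c (i : hom a c) (p : hom c b),
      [/\ cof i, weq i, fib p & f = p ∘ i];
  mc_factor_afib : forall a b (f : hom a b),
    exists c (i : hom a c) (p : hom c b),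
      [/\ cof i, fib p, weq p & f = p ∘ i] }.

(** The category of objects of a model category under its terminal object is
    of this form; conversely a category of this form is isomorphic to the
    category of its own objects under the terminal object. *)
Record pointed_model_category := PointedModelCategory {
  pmcat :> model_category;
  pm_zero : exists z : pmcat, is_zero z }.

Section Homotopy.
Variable E : model_category.

Definition acof (a b : E) (f : hom a b) : Prop := cof f /\ weq f.

Definition fibrant (a : E) : Prop :=
  exists (z : E) (p : hom a z), is_terminal z /\ fib p.
Definition cofibrant (a : E) : Prop :=
  exists (z : E) (i : hom z a), is_initial z /\ cof i.

Definition left_homotopic (a b : E) (f g : hom a b) : Prop :=
  exists (aa cyl : E) (i1 i2 : hom a aa) (i : hom aa cyl) (w : hom cyl a)
         (h : hom cyl b),
    [/\ is_coproduct2 i1 i2, cof i, weq w,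
        w ∘ (i ∘ i1) = idm a /\ w ∘ (i ∘ i2) = idm a
      & h ∘ (i ∘ i1) = f /\ h ∘ (i ∘ i2) = g].

Definition right_homotopic (a b : E) (f g : hom a b) : Prop :=
  exists (bb pth : E) (p1 p2 : hom bb b) (p : hom pth bb) (w : hom b pth)
         (h : hom a pth),
    [/\ is_product2 p1 p2, fib p, weq w,
        (p1 ∘ p) ∘ w = idm b /\ (p2 ∘ p) ∘ w = idm b
      & (p1 ∘ p) ∘ h = f /\ (p2 ∘ p) ∘ h = g].

Definition homotopic (a b : E) (f g : hom a b) : Prop :=
  left_homotopic f g /\ right_homotopic f g.

Definition homotopy_class (a b : E) (f : hom a b) : set (hom a b) :=
  [set g | homotopic f g].

(** The localization of [E] at the weak equivalences, with the same objects
    as [E]. *)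
Record homotopy_category := HomotopyCategory {
  ho_str : cat_on E;
  ho_loc : functor E (Category ho_str) id;
  ho_weq : forall (a b : E) (f : hom a b), weq f -> is_iso (ho_loc _ _ f);
  ho_factor : forall (D : category) (F0 : E -> D) (F : functor E D F0),
    (forall (a b : E) (f : hom a b), weq f -> is_iso (F _ _ f)) ->
    exists G : functor (Category ho_str) D F0,
      forall (a b : E) (f : hom a b), G _ _ (ho_loc _ _ f) = F _ _ f;
  ho_unique : forall (D : category) (F0 : E -> D)
      (G G' : functor (Category ho_str) D F0),
    (forall (a b : E) (f : hom a b),
       G _ _ (ho_loc _ _ f) = G' _ _ (ho_loc _ _ f)) ->
    forall (a b : Category ho_str) (f : hom a b), G _ _ f = G' _ _ f }.

Definition ho (H : homotopy_category) : category := Category (ho_str H).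

End Homotopy.

Inductive is_id (C : category) : forall a b : C, hom a b -> Prop :=
  IsId a : is_id (idm a).

(** As non-identity morphisms strictly decrease degree, the Reedy structure is
    the one in which every morphism is inverse and only identities are
    direct. *)
Record weak_lattice := WeakLattice {
  wcat :> category;
  deg : wcat -> nat;
  wl_connected : forall s t : wcat,
    clos_refl_sym_trans wcat (fun a b => inhabited (hom a b)) s t;
  wl_finite_hom : forall s t : wcat, finite_set [set: hom s t];
  wl_finite_deg : forall d, finite_set [set t : wcat | deg t = d];
  wl_decreasing : forall (s t : wcat) (f : hom s t),
    ~ is_id f -> deg t < deg s;
  wl_bottom : forall s : wcat, exists t, inhabited (hom s t) /\ deg t = 0 }.

(** [barred f] says that [f] belongs to the part $\overline{\mathcal J}$ of the
    partition; its negation is membership in $\widetilde{\mathcal J}$. *)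
Record pointed_weak_lattice := PointedWeakLattice {
  pwcat :> weak_lattice;
  barred : forall s t : pwcat, hom s t -> bool;
  barred_id : forall s : pwcat, barred (idm s) <-> is_zero s;
  barred_comp : forall (r s t : pwcat) (f : hom s t) (g : hom r s),
    barred f || barred g -> barred (f ∘ g) }.

Section Subcategories.
Variables (J : weak_lattice) (x : J) (k : nat).

Definition in_sub (t : J) : Prop :=
  t = x \/ (inhabited (hom x t) /\ deg t <= k).
Definition in_bdry (t : J) : Prop := in_sub t /\ t <> x.

Definition sub : category := full in_sub.
Definition bdry : category := full in_bdry.

End Subcategories.

Section PointedFunctors.
Variables (J : pointed_weak_lattice) (D : category).

Definition pointed_functor (F0 : J -> D) (F : functor J D F0) : Prop :=
  forall (s t : J) (f : hom s t), barred f -> is_zero_map (F _ _ f).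

Variables (P : J -> Prop) (F0 : J -> D).

Definition pointed_on (F : functor (full P) D (fun s => F0 (sval s))) : Prop :=
  forall (s t : full P) (f : hom s t),
    @barred J (sval s) (sval t) f -> is_zero_map (F _ _ f).

(** Agreement of functors defined on two full subcategories, on the morphisms
    between their common objects. *)
Definition agree (P' : J -> Prop)
    (F : functor (full P) D (fun s => F0 (sval s)))
    (F' : functor (full P') D (fun s => F0 (sval s))) : Prop :=
  forall (s t : J) (hs : P s) (ht : P t) (hs' : P' s) (ht' : P' t)
         (f : hom s t),
    F (exist _ s hs) (exist _ t ht) f = F' (exist _ s hs') (exist _ t ht') f.

End PointedFunctors.

Definition lifts (E : model_category) (H : homotopy_category E)
    (J : weak_lattice) (Y0 : J -> E) (Yt : functor J (ho H) Y0) (P : J -> Prop)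
    (Y : functor (full P) E (fun s => Y0 (sval s))) : Prop :=
  forall (s t : full P) (f : hom s t),
    ho_loc H _ _ (Y _ _ f) = Yt (sval s) (sval t) f.

Section Grid.
Variables (E : pointed_model_category) (J : pointed_weak_lattice).
Variables (x : J) (k : nat) (Y0 : J -> E).
Variable Y : functor (bdry x k) E (fun s => Y0 (sval s)).

(** Targets range over the boundary of $\mathcal J^x_k$, where [Y] is defined:
    it contains every target of degree at most [k] of a morphism from [x], and
    every target of a morphism from one of its own objects. *)
Record arrow (y : J) (p : pred nat) := Arrow {
  tgt_ : bdry x k;
  arr : hom y (sval tgt_);
  arr_deg : p (deg (sval tgt_)) }.

Definition tgt (y : J) (p : pred nat) (a : arrow y p) : J := sval (tgt_ a).

Record tarrow (y : J) (p : pred nat) := Tarrow {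
  tarr :> arrow y p;
  tarr_ok : ~~ barred (arr tarr) }.

Definition after (y : J) (p q : pred nat) (a : arrow y p)
    (b : arrow (tgt a) q) : arrow y q :=
  @Arrow y q (tgt_ b) (arr b ∘ arr a) (arr_deg b).

Definition relax (y : J) (p q : pred nat) (a : arrow y p) (h : q (deg (tgt a))) :
  arrow y q := @Arrow y q (tgt_ a) (arr a) h.

Definition trelax (y : J) (p q : pred nat) (a : tarrow y p)
    (h : q (deg (tgt a))) : tarrow y q :=
  @Tarrow y q (relax h) (tarr_ok a).

Definition deg_le (m : nat) : pred nat := fun d => d <= m.
Definition deg_eq (m : nat) : pred nat := fun d => d == m.

Section Under.
Variables (y : J) (m : nat).

Definition under_hom (a b : arrow y (deg_le m)) : Type :=
  {g : @hom J (tgt a) (tgt b) | g ∘ arr a = arr b}.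

Lemma under_hom_eq (a b : arrow y (deg_le m)) (f g : under_hom a b) :
  sval f = sval g -> f = g.
Proof. by case: f g => [f pf] [g pg] /= e; subst g; rewrite (Prop_irrelevance pf pg). Qed.

Lemma under_id_proof (a : arrow y (deg_le m)) : idm (tgt a) ∘ arr a = arr a.
Proof. exact: comp_idl_. Qed.

Lemma under_comp_proof (a b c : arrow y (deg_le m))
  (g : under_hom b c) (f : under_hom a b) : (sval g ∘ sval f) ∘ arr a = arr c.
Proof.
by case: g f => [g pg] [f pf] /=; rewrite /comp -comp_assoc_ -/(f ∘ _) pf.
Qed.

Definition under : category.
refine (@Category (arrow y (deg_le m))
  (@CatOn _ under_hom
    (fun a => exist _ _ (under_id_proof a))
    (fun a b c g f => exist _ _ (under_comp_proof g f)) _ _ _)).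
- by move=> a b f; apply: under_hom_eq; apply: comp_idl_.
- by move=> a b f; apply: under_hom_eq; apply: comp_idr_.
- by move=> a b c d h g f; apply: under_hom_eq; apply: comp_assoc_.
Defined.

Definition under_functor : functor under E (fun a => Y0 (tgt a)).
refine (@Functor under E (fun a => Y0 (tgt a))
  (fun a b g => Y (tgt_ a) (tgt_ b) (sval g)) _ _).
- by move=> a; apply: (fmap_id Y).
- by move=> a b c g f; apply: (fmap_comp Y).
Defined.

(** The matching object [rm_lim], the inclusion [rm_incl] into the product
    [rm_all] over all morphisms, the section [rm_sect] from the product
    [rm_til] over the unbarred morphisms, and their pullback [rm_obj], which is
    $\overline{\mathbf M}^y_m$. *)
Record reduced_matching := ReducedMatching {
  rm_lim : E;
  rm_cone : forall a : under, hom rm_lim (Y0 (tgt a));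
  rm_limP : is_limit under_functor rm_cone;
  rm_all : E;
  rm_all_pr : forall a : arrow y (deg_le m), hom rm_all (Y0 (tgt a));
  rm_allP : is_product rm_all_pr;
  rm_til : E;
  rm_til_pr : forall a : tarrow y (deg_le m), hom rm_til (Y0 (tgt a));
  rm_tilP : is_product rm_til_pr;
  rm_incl : hom rm_lim rm_all;
  rm_inclP : forall a : arrow y (deg_le m),
    rm_all_pr a ∘ rm_incl = rm_cone a;
  rm_sect : hom rm_til rm_all;
  rm_sect_til : forall a : tarrow y (deg_le m),
    rm_all_pr a ∘ rm_sect = rm_til_pr a;
  rm_sect_bar : forall a : arrow y (deg_le m), barred (arr a) ->
    is_zero_map (rm_all_pr a ∘ rm_sect);
  rm_obj :> E;
  rm_in : hom rm_obj rm_lim;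
  rm_forget : hom rm_obj rm_til;
  rm_pullback : is_pullback rm_incl rm_sect rm_in rm_forget }.

Definition rm_cmp (M : reduced_matching) (a : arrow y (deg_le m)) :
  hom M (Y0 (tgt a)) := @rm_cone M a ∘ rm_in M.

End Under.

(** [h] is the canonical map $\overline{\mathrm m}^v_m$. *)
Definition is_matching_map (v : bdry x k) (m : nat)
    (M : reduced_matching (sval v) m) (h : hom (Y0 (sval v)) M) : Prop :=
  forall a : arrow (sval v) (deg_le m), rm_cmp M a ∘ h = Y v (tgt_ a) (arr a).

Definition reedy_fibrant : Prop :=
  forall v : bdry x k,
    (deg (sval v) = 0 -> fibrant (Y0 (sval v))) /\
    (0 < deg (sval v) ->
       exists (M : reduced_matching (sval v) (deg (sval v)).-1)
              (h : hom (Y0 (sval v)) M), is_matching_map h /\ fib h).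

(** The data of the grids for all pairs $(y,m)$; they are only constrained by
    [grid_laws] and [column0_laws] below. [gF y m j i] is $F^{j,i}_{y,m}$, with
    $A = F^{0,m+1}$, $L = F^{0,m}$, $D = F^{0,1}$, and [gG y m j] is
    $G^{j,m+1}_{y,m}$; [gM y m] is $\overline{\mathbf M}^y_m$, while [gQ y m],
    [gN y m] and [gP y m] are $\overline{\mathbf Q}^y_{m-1}$,
    $\overline{\mathbf N}^y_{m-1}$ and $\overline{\mathbf P}^y_m$. The composite
    grid map $F^{j,i} \to F^{j',i'}$ is [gmap y m j i j' i']. *)
Record grid_data := GridData {
  gM : forall (y : J) (m : nat), reduced_matching y m;
  gmb : forall (v : bdry x k) (m : nat),
    hom (Y0 (sval v)) (gM (sval v) m);
  gF : J -> nat -> nat -> nat -> E;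
  gmap : forall (y : J) (m j i j' i' : nat), hom (gF y m j i) (gF y m j' i');
  gA_pr : forall (y : J) (m : nat) (a : tarrow y (deg_eq m)),
    hom (gF y m 0 m.+1) (Y0 (tgt a));
  gL_pr : forall (y : J) (m : nat) (a : tarrow y (deg_eq m)),
    hom (gF y m 0 m) (gM (tgt a) m.-1);
  gD_pr : forall (y : J) (m : nat) (a : tarrow y (deg_eq m)),
    hom (gF y m 0 1) (rm_til (gM (tgt a) m.-1));
  gLD : forall (y : J) (m : nat), hom (gF y m 0 m) (gF y m 0 1);
  gPsi : forall (y : J) (m : nat), hom (rm_til (gM y m.-1)) (gF y m 0 1);
  gQ : J -> nat -> E;
  gQB : forall (y : J) (m : nat), hom (gQ y m) (rm_til (gM y m.-1));
  gQL : forall (y : J) (m : nat), hom (gQ y m) (gF y m 0 m);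
  gN : J -> nat -> E;
  gNM : forall (y : J) (m : nat), hom (gN y m) (gM y m.-1);
  gNQ : forall (y : J) (m : nat), hom (gN y m) (gQ y m);
  gP : J -> nat -> E;
  gPQ : forall (y : J) (m : nat), hom (gP y m) (gQ y m);
  gPA : forall (y : J) (m : nat), hom (gP y m) (gF y m 0 m.+1);
  gMQ : forall (y : J) (m : nat), hom (gM y m) (gQ y m);
  gMN : forall (y : J) (m : nat), hom (gM y m) (gN y m);
  gMP : forall (y : J) (m : nat), hom (gM y m) (gP y m);
  gG : J -> nat -> nat -> E;
  gGmap : forall (y : J) (m j : nat), hom (gG y m j.+1) (gG y m j);
  gGB : forall (y : J) (m j : nat), hom (gG y m j) (rm_til (gM y m.-1));
  gGF : forall (y : J) (m j : nat), hom (gG y m j) (gF y m 0 j.+1);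
  gQG : forall (y : J) (m : nat), hom (gQ y m) (gG y m m.-2);
  gNG : forall (y : J) (m : nat), hom (gN y m) (gG y m m.-1);
  giota : forall (y : J) (m : nat), hom (rm_til (gM y m.-1)) (gF y m 1 1);
  gQF : forall (y : J) (m j i : nat), hom (gQ y m) (gF y m j i);
  gPF : forall (y : J) (m : nat), hom (gP y m) (gF y m m.-1 m.+1);
  gCF : forall (y : J) (m j : nat) (a : tarrow y (deg_eq m)),
    hom (gF y m 0 j.+1) (gF (tgt a) m.-1 j m);
  gCG : forall (y : J) (m j : nat) (a : tarrow y (deg_eq m)),
    hom (gF y m 0 j.+1) (gG (tgt a) m.-1 j) }.

(** $B^y_m$, the target of the forgetful map from
    $\overline{\mathbf M}^y_{m-1}$. *)
Definition gB (S : grid_data) (y : J) (m : nat) : E := rm_til (gM S y m.-1).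
Definition gB_pr (S : grid_data) (y : J) (m : nat)
    (b : tarrow y (deg_le m.-1)) : hom (gB S y m) (Y0 (tgt b)) :=
  @rm_til_pr _ _ (gM S y m.-1) b.

(** The positions $(j,i)$ occupied in the grid of size [m]. *)
Definition in_grid (m j i : nat) : bool :=
  [&& j < m, 0 < i, j <= i & i <= m.+1].

(** The conditions on the grid of size $m = n + 2$, apart from the structure
    of its column 0. *)
Record grid_laws (S : grid_data) (y : J) (n : nat) (m := n.+2) : Prop :=
 GridLaws {
  gA_product : is_product (gA_pr S (y := y) (m := m));
  gL_product : is_product (gL_pr S (y := y) (m := m));
  gD_product : is_product (gD_pr S (y := y) (m := m));
  gmb_canonical : forall a : tarrow y (deg_eq m),
    is_matching_map (gmb S (tgt_ a) m.-1);
  gAL_law : forall a : tarrow y (deg_eq m),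
    gL_pr S a ∘ gmap S y m 0 m.+1 0 m = gmb S (tgt_ a) m.-1 ∘ gA_pr S a;
  gLD_law : forall a : tarrow y (deg_eq m),
    gD_pr S a ∘ gLD S y m = rm_forget (gM S (tgt a) m.-1) ∘ gL_pr S a;
  gPsi_til : forall (a : tarrow y (deg_eq m)) (b : tarrow (tgt a) (deg_le m.-1))
      (h : ~~ barred (arr (after b))),
    gB_pr S b ∘ (gD_pr S a ∘ gPsi S y m) = gB_pr S (Tarrow h);
  gPsi_bar : forall (a : tarrow y (deg_eq m)) (b : tarrow (tgt a) (deg_le m.-1)),
    barred (arr (after b)) ->
    is_zero_map (gB_pr S b ∘ (gD_pr S a ∘ gPsi S y m));
  gQ_pullback : is_pullback (gPsi S y m) (gLD S y m) (gQB S y m) (gQL S y m);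
  gN_pullback : is_pullback (rm_forget (gM S y m.-1)) (gQB S y m)
    (gNM S y m) (gNQ S y m);
  gP_pullback : is_pullback (gQL S y m) (gmap S y m 0 m.+1 0 m)
    (gPQ S y m) (gPA S y m);
  gMQ_B : forall (b : tarrow y (deg_le m.-1)) (h : deg_le m (deg (tgt b))),
    gB_pr S b ∘ (gQB S y m ∘ gMQ S y m) = rm_cmp (gM S y m) (relax h);
  gMQ_L : forall (a : tarrow y (deg_eq m)) (b : arrow (tgt a) (deg_le m.-1))
      (h : deg_le m (deg (tgt b))),
    rm_cmp (gM S (tgt a) m.-1) b ∘ (gL_pr S a ∘ (gQL S y m ∘ gMQ S y m))
      = rm_cmp (gM S y m) (relax (a := after b) h);
  gMN_M : forall (b : arrow y (deg_le m.-1)) (h : deg_le m (deg (tgt b))),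
    rm_cmp (gM S y m.-1) b ∘ (gNM S y m ∘ gMN S y m)
      = rm_cmp (gM S y m) (relax h);
  gMN_Q : gNQ S y m ∘ gMN S y m = gMQ S y m;
  gMP_Q : gPQ S y m ∘ gMP S y m = gMQ S y m;
  gMP_A : forall (a : tarrow y (deg_eq m)) (h : deg_le m (deg (tgt a))),
    gA_pr S a ∘ (gPA S y m ∘ gMP S y m) = rm_cmp (gM S y m) (relax h);
  gmap_id : forall j i, in_grid m j i ->
    gmap S y m j i j i = idm (gF S y m j i);
  gmap_comp : forall j i j' i' j'' i'',
    in_grid m j i -> in_grid m j' i' -> in_grid m j'' i'' ->
    j'' <= j' <= j -> i'' <= i' <= i ->
    gmap S y m j' i' j'' i'' ∘ gmap S y m j i j' i' = gmap S y m j i j'' i'';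
  gG_pullback : forall j, j <= m.-2 ->
    is_pullback (gPsi S y m) (gmap S y m 0 j.+1 0 1)
      (gGB S y m j) (gGF S y m j);
  gGmap_B : forall j, j.+1 <= m.-2 ->
    gGB S y m j ∘ gGmap S y m j = gGB S y m j.+1;
  gGmap_F : forall j, j.+1 <= m.-2 ->
    gGF S y m j ∘ gGmap S y m j
      = gmap S y m 0 j.+2 0 j.+1 ∘ gGF S y m j.+1;
  gQG_B : gGB S y m m.-2 ∘ gQG S y m = gQB S y m;
  gQG_F : gGF S y m m.-2 ∘ gQG S y m = gmap S y m 0 m 0 m.-1 ∘ gQL S y m;
  gNG_acof : acof (gNG S y m);
  gNG_fib : fib (gGmap S y m m.-2);
  gNG_law : gGmap S y m m.-2 ∘ gNG S y m = gQG S y m ∘ gNQ S y m;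
  giota_acof : acof (giota S y m);
  giota_fib : fib (gmap S y m 1 1 0 1);
  giota_law : gmap S y m 1 1 0 1 ∘ giota S y m = gPsi S y m;
  gF_pullback : forall j i, j.+1 < m -> j.+2 <= i <= m.+1 ->
    is_pullback (gmap S y m j.+1 j.+1 j j.+1) (gmap S y m j i j j.+1)
      (gmap S y m j.+1 i j.+1 j.+1) (gmap S y m j.+1 i j i);
  gQF_L : gQF S y m 0 m = gQL S y m;
  gQF_iota : gQF S y m 1 1 = giota S y m ∘ gQB S y m;
  gQF_compat : forall j i j' i', in_grid m j i -> in_grid m j' i' ->
    j' <= j -> i' <= i -> i <= m ->
    gmap S y m j i j' i' ∘ gQF S y m j i = gQF S y m j' i';
  (* $\varphi^{j+1}$ and $q_{j+1}$ *)
  gQF_acof : forall j, 1 <= j <= m.-2 -> acof (gQF S y m j.+1 j.+1);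
  gQF_fib : forall j, 1 <= j <= m.-2 -> fib (gmap S y m j.+1 j.+1 j j.+1);
  gPF_Q : gmap S y m m.-1 m.+1 m.-1 m ∘ gPF S y m
    = gQF S y m m.-1 m ∘ gPQ S y m;
  gPF_A : gmap S y m m.-1 m.+1 0 m.+1 ∘ gPF S y m = gPA S y m }.

(** Column 0 below $L$ in the grid of size $m = n + 3$. *)
Record column0_laws (S : grid_data) (y : J) (n : nat) (m := n.+3) : Prop :=
 Column0Laws {
  gC_product : forall j, 1 <= j <= m.-2 ->
    is_product
      (X := fun i : tarrow y (deg_eq m) + tarrow y (deg_eq m) =>
        match i with
        | inl a => gF S (tgt a) m.-1 j m
        | inr a => gG S (tgt a) m.-1 j
        end)
      (P := gF S y m 0 j.+1)
      (fun i => match i with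
        | inl a => gCF S j a
        | inr a => gCG S j a
        end);
  gC_top_F : forall a : tarrow y (deg_eq m),
    gCF S m.-2 a ∘ gmap S y m 0 m 0 m.-1
      = gPF S (tgt a) m.-1 ∘ (gMP S (tgt a) m.-1 ∘ gL_pr S a);
  gC_top_G : forall a : tarrow y (deg_eq m),
    gCG S m.-2 a ∘ gmap S y m 0 m 0 m.-1
      = gNG S (tgt a) m.-1 ∘ (gMN S (tgt a) m.-1 ∘ gL_pr S a);
  gC_step_F : forall j (a : tarrow y (deg_eq m)), 1 <= j -> j.+1 <= m.-2 ->
    gCF S j a ∘ gmap S y m 0 j.+2 0 j.+1
      = gmap S (tgt a) m.-1 j.+1 m j m ∘ gCF S j.+1 a;
  gC_step_G : forall j (a : tarrow y (deg_eq m)), 1 <= j -> j.+1 <= m.-2 ->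
    gCG S j a ∘ gmap S y m 0 j.+2 0 j.+1
      = gGmap S (tgt a) m.-1 j ∘ gCG S j.+1 a;
  (* $F^{0,2} \to F^{0,1} = D$, where $D$ is identified with the product of the
     $F^{0,m}_{v,m-1} \times G^{0,m}_{v,m-1} = A^v_{m-1} \times B^v_{m-1}$ *)
  gC_bottom_F : forall (a : tarrow y (deg_eq m))
      (b : tarrow (tgt a) (deg_le m.-1)) (h : deg_eq m.-1 (deg (tgt b))),
    gB_pr S b ∘ (gD_pr S a ∘ gmap S y m 0 2 0 1)
      = gA_pr S (trelax h) ∘ (gmap S (tgt a) m.-1 1 m 0 m ∘ gCF S 1 a);
  gC_bottom_G : forall (a : tarrow y (deg_eq m))
      (b : tarrow (tgt a) (deg_le m.-1)) (h : deg_le m.-2 (deg (tgt b))),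
    gB_pr S b ∘ (gD_pr S a ∘ gmap S y m 0 2 0 1)
      = gB_pr S (trelax h)
        ∘ (gGB S (tgt a) m.-1 0 ∘ (gGmap S (tgt a) m.-1 0 ∘ gCG S 1 a)) }.

Definition admissible (y : J) (m : nat) : Prop :=
  m < deg y /\ ((y = x /\ m = k) \/ in_bdry x k y).

Record separation_grid := SeparationGrid {
  sg_data :> grid_data;
  sg_laws : forall y n, admissible y n.+2 -> grid_laws sg_data y n;
  sg_column0_two : forall y, admissible y 2 ->
    gmap sg_data y 2 0 2 0 1 = gLD sg_data y 2;
  sg_column0 : forall y n, admissible y n.+3 -> column0_laws sg_data y n }.

Variables (H : homotopy_category E) (Yt : functor J (ho H) Y0).
Variable Yx : functor (sub x k.-1) E (fun s => Y0 (sval s)).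

Definition Yx_at (t : J) (f : hom x t) (h : deg t <= k.-1) :
    hom (Y0 x) (Y0 t) :=
  Yx (exist (in_sub x k.-1) x (or_introl erefl))
     (exist (in_sub x k.-1) t (or_intror (conj (inhabits f) h))) f.

Record maps_from_x (S : separation_grid) := MapsFromX {
  sigma_lt : hom (Y0 x) (gB S x k);
  sigma_ltP : forall b : tarrow x (deg_le k.-1),
    gB_pr S b ∘ sigma_lt = Yx_at (arr b) (arr_deg b);
  sigma_k : hom (Y0 x) (gF S x k 0 k.+1);
  sigma_kP : forall a : tarrow x (deg_eq k),
    ho_loc H _ _ (gA_pr S a ∘ sigma_k) = Yt x (tgt a) (arr a);
  eta : hom (Y0 x) (gQ S x k);
  eta_B : gQB S x k ∘ eta = sigma_lt;
  eta_L : forall (a : tarrow x (deg_eq k)) (b : arrow (tgt a) (deg_le k.-1)),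
    rm_cmp (gM S (tgt a) k.-1) b ∘ (gL_pr S a ∘ (gQL S x k ∘ eta))
      = Yx_at (arr b ∘ arr a) (arr_deg b) }.

Section Operations.
Variables (S : separation_grid) (o : maps_from_x S).

Definition total_maps : set (hom (Y0 x) (gF S x k 1 k)) :=
  [set theta |
    let phi := gmap S x k 1 k 1 1 ∘ theta in
    homotopic phi (giota S x k ∘ sigma_lt o) /\
    gmap S x k 1 1 0 1 ∘ phi
      = gLD S x k ∘ (gmap S x k 0 k.+1 0 k ∘ sigma_k o)].

Definition total_operation : set (set (hom (Y0 x) (gF S x k 1 k))) :=
  [set homotopy_class theta | theta in total_maps].

Definition total_vanishes : Prop :=
  total_operation (homotopy_class (gQF S x k 1 k ∘ eta o)).

(** Below, [i] stands for $j - 1$, where the operation has order $j + 1$. *)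
Definition separated_maps (i : nat) (kappa : hom (Y0 x) (gF S x k i k.+1)) :
    set (hom (Y0 x) (gF S x k i.+1 i.+2)) :=
  [set theta |
    homotopic (gmap S x k i.+1 i.+2 i.+1 i.+1 ∘ theta)
              (gQF S x k i.+1 i.+1 ∘ eta o) /\
    gmap S x k i.+1 i.+2 i i.+2 ∘ theta = gmap S x k i k.+1 i i.+2 ∘ kappa].

Definition separated_operation (i : nat)
    (kappa : hom (Y0 x) (gF S x k i k.+1)) :
    set (set (hom (Y0 x) (gF S x k i.+1 i.+2))) :=
  [set homotopy_class theta | theta in separated_maps kappa].

(** The map $q_{j+1} \circ \varphi^{j+1}$ is the induced map
    $\overline{\mathbf Q}^x_{k-1} \to F^{j,j+1}$: by [gQF_compat] when
    $j < k-1$, and by the definition of $q_k$ and $\varphi^k$ when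
    $j = k-1$. *)
Definition vanishes_at (i : nat)
    (theta : hom (Y0 x) (gF S x k i.+1 i.+2)) : Prop :=
  homotopic theta (gQF S x k i.+1 i.+2 ∘ eta o).

Definition determines_next (i : nat) (kappa : hom (Y0 x) (gF S x k i k.+1))
    (theta : hom (Y0 x) (gF S x k i.+1 i.+2))
    (kappa' : hom (Y0 x) (gF S x k i.+1 k.+1)) : Prop :=
  gmap S x k i.+1 k.+1 i k.+1 ∘ kappa' = kappa /\
  gmap S x k i.+1 k.+1 i.+1 i.+2 ∘ kappa' = theta.

Definition sequence_vanishes : Prop :=
  exists (kappa : forall i, hom (Y0 x) (gF S x k i k.+1))
         (theta : forall i, hom (Y0 x) (gF S x k i.+1 i.+2)),
    kappa 0 = sigma_k o /\
    forall i, i.+1 < k ->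
      [/\ separated_maps (kappa i) (theta i), vanishes_at (theta i)
        & determines_next (kappa i) (theta i) (kappa i.+1)].

(** The $k - 1$ separated operations are successively well defined: the first
    one is a nonempty set of homotopy classes, each choice of $\theta$
    determines the next $\kappa$ uniquely, and the next operation is nonempty
    if the given one vanishes at $\theta$. *)
Definition separates : Prop :=
  [/\ separated_operation (sigma_k o) !=set0,
      forall i (kappa : hom (Y0 x) (gF S x k i k.+1)) theta, i.+1 < k ->
        separated_maps kappa theta ->
        exists! kappa', determines_next kappa theta kappa'
    & forall i (kappa : hom (Y0 x) (gF S x k i k.+1)) theta kappa', i.+2 < k ->
        separated_maps kappa theta -> vanishes_at theta ->
        determines_next kappa theta kappa' ->
        separated_operation kappa' !=set0].

End Operations.
End Grid.

(* Main.v *)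
(** Write X = Y(x), sigma for sigma_k, and A -> L -> D for the top of column 0.
    An extension as in (1) is the same thing as a map s : X -> A homotopic to
    sigma whose image in L is the composite of eta with Q -> L.  Since X is
    cofibrant, homotopies of maps out of X lift along fibrations. For (2) =>
    (1), L -> D is monic, so the L-component of an element of the total
    operation is the image of sigma, and its homotopy to that of eta lifts
    along A -> L, a product of the matching fibrations. For (1) => (2) and
    (1) => (3), the homotopy from s to sigma is lifted along F^{1,k} -> L,
    respectively one column at a time along the maps F^{j+1,k+1} ->
    F^{j,k+1}, which are pullbacks of the fibrations q_{j+1}. The same
    lifting shows that each operation is nonempty once its predecessor
    vanishes. For (3) => (2), project F^{k-1,k} onto F^{1,k}.

    Components of s and sigma have equal classes in the homotopy category; that
    they are homotopic, and that every class is represented, follows by comparing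
    the localization with the category of homotopy classes of maps from a
    cofibrant object into fibrant replacements. *)

Require Import Defs.
From mathcomp Require Import all_boot.
From mathcomp Require Import boolp classical_sets cardinality.
From mathcomp Require Import zify.

Set Implicit Arguments.
Unset Strict Implicit.
Unset Printing Implicit Defensive.

Local Open Scope classical_set_scope.

(** Two obstacles shape the development. In column 0 of a grid of size at least 3 the map from [L]
    to [D] is prescribed only row by row, through grids of smaller size, whereas $\overline{\mathbf
    Q}$ and the total operation use the product of the forgetful maps. That the composite of the
    rows is this product is needed both for a grid under construction and for an arbitrary given
    one; it is therefore derived from a short list of facts, [tower_facts], valid in both
    situations. Moreover, the homotopies obtained from the homotopy category come one factor of a
    product at a time, and they can be assembled only over a common cylinder; the factors being
    fibrant, each homotopy can be moved to a prescribed cylinder. The grid data are functions of all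
    indices, constrained only at some; the remaining values are filled with zero maps, which exist
    because the model category is pointed. *)

Lemma dep_choice (I : Type) (T : I -> Type) (P : forall i, T i -> Prop) :
  (forall i, exists y, P i y) -> exists f : forall i, T i, forall i, P i (f i).
Proof. by move=> H; exists (fun i => projT1 (cid (H i))) => i; case: cid. Qed.

Lemma dep_sequence (T : nat -> Type) (R : forall n, T n -> T n.+1 -> Prop) (t0 : T 0) :
  (forall n t, exists t', R n t t') ->
  exists s : forall n, T n, s 0 = t0 /\ forall n, R n (s n) (s n.+1).
Proof.
move=> H; have /dep_choice [g gP] : forall n, exists g : T n -> T n.+1, forall t, R n t (g t).
  by move=> n; have [g gP] := choice (H n); exists g.
pose fix s n : T n := if n is k.+1 then g k (s k) else t0.
by exists s; split=> // n; apply: gP.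
Qed.

(** * Categories and finite limits *)

Section CategoryBasics.
Variable C : category.
Implicit Types a b c d : C.

Lemma compA a b c d (h : hom c d) (g : hom b c) (f : hom a b) :
  h ∘ (g ∘ f) = (h ∘ g) ∘ f.
Proof. exact: comp_assoc_. Qed.

Lemma comp1m a b (f : hom a b) : idm b ∘ f = f.
Proof. exact: comp_idl_. Qed.

Lemma compm1 a b (f : hom a b) : f ∘ idm a = f.
Proof. exact: comp_idr_. Qed.

Lemma terminal_eq (z : C) a (f g : hom a z) : is_terminal z -> f = g.
Proof. by move=> /(_ a) [h [_ hu]]; rewrite -(hu f I) -(hu g I). Qed.

Lemma initial_eq (z : C) a (f g : hom z a) : is_initial z -> f = g.
Proof. by move=> /(_ a) [h [_ hu]]; rewrite -(hu f I) -(hu g I). Qed.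

Lemma zero_map_eq a b (f g : hom a b) : is_zero_map f -> is_zero_map g -> f = g.
Proof.
move=> [z [p [i [[zt zi] ->]]]] [z' [p' [i' [[zt' zi'] ->]]]].
have [t [_ _]] := zi z'.
by rewrite (initial_eq i (i' ∘ t) zi) -compA (terminal_eq (t ∘ p) p' zt').
Qed.

Lemma zero_map_compr a b c (f : hom b c) (g : hom a b) :
  is_zero_map g -> is_zero_map (f ∘ g).
Proof.
by move=> [z [p [i [zz ->]]]]; exists z, p, (f ∘ i); split=> //; rewrite compA.
Qed.

Lemma zero_map_compl a b c (f : hom b c) (g : hom a b) :
  is_zero_map f -> is_zero_map (f ∘ g).
Proof.
by move=> [z [p [i [zz ->]]]]; exists z, (p ∘ g), i; split=> //; rewrite compA.
Qed.

Lemma product_ex (I : Type) (X : I -> C) P (pr : forall i, hom P (X i)) :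
  is_product pr -> forall T (f : forall i, hom T (X i)),
  exists h : hom T P, forall i, pr i ∘ h = f i.
Proof. by move=> H T f; have [h [h1 _]] := H T f; exists h. Qed.

Lemma product_mono (I : Type) (X : I -> C) P (pr : forall i, hom P (X i)) :
  is_product pr -> forall T (f g : hom T P),
  (forall i, pr i ∘ f = pr i ∘ g) -> f = g.
Proof.
move=> H T f g e; have [h [_ hu]] := H T (fun i => pr i ∘ g).
by rewrite -(hu f e) -(hu g).
Qed.

Lemma pullback_ex a b c p (f : hom a c) (g : hom b c) (pa : hom p a)
    (pb : hom p b) : is_pullback f g pa pb ->
  forall T (u : hom T a) (v : hom T b), f ∘ u = g ∘ v ->
  exists h, pa ∘ h = u /\ pb ∘ h = v.
Proof. by move=> [_ H] T u v /H [h [h1 _]]; exists h. Qed.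

Lemma pullback_comm a b c p (f : hom a c) (g : hom b c) (pa : hom p a)
    (pb : hom p b) : is_pullback f g pa pb -> f ∘ pa = g ∘ pb.
Proof. by case. Qed.

Lemma pullback_mono a b c p (f : hom a c) (g : hom b c) (pa : hom p a)
    (pb : hom p b) : is_pullback f g pa pb ->
  forall T (u v : hom T p), pa ∘ u = pa ∘ v -> pb ∘ u = pb ∘ v -> u = v.
Proof.
move=> [e H] T u v ea eb.
have [|h [_ hu]] := H T (pa ∘ v) (pb ∘ v); first by rewrite !compA e.
by rewrite -(hu u) // -(hu v).
Qed.

Lemma pullback_intro a b c p (f : hom a c) (g : hom b c) (pa : hom p a)
    (pb : hom p b) : f ∘ pa = g ∘ pb ->
  (forall T (u : hom T a) (v : hom T b), f ∘ u = g ∘ v ->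
     exists h, pa ∘ h = u /\ pb ∘ h = v) ->
  (forall T (u v : hom T p), pa ∘ u = pa ∘ v -> pb ∘ u = pb ∘ v -> u = v) ->
  is_pullback f g pa pb.
Proof.
move=> e ex mono; split=> // T u v /ex [h [h1 h2]].
by exists h; split=> // h' [h1' h2']; apply: mono; rewrite ?h1 ?h2.
Qed.

Lemma iso_pullback_id a c (q : hom a c) : is_pullback q (idm c) (idm a) q.
Proof.
apply: pullback_intro; first by rewrite compm1 comp1m.
- by move=> T u v; rewrite comp1m => <-; exists u; rewrite comp1m.
- by move=> T u v; rewrite !comp1m.
Qed.

Lemma limit_mono (I : category) (F0 : I -> C) (F : functor I C F0) L
    (c : forall i, hom L (F0 i)) : is_limit F c -> forall T (f g : hom T L),
  (forall i, c i ∘ f = c i ∘ g) -> f = g.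
Proof.
move=> [cc H] T f g e; have [|h [_ hu]] := H T (fun i => c i ∘ g).
  by move=> i j k /=; rewrite compA cc.
by rewrite -(hu f e) -(hu g).
Qed.

Definition is_pushout a b c p (f : hom c a) (g : hom c b) (ia : hom a p)
    (ib : hom b p) : Prop :=
  ia ∘ f = ib ∘ g /\
  forall T (u : hom a T) (v : hom b T), u ∘ f = v ∘ g ->
    exists! h : hom p T, h ∘ ia = u /\ h ∘ ib = v.

Lemma pushout_ex a b c p (f : hom c a) (g : hom c b) (ia : hom a p)
    (ib : hom b p) : is_pushout f g ia ib ->
  forall T (u : hom a T) (v : hom b T), u ∘ f = v ∘ g ->
  exists h, h ∘ ia = u /\ h ∘ ib = v.
Proof. by move=> [_ H] T u v /H [h [h1 _]]; exists h. Qed.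

Lemma pushout_mono a b c p (f : hom c a) (g : hom c b) (ia : hom a p)
    (ib : hom b p) : is_pushout f g ia ib ->
  forall T (u v : hom p T), u ∘ ia = v ∘ ia -> u ∘ ib = v ∘ ib -> u = v.
Proof.
move=> [e H] T u v ea eb.
have [|h [_ hu]] := H T (v ∘ ia) (v ∘ ib); first by rewrite -!compA e.
by rewrite -(hu u) // -(hu v).
Qed.

Lemma coproduct2_ex a b s (i1 : hom a s) (i2 : hom b s) :
  is_coproduct2 i1 i2 -> forall T (u : hom a T) (v : hom b T),
  exists h, h ∘ i1 = u /\ h ∘ i2 = v.
Proof. by move=> H T u v; have [h [h1 _]] := H T u v; exists h. Qed.

Lemma coproduct2_mono a b s (i1 : hom a s) (i2 : hom b s) :
  is_coproduct2 i1 i2 -> forall T (u v : hom s T),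
  u ∘ i1 = v ∘ i1 -> u ∘ i2 = v ∘ i2 -> u = v.
Proof.
move=> H T u v e1 e2; have [h [_ hu]] := H T (v ∘ i1) (v ∘ i2).
by rewrite -(hu u) // -(hu v).
Qed.

Lemma product2_ex a b s (i1 : hom s a) (i2 : hom s b) :
  is_product2 i1 i2 -> forall T (u : hom T a) (v : hom T b),
  exists h, i1 ∘ h = u /\ i2 ∘ h = v.
Proof. by move=> H T u v; have [h [h1 _]] := H T u v; exists h. Qed.

Lemma product2_mono a b s (i1 : hom s a) (i2 : hom s b) :
  is_product2 i1 i2 -> forall T (u v : hom T s),
  i1 ∘ u = i1 ∘ v -> i2 ∘ u = i2 ∘ v -> u = v.
Proof.
move=> H T u v e1 e2; have [h [_ hu]] := H T (i1 ∘ v) (i2 ∘ v).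
by rewrite -(hu u) // -(hu v).
Qed.

End CategoryBasics.

(** * Products, pullbacks and pushouts as limits and colimits of finite diagrams *)

Definition thin_cat (I : Type) (r : I -> I -> bool)
  (rr : forall i, r i i) (rt : forall i j l, r j l -> r i j -> r i l) : category :=
  @Category I (@CatOn I (fun i j => is_true (r i j)) rr
    (fun i j l => @rt i j l)
    (fun _ _ _ => bool_irrelevance _ _) (fun _ _ _ => bool_irrelevance _ _)
    (fun _ _ _ _ _ _ _ => bool_irrelevance _ _)).

Lemma cospan_refl (i : option bool) : (i == None) || (i == i).
Proof. by rewrite eqxx orbT. Qed.
Lemma cospan_trans (i j l : option bool) :
  (l == None) || (j == l) -> (j == None) || (i == j) -> (l == None) || (i == l).
Proof. by case: i j l => [[]|] [[]|] [[]|]. Qed.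
Lemma span_trans (i j l : option bool) :
  (j == None) || (l == j) -> (i == None) || (j == i) -> (i == None) || (l == i).
Proof. by case: i j l => [[]|] [[]|] [[]|]. Qed.

(** [None] is the vertex of the diagram: it receives an arrow from every object of [cospan] and
    sends one to every object of [span]. *)
Definition cospan : category := thin_cat cospan_refl cospan_trans.
Definition span : category := thin_cat cospan_refl span_trans.

Lemma finite_subsingleton (T : Type) : (forall a b : T, a = b) ->
  finite_set [set: T].
Proof.
move=> s; have [[a]|n] := pselect (inhabited T).
  by rewrite (_ : setT = [set a]) //; apply/seteqP; split=> b //= _; apply: s.
by rewrite (_ : setT = set0) //; apply/seteqP; split=> b //= _; case: n.
Qed.

Lemma cospan_finite : finite_category cospan.
Proof.
split; first exact: (@finite_finset (option bool)).
by move=> i j; apply: finite_subsingleton => a b; apply: bool_irrelevance.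
Qed.

Lemma span_finite : finite_category span.
Proof.
split; first exact: (@finite_finset (option bool)).
by move=> i j; apply: finite_subsingleton => a b; apply: bool_irrelevance.
Qed.

Definition discrete (I : Type) : category :=
  @Category I (@CatOn I (fun i j => i = j) (fun i => erefl)
    (fun i j l h g => etrans g h)
    (fun _ _ _ => Prop_irrelevance _ _) (fun _ _ _ => Prop_irrelevance _ _)
    (fun _ _ _ _ _ _ _ => Prop_irrelevance _ _)).

Section FiniteLimits.
Variable E : model_category.

Lemma product_exists (I : Type) (X : I -> E) : finite_set [set: I] ->
  exists P (pr : forall i, hom P (X i)), is_product pr.
Proof.
move=> fI.
have @F : functor (discrete I) E X.
  refine (@Functor (discrete I) E X
    (fun i j e => match e in _ = j return hom (X i) (X j) with erefl => idm _ end)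
    _ _) => //.
  by move=> i j l g f; case: l / g; rewrite comp1m; case: j / f.
have [|L [c [cc cl]]] := @mc_limits E (discrete I) X F.
  by split=> // i j; apply: finite_subsingleton => a b;
    apply: (@Prop_irrelevance (i = j :> I)).
exists L, c => T f; apply: cl => i j g; case: j / g; exact: comp1m.
Qed.

Section Pullback.
Variables (a b c : E) (f : hom a c) (g : hom b c).

Definition cospan_ob (i : cospan) : E :=
  match i with Some true => a | Some false => b | None => c end.

Definition cospan_map (i j : cospan) :
    hom i j -> hom (cospan_ob i) (cospan_ob j) :=
  match i, j return @hom cospan i j -> hom (cospan_ob i) (cospan_ob j) with
  | None, None => fun _ => idm c
  | Some true, None => fun _ => f
  | Some false, None => fun _ => g
  | Some true, Some true => fun _ => idm a
  | Some false, Some false => fun _ => idm b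
  | _, _ => fun h => False_rect _ (notF h)
  end.

Lemma pullback_exists :
  exists p (pa : hom p a) (pb : hom p b), is_pullback f g pa pb.
Proof.
have @F : functor cospan E cospan_ob.
  refine (@Functor cospan E cospan_ob cospan_map _ _).
    by case=> [[]|].
  by case=> [[]|] [[]|] [[]|] //= h h'; rewrite /cospan_map ?comp1m ?compm1 //;
    (case: (notF h) || case: (notF h')).
have [L [cn [cc cl]]] := mc_limits F cospan_finite.
exists L, (cn (Some true)), (cn (Some false)).
have ea : f ∘ cn (Some true) = cn None := cc (Some true) None isT.
have eb : g ∘ cn (Some false) = cn None := cc (Some false) None isT.
split=> [|T u v e]; first by rewrite ea eb.
have [|h [h1 h2]] := cl T (fun i : cospan =>
    match i return hom T (cospan_ob i) with
    | Some true => u | Some false => v | None => f ∘ u end).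
  by case=> [[]|] [[]|] //= h; rewrite /cospan_map ?comp1m //; case: (notF h).
exists h; split; first by split; [apply: (h1 (Some true))|apply: (h1 (Some false))].
move=> h' [e1 e2]; apply: h2; case=> [[]|] //.
by rewrite -ea -compA e1.
Qed.

End Pullback.

Section Pushout.
Variables (a b c : E) (f : hom c a) (g : hom c b).

Definition span_map (i j : span) :
    hom i j -> hom (cospan_ob a b c i) (cospan_ob a b c j) :=
  match i, j return @hom span i j ->
    hom (cospan_ob a b c i) (cospan_ob a b c j) with
  | None, None => fun _ => idm c
  | None, Some true => fun _ => f
  | None, Some false => fun _ => g
  | Some true, Some true => fun _ => idm a
  | Some false, Some false => fun _ => idm b
  | _, _ => fun h => False_rect _ (notF h)
  end.

Lemma pushout_exists :
  exists p (ia : hom a p) (ib : hom b p), is_pushout f g ia ib.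
Proof.
have @F : functor span E (cospan_ob a b c).
  refine (@Functor span E (cospan_ob a b c) span_map _ _).
    by case=> [[]|].
  by case=> [[]|] [[]|] [[]|] //= h h'; rewrite /span_map ?comp1m ?compm1 //;
    (case: (notF h) || case: (notF h')).
have [L [cn [cc cl]]] := mc_colimits F span_finite.
exists L, (cn (Some true)), (cn (Some false)).
have ea : cn (Some true) ∘ f = cn None := cc None (Some true) isT.
have eb : cn (Some false) ∘ g = cn None := cc None (Some false) isT.
split=> [|T u v e]; first by rewrite ea eb.
have [|h [h1 h2]] := cl T (fun i : span =>
    match i return hom (cospan_ob a b c i) T with
    | Some true => u | Some false => v | None => u ∘ f end).
  by case=> [[]|] [[]|] //= h; rewrite /span_map ?compm1 //; case: (notF h).
exists h; split; first by split; [apply: (h1 (Some true))|apply: (h1 (Some false))].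
move=> h' [e1 e2]; apply: h2; case=> [[]|] //.
by rewrite -ea compA e1.
Qed.

End Pushout.
End FiniteLimits.

(** * Homotopies in a pointed model category *)

Section ModelBasics.
Variable E : model_category.
Implicit Types a b c d : E.

(** Retract argument: a lift of [i] against the acyclic fibration of its own factorization exhibits
    [i] as a retract of the cofibration in it. *)
Lemma cof_of_llp a b (i : hom a b) :
  (forall c d (p : hom c d), fib p -> weq p -> has_lifting i p) -> cof i.
Proof.
move=> H; have [c [j [p [cj fp wp e]]]] := mc_factor_afib i.
have [|h [h1 h2]] := H _ _ p fp wp j (idm b); first by rewrite -e comp1m.
have [_ + _] : [/\ weq j -> weq i, cof j -> cof i & fib j -> fib i].
  by apply: mc_retract; exists (idm a), (idm a), h, p; split=> //;
    rewrite ?comp1m ?compm1.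
exact.
Qed.

Lemma acof_of_llp a b (i : hom a b) :
  (forall c d (p : hom c d), fib p -> has_lifting i p) -> acof i.
Proof.
move=> H; have [c [j [p [cj wj fp e]]]] := mc_factor_acof i.
have [|h [h1 h2]] := H _ _ p fp j (idm b); first by rewrite -e comp1m.
have [wi ci _] : [/\ weq j -> weq i, cof j -> cof i & fib j -> fib i].
  by apply: mc_retract; exists (idm a), (idm a), h, p; split=> //;
    rewrite ?comp1m ?compm1.
by split; [apply: ci|apply: wi].
Qed.

(** Equivalent to being a fibration by the next two lemmas. In this form closure under composition,
    pullback and products is immediate from the universal properties. *)
Definition rlp c d (p : hom c d) : Prop :=
  forall a b (i : hom a b), acof i -> has_lifting i p.

Lemma fib_rlp c d (p : hom c d) : fib p -> rlp p.
Proof. by move=> fp a b i [ci wi]; apply: mc_lifting => //; left. Qed.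

Lemma fib_of_rlp c d (p : hom c d) : rlp p -> fib p.
Proof.
move=> H; have [b [j [q [cj wj fq e]]]] := mc_factor_acof p.
have [|h [h1 h2]] := H _ _ j (conj cj wj) (idm c) q; first by rewrite compm1.
have [_ _] : [/\ weq q -> weq p, cof q -> cof p & fib q -> fib p].
  by apply: mc_retract; exists j, h, (idm d), (idm d); split=> //;
    rewrite ?comp1m ?compm1.
exact.
Qed.

Lemma weq_id a : weq (idm a).
Proof.
have [c [j [p [cj wj fp e]]]] := mc_factor_acof (idm a).
have [+ _ _] : [/\ weq j -> weq (idm a), cof j -> cof (idm a) & fib j -> fib (idm a)].
  by apply: mc_retract; exists (idm a), (idm a), j, p; split=> //;
    rewrite ?comp1m ?compm1.
exact.
Qed.

Lemma cof_id a : cof (idm a).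
Proof. by apply: cof_of_llp => c d p _ _ u v; rewrite compm1 => e; exists u; rewrite compm1. Qed.

Lemma cof_comp a b c (j : hom b c) (i : hom a b) : cof i -> cof j -> cof (j ∘ i).
Proof.
move=> ai aj; apply: cof_of_llp => x y p fp wp u v e.
have [|h [h1 h2]] := mc_lifting ai fp (or_intror wp) (u := u) (v := v ∘ j).
  by rewrite e compA.
have [g [g1 g2]] := mc_lifting aj fp (or_intror wp) h2.
by exists g; rewrite compA g1.
Qed.

Lemma rlp_comp a b c (p : hom a b) (q : hom b c) : rlp p -> rlp q -> rlp (q ∘ p).
Proof.
move=> rp rq x y i ai u v e.
have [|h [h1 h2]] := rq _ _ i ai (p ∘ u) v; first by rewrite compA e.
have [|g [g1 g2]] := rp _ _ i ai u h; first by [].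
by exists g; rewrite -compA g2.
Qed.

Lemma rlp_pullback a b c p (f : hom a c) (g : hom b c) (pa : hom p a)
  (pb : hom p b) : is_pullback f g pa pb -> rlp f -> rlp pb.
Proof.
move=> H rf x y i ai u v e.
have [|h [h1 h2]] := rf _ _ i ai (pa ∘ u) (g ∘ v).
  by rewrite compA (pullback_comm H) -!compA e.
have [k [k1 k2]] := pullback_ex H h2.
exists k; split=> //; apply: (pullback_mono H); first by rewrite compA k1 h1.
by rewrite compA k2 -e.
Qed.

Lemma rlp_product (I : Type) (X Y : I -> E) (f : forall i, hom (X i) (Y i))
    P Q (pr : forall i, hom P (X i)) (qr : forall i, hom Q (Y i)) (g : hom P Q) :
  is_product pr -> is_product qr -> (forall i, qr i ∘ g = f i ∘ pr i) ->
  (forall i, rlp (f i)) -> rlp g.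
Proof.
move=> HP HQ e rf x y i ai u v euv.
have /dep_choice [h hP] : forall j, exists h, h ∘ i = pr j ∘ u /\ f j ∘ h = qr j ∘ v.
  by move=> j; apply: rf => //; rewrite compA -e -compA euv compA.
have [k kP] := product_ex HP h.
exists k; split.
- by apply: (product_mono HP) => j; rewrite compA kP; case: (hP j).
- by apply: (product_mono HQ) => j; rewrite compA e -compA kP; case: (hP j).
Qed.

Lemma rlp_iso a b b' (p : hom a b) (f : hom b b') (g : hom b' b) :
  f ∘ g = idm b' -> g ∘ f = idm b -> rlp p -> rlp (f ∘ p).
Proof.
move=> fg gf rp x y i ai u v e.
have [|h [h1 h2]] := rp _ _ i ai u (g ∘ v).
  by rewrite -compA -e !compA gf comp1m.
by exists h; split=> //; rewrite -compA h2 compA fg comp1m.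
Qed.

Lemma acof_pushout a b c p (f : hom c a) (g : hom c b) (ia : hom a p)
  (ib : hom b p) : is_pushout f g ia ib -> acof g -> acof ia.
Proof.
move=> H ag; apply: acof_of_llp => x y q fq u v e.
have [|h [h1 h2]] := fib_rlp fq ag (u := u ∘ f) (v := v ∘ ib).
  by rewrite compA e -!compA (proj1 H).
have [|k [k1 k2]] := pushout_ex H (u := u) (v := h); first by rewrite h1.
exists k; split=> //; apply: (pushout_mono H); rewrite -compA ?k1 ?k2 //.
Qed.

Lemma fibrant_extend a b c (i : hom a b) (u : hom a c) :
  acof i -> fibrant c -> exists h : hom b c, h ∘ i = u.
Proof.
move=> ai [z [q [tz fq]]]; have [v [_ _]] := tz b.
have [|h [h1 _]] := fib_rlp fq ai (u := u) (v := v); first exact: terminal_eq.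
by exists h.
Qed.

Lemma cofibrant_lift a c d (p : hom c d) (u : hom a d) :
  cofibrant a -> fib p -> weq p -> exists h : hom a c, p ∘ h = u.
Proof.
move=> [z [i [iz ci]]] fp wp; have [v [_ _]] := iz c.
have [|h [_ h2]] := mc_lifting ci fp (or_intror wp) (u := v) (v := u).
  exact: initial_eq.
by exists h.
Qed.

Lemma fibrant_total a b (p : hom a b) : rlp p -> fibrant b -> fibrant a.
Proof.
move=> rp [z [q [tz fq]]]; exists z, (q ∘ p); split=> //.
by apply: fib_of_rlp; apply: rlp_comp => //; apply: fib_rlp.
Qed.

End ModelBasics.

(** * Cylinders, path objects and homotopy classes *)

Section Homotopies.
Variable E : pointed_model_category.
Implicit Types a b c d : E.

Lemma zero_object_bifibrant : exists z : E, [/\ is_zero z, fibrant z & cofibrant z].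
Proof.
have [z [tz iz]] := pm_zero E; exists z; split=> //.
- exists z, (idm z); split=> //; apply: fib_of_rlp => a b i ai u v e.
  by exists v; split; apply: terminal_eq.
- by exists z, (idm z); split=> //; apply: cof_id.
Qed.

Lemma zero_map_exists a b : exists f : hom a b, is_zero_map f.
Proof.
have [z zz] := pm_zero E; have [p [_ _]] := proj1 zz a; have [i [_ _]] := proj2 zz b.
by exists (i ∘ p), z, p, i.
Qed.

Lemma product2_exists a b : exists p (p1 : hom p a) (p2 : hom p b), is_product2 p1 p2.
Proof.
have [z [tz iz]] := pm_zero E.
have [[f [_ _]] [g [_ _]]] := (tz a, tz b).
have [p [pa [pb H]]] := pullback_exists f g.
by exists p, pa, pb => T u v; apply: (proj2 H); apply: terminal_eq.
Qed.

Lemma coproduct2_exists a b :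
  exists p (p1 : hom a p) (p2 : hom b p), is_coproduct2 p1 p2.
Proof.
have [z [tz iz]] := pm_zero E.
have [[f [_ _]] [g [_ _]]] := (iz a, iz b).
have [p [pa [pb H]]] := pushout_exists f g.
by exists p, pa, pb => T u v; apply: (proj2 H); apply: initial_eq.
Qed.

Record cylinder a := Cylinder {
  cy_sum : E; cy_ob :> E;
  cy_1 : hom a cy_sum; cy_2 : hom a cy_sum;
  cy_in : hom cy_sum cy_ob; cy_w : hom cy_ob a;
  cy_i1 : hom a cy_ob; cy_i2 : hom a cy_ob;
  cy_in1 : cy_in ∘ cy_1 = cy_i1; cy_in2 : cy_in ∘ cy_2 = cy_i2;
  cy_sumP : is_coproduct2 cy_1 cy_2;
  cy_cof : cof cy_in; cy_weq : weq cy_w;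
  cy_wi1 : cy_w ∘ cy_i1 = idm a;
  cy_wi2 : cy_w ∘ cy_i2 = idm a }.

(** The cylinder is prescribed because homotopies between the components of two maps into a product
    combine only if they share it. *)
Definition homotopic_by a (K : cylinder a) b (f g : hom a b) : Prop :=
  exists h : hom K b, h ∘ cy_i1 K = f /\ h ∘ cy_i2 K = g.

Lemma left_homotopicP a b (f g : hom a b) :
  left_homotopic f g <-> exists K : cylinder a, homotopic_by K f g.
Proof.
split=> [[aa [cyl [i1 [i2 [i [w [h [H1 H2 H3 [H4 H5] H6]]]]]]]]|[K [h H6]]].
  by exists (Cylinder erefl erefl H1 H2 H3 H4 H5), h.
exists (cy_sum K), K, (cy_1 K), (cy_2 K), (cy_in K), (cy_w K), h.
rewrite !cy_in1 !cy_in2; split=> //; [exact: cy_sumP|exact: cy_cof|exact: cy_weq|].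
by split; [exact: cy_wi1|exact: cy_wi2].
Qed.

Lemma cylinder_exists a : inhabited (cylinder a).
Proof.
have [s [i1 [i2 H]]] := coproduct2_exists a a.
have [h [h1 h2]] := coproduct2_ex H (idm a) (idm a).
have [c [i [p [ci fp wp e]]]] := mc_factor_afib h.
by apply: inhabits;
  apply: (@Cylinder a s c i1 i2 i p (i ∘ i1) (i ∘ i2) erefl erefl H ci wp);
  rewrite compA -e.
Qed.

(** The inclusion of one summand into [a + a] is a cofibration since a lift on the other summand
    exists by cofibrancy of [a]; the end is a weak equivalence as a section of [cy_w]. *)
Lemma cylinder_acof a (K : cylinder a) : cofibrant a -> acof (cy_i1 K).
Proof.
move=> ca; split; last first.
  by apply: (mc_weq_right (g := cy_w K)); [apply: cy_weq|rewrite cy_wi1; apply: weq_id].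
rewrite -cy_in1; apply: cof_comp; last exact: cy_cof.
apply: cof_of_llp => c d p fp wp u v e.
have [h hP] := cofibrant_lift (v ∘ cy_2 K) ca fp wp.
have [k [k1 k2]] := coproduct2_ex (cy_sumP K) u h.
by exists k; split=> //; apply: (coproduct2_mono (cy_sumP K));
  rewrite -compA ?k1 ?k2.
Qed.

Definition cylinder_swap a (K : cylinder a) : cylinder a :=
  @Cylinder a (cy_sum K) K (cy_2 K) (cy_1 K) (cy_in K) (cy_w K) (cy_i2 K) (cy_i1 K)
    (cy_in2 K) (cy_in1 K)
    (fun T f g =>
       let: ex_intro h (conj (conj h1 h2) hu) := cy_sumP K g f in
       ex_intro _ h (conj (conj h2 h1) (fun h' e => hu h' (conj (proj2 e) (proj1 e)))))
    (cy_cof K) (cy_weq K) (cy_wi2 K) (cy_wi1 K).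

Section Cofibrant.
Variables (a : E) (ca : cofibrant a).

Lemma left_homotopic_refl b (f : hom a b) : left_homotopic f f.
Proof.
have [K] := cylinder_exists a; apply/left_homotopicP; exists K, (f ∘ cy_w K).
by rewrite -!compA cy_wi1 cy_wi2 compm1.
Qed.

Lemma left_homotopic_sym b (f g : hom a b) : left_homotopic f g -> left_homotopic g f.
Proof.
move=> /left_homotopicP [K [h [h1 h2]]].
by apply/left_homotopicP; exists (cylinder_swap K), h.
Qed.

Lemma left_homotopic_comp b c (p : hom b c) (f g : hom a b) :
  left_homotopic f g -> left_homotopic (p ∘ f) (p ∘ g).
Proof.
move=> /left_homotopicP [K [h [h1 h2]]].
by apply/left_homotopicP; exists K, (p ∘ h); rewrite -!compA h1 h2.
Qed.

(* Two cylinders are glued along a common end; the result need not be cofibrant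
   under [a + a] and is replaced by a factorization. *)
Lemma left_homotopic_trans b (f g h : hom a b) :
  left_homotopic f g -> left_homotopic g h -> left_homotopic f h.
Proof.
move=> /left_homotopicP [K [u [u1 u2]]] /left_homotopicP [L [v [v1 v2]]].
have aL := cylinder_acof L ca.
have [G [iK [iL H]]] := pushout_exists (cy_i2 K) (cy_i1 L).
have [|k [k1 k2]] := pushout_ex H (u := u) (v := v); first by rewrite u2 v1.
have [|w [w1 w2]] := pushout_ex H (u := cy_w K) (v := cy_w L).
  by rewrite cy_wi1 cy_wi2.
have [_ wiK] := acof_pushout H aL.
have ww : weq w by apply: mc_weq_left wiK _; rewrite w1; apply: cy_weq.
have [m [m1 m2]] := coproduct2_ex (cy_sumP K) (iK ∘ cy_i1 K) (iL ∘ cy_i2 L).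
have [c [i [p [ci fp wp e]]]] := mc_factor_afib m.
apply/left_homotopicP.
have e1 : (w ∘ p) ∘ (i ∘ cy_1 K) = idm a.
  by rewrite -compA (compA p) -e m1 compA w1 cy_wi1.
have e2 : (w ∘ p) ∘ (i ∘ cy_2 K) = idm a.
  by rewrite -compA (compA p) -e m2 compA w2 cy_wi2.
exists (Cylinder erefl erefl (cy_sumP K) ci (mc_weq_comp wp ww) e1 e2), (k ∘ p).
by rewrite /= -!compA !(compA p) -e m1 m2 !compA k1 k2.
Qed.

(** A map from the cylinder to [P] is lifted from one end, where it is the constant path [w ∘ f],
    over the pair formed by the constant homotopy at [f] and the given homotopy [h]. Its restriction
    to the other end is the required map. *)
Lemma path_lift b (P bb : E) (p1 p2 : hom bb b) (p : hom P bb) (w : hom b P)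
    (f g : hom a b) : is_product2 p1 p2 -> fib p ->
  (p1 ∘ p) ∘ w = idm b -> (p2 ∘ p) ∘ w = idm b ->
  left_homotopic f g ->
  exists h : hom a P, (p1 ∘ p) ∘ h = f /\ (p2 ∘ p) ∘ h = g.
Proof.
move=> HP fp w1 w2 /left_homotopicP [K [h [h1 h2]]].
have [v [v1 v2]] := product2_ex HP (f ∘ cy_w K) h.
have [|k [k1 k2]] := fib_rlp fp (cylinder_acof K ca) (u := w ∘ f) (v := v).
  apply: (product2_mono HP); rewrite !compA ?w1 ?w2 ?v1 ?v2 comp1m ?h1 //.
  by rewrite -compA cy_wi1 compm1.
exists (k ∘ cy_i2 K); rewrite !compA -!(compA _ p k) k2 v1 v2; split=> //.
by rewrite -compA cy_wi2 compm1.
Qed.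

Lemma left_right_homotopic b (f g : hom a b) : left_homotopic f g -> right_homotopic f g.
Proof.
move=> H; have [bb [p1 [p2 HP]]] := product2_exists b b.
have [dg [d1 d2]] := product2_ex HP (idm b) (idm b).
have [P [w [p [cw ww fp e]]]] := mc_factor_acof dg.
have e1 : (p1 ∘ p) ∘ w = idm b by rewrite -compA -e.
have e2 : (p2 ∘ p) ∘ w = idm b by rewrite -compA -e.
have [h [h1 h2]] := path_lift HP fp e1 e2 H.
by exists bb, P, p1, p2, p, w, h.
Qed.

Lemma homotopicE b (f g : hom a b) : homotopic f g <-> left_homotopic f g.
Proof. by split=> [[]//|H]; split=> //; apply: left_right_homotopic. Qed.

(** Fibrancy of [b] makes [p1 ∘ p] an acyclic fibration, so the inclusion of both ends of any
    cylinder lifts against it. Hence the choice of cylinder is immaterial for maps into fibrant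
    objects. *)
Lemma right_homotopic_by (K : cylinder a) b (f g : hom a b) : fibrant b ->
  right_homotopic f g -> homotopic_by K f g.
Proof.
move=> fb [bb [P [p1 [p2 [p [w [h [HP fp ww [w1 w2] [h1 h2]]]]]]]]].
have wp : weq (p1 ∘ p) by apply: mc_weq_left ww _; rewrite w1; apply: weq_id.
have fp1 : fib (p1 ∘ p).
  apply: fib_of_rlp; apply: rlp_comp; first exact: fib_rlp.
  (* The projection [p1] is a fibration: the second coordinate of a lift extends because [b] is
     fibrant. *)
  move=> x y i ai u v e; have [k kP] := fibrant_extend (p2 ∘ u) ai fb.
  have [l [l1 l2]] := product2_ex HP v k.
  by exists l; split=> //; apply: (product2_mono HP);
    rewrite compA ?l1 ?l2 ?kP ?e.
have [s [s1 s2]] := coproduct2_ex (cy_sumP K) (w ∘ f) h.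
have [|k [k1 k2]] := mc_lifting (cy_cof K) fp1 (or_intror wp)
    (u := s) (v := f ∘ cy_w K).
  apply: (coproduct2_mono (cy_sumP K)).
    by rewrite -!compA s1 cy_in1 cy_wi1 compm1 (compA p1) compA w1 comp1m.
  by rewrite -compA s2 h1 -!compA cy_in2 cy_wi2 compm1.
exists ((p2 ∘ p) ∘ k); rewrite -cy_in1 -cy_in2 -!(compA _ k) !(compA k) k1 s1 s2; split=> //.
by rewrite compA w2 comp1m.
Qed.

Lemma left_homotopic_by (K : cylinder a) b (f g : hom a b) : fibrant b ->
  left_homotopic f g <-> homotopic_by K f g.
Proof.
move=> fb; split=> [/left_right_homotopic|H]; first exact: right_homotopic_by.
by apply/left_homotopicP; exists K.
Qed.

Lemma homotopic_by_product (K : cylinder a) (I : Type) (X : I -> E) P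
    (pr : forall i, hom P (X i)) (f g : hom a P) : is_product pr ->
  (forall i, homotopic_by K (pr i ∘ f) (pr i ∘ g)) -> homotopic_by K f g.
Proof.
move=> HP /dep_choice [h hP]; have [k kP] := product_ex HP h.
by exists k; split; apply: (product_mono HP) => i; rewrite compA kP; case: (hP i).
Qed.

Lemma homotopy_lifting b c (p : hom b c) (f : hom a b) (g : hom a c) : rlp p ->
  left_homotopic (p ∘ f) g -> exists f', left_homotopic f f' /\ p ∘ f' = g.
Proof.
move=> rp /left_homotopicP [K [h [h1 h2]]].
have [|k [k1 k2]] := rp _ _ _ (cylinder_acof K ca) f h; first by [].
exists (k ∘ cy_i2 K); split; last by rewrite compA k2.
by apply/left_homotopicP; exists K, k.
Qed.

Lemma homotopy_class_eq b (f g : hom a b) :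
  homotopy_class f = homotopy_class g <-> left_homotopic f g.
Proof.
split=> [e|H].
  have : homotopy_class g g by apply/homotopicE; apply: left_homotopic_refl.
  by rewrite -e => /homotopicE.
apply/seteqP; split=> h /homotopicE H'; apply/homotopicE.
  by apply: left_homotopic_trans H'; apply: left_homotopic_sym.
exact: left_homotopic_trans H'.
Qed.

(** Lifting along [i] into a path object of [c] gives a right homotopy from [u] to [v]. It becomes a
    left homotopy after precomposition with [t], whose source is cofibrant. *)
Lemma extension_homotopic b r c (i : hom b r) (u v : hom r c) (t : hom a r) :
  acof i -> fibrant c -> u ∘ i = v ∘ i -> left_homotopic (u ∘ t) (v ∘ t).
Proof.
move=> ai fc e.
have [cc [p1 [p2 HP]]] := product2_exists c c.
have [dg [d1 d2]] := product2_ex HP (idm c) (idm c).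
have [P [w [p [cw ww fp ep]]]] := mc_factor_acof dg.
have [uv [e1 e2]] := product2_ex HP u v.
have [|k [k1 k2]] := fib_rlp fp ai (u := w ∘ (u ∘ i)) (v := uv).
  by apply: (product2_mono HP); rewrite !(compA p w) -ep !compA ?d1 ?d2 ?e1 ?e2
    comp1m // e.
have [K] := cylinder_exists a; apply/(left_homotopic_by K) => //.
apply: right_homotopic_by => //.
exists cc, P, p1, p2, p, w, (k ∘ t); split=> //.
  by rewrite -!compA -ep.
by rewrite !compA -!(compA _ p k) k2 e1 e2.
Qed.

(* Factoring [f] reduces surjectivity and injectivity to those of an acyclic
   fibration, along which maps and homotopies lift, and of an acyclic cofibration
   between fibrant objects, which has a homotopy inverse. *)
Lemma weq_homotopy_bijective c d (f : hom c d) : fibrant c -> fibrant d -> weq f ->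
  (forall t : hom a d, exists s, left_homotopic (f ∘ s) t) /\
  (forall s s' : hom a c, left_homotopic (f ∘ s) (f ∘ s') -> left_homotopic s s').
Proof.
move=> fc fd wf; have [x [j [p [cj wj fp e]]]] := mc_factor_acof f.
have wp : weq p by apply: mc_weq_left wj _; rewrite -e.
have fx : fibrant x by apply: fibrant_total fd; apply: fib_rlp; exact: fp.
have [r rj] := fibrant_extend (idm c) (conj cj wj) fc.
split=> [t|s s'].
  have [t' t'P] := cofibrant_lift t ca fp wp.
  exists (r ∘ t'); rewrite e -compA -t'P; apply: left_homotopic_comp.
  rewrite compA -{2}(comp1m t'); apply: extension_homotopic (conj cj wj) fx _.
  by rewrite -compA rj compm1 comp1m.
move=> /left_homotopicP [K [h [h1 h2]]].
have [k [k1 k2]] := coproduct2_ex (cy_sumP K) (j ∘ s) (j ∘ s').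
have [|l [l1 l2]] := mc_lifting (cy_cof K) fp (or_intror wp) (u := k) (v := h).
  apply: (coproduct2_mono (cy_sumP K)); rewrite -!compA.
    by rewrite k1 cy_in1 h1 compA -e.
  by rewrite k2 cy_in2 h2 compA -e.
apply/left_homotopicP; exists K, (r ∘ l); rewrite -cy_in1 -cy_in2.
by rewrite -!compA !(compA l) l1 k1 k2 !compA rj !comp1m.
Qed.

End Cofibrant.
End Homotopies.

(** * Maps in the homotopy category *)

Section HomotopyCategory.
Variables (E : pointed_model_category) (H : homotopy_category E).
Implicit Types a b c d : E.

Definition loc a b (f : hom a b) : @hom (ho H) a b := ho_loc H a b f.

Lemma loc_comp a b c (g : hom b c) (f : hom a b) : loc (g ∘ f) = loc g ∘ loc f.
Proof. exact: (fmap_comp (ho_loc H)). Qed.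

Lemma loc_id a : loc (idm a) = idm (a : ho H).
Proof. exact: (fmap_id (ho_loc H)). Qed.

(** Both ends of a cylinder are sections of [cy_w], which the localization inverts, so they have the
    same class. *)
Lemma loc_homotopic a b (f g : hom a b) : left_homotopic f g -> loc f = loc g.
Proof.
move=> /left_homotopicP [K [h [<- <-]]].
have [v [v1 v2]] := ho_weq H (cy_weq K).
have e : loc (cy_i1 K) = loc (cy_i2 K).
  rewrite -(comp1m (loc (cy_i1 K))) -(comp1m (loc (cy_i2 K))) -v1 -!compA.
  by rewrite -!loc_comp cy_wi1 cy_wi2.
by rewrite !loc_comp e.
Qed.

(** * Comparison of the localization with homotopy classes of maps out of a cofibrant object *)

Section Representable.
Variables (a : E) (ca : cofibrant a).

(** The replacements are chosen object by object, without functoriality; this is why the action of a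
    map on them is the relation [induced] and not a function. *)
Lemma fibrant_replacement :
  exists (R : E -> E) (r : forall b, hom b (R b)) (v : forall b, @hom (ho H) (R b) b),
  [/\ forall b, acof (r b), forall b, fibrant (R b),
      forall b, v b ∘ loc (r b) = idm (b : ho H)
    & forall b, loc (r b) ∘ v b = idm (R b : ho H)].
Proof.
have [z [tz iz]] := pm_zero E.
have /choice [R /dep_choice [r rP]] : forall b, exists c, exists r : hom b c,
    acof r /\ fibrant c.
  move=> b; have [t [_ _]] := tz b.
  have [c [i [p [ci wi fp e]]]] := mc_factor_acof t.
  by exists c, i; split=> //; exists z, p.
have /dep_choice [v vP] : forall b, exists v : @hom (ho H) (R b) b,
    v ∘ loc (r b) = idm (b : ho H) /\ loc (r b) ∘ v = idm (R b : ho H).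
  by move=> b; have [[_ /(ho_weq H)]] := rP b.
by exists R, r, v; split=> b; case: (rP b); case: (vP b).
Qed.

Section Replacement.
Variables (R : E -> E) (r : forall b, hom b (R b)).
Variable v : forall b, @hom (ho H) (R b) b.
Hypotheses (ar : forall b, acof (r b)) (fR : forall b, fibrant (R b)).
Hypothesis vr : forall b, v b ∘ loc (r b) = idm (b : ho H).
Hypothesis rv : forall b, loc (r b) ∘ v b = idm (R b : ho H).

Lemma replacement_naturality b c (f : hom b c) (g : hom (R b) (R c)) (t : hom a (R b)) :
  g ∘ r b = r c ∘ f -> v c ∘ loc (g ∘ t) = loc f ∘ (v b ∘ loc t).
Proof.
move=> e; rewrite loc_comp.
have -> : loc g = loc (r c) ∘ (loc f ∘ v b).
  by rewrite compA -loc_comp -e loc_comp -compA rv compm1.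
by rewrite !compA vr comp1m.
Qed.

(** The second clause ties the relation to the morphism [u], through the identification [v] of [R b]
    with [b]; it is the source of representatives for arbitrary classes in
    [loc_surjective_injective]. *)
Definition transport_ok b c (uS : @hom (ho H) b c * (hom a (R b) -> hom a (R c) -> Prop)) :=
  [/\ forall t, exists t', uS.2 t t',
      forall t t', uS.2 t t' -> v c ∘ loc t' = uS.1 ∘ (v b ∘ loc t)
    & forall t t1 t' t1', uS.2 t t' -> left_homotopic t t1 ->
        left_homotopic t' t1' -> uS.2 t1 t1'].

(* A morphism is a map [u] of the homotopy category together with its action on
   the homotopy classes of maps from [a] to the fibrant replacements, given as a
   relation between representatives. *)
Definition transport b c := {uS | @transport_ok b c uS}.

Lemma transport_eq b c (x y : transport b c) :
  (sval x).1 = (sval y).1 -> (forall t t', (sval x).2 t t' <-> (sval y).2 t t') -> x = y.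
Proof.
case: x y => [[u S] p] [[u' S'] p'] /= e eS; apply: eq_exist => /=.
by rewrite e; congr pair; apply/funext => t; apply/funext => t'; apply/propext.
Qed.

Lemma transport_id_ok b : transport_ok (idm (b : ho H), fun t t' => left_homotopic t t').
Proof.
split=> /=.
- by move=> t; exists t; apply: left_homotopic_refl.
- by move=> t t' /loc_homotopic ->; rewrite comp1m.
- move=> t t1 t' t1' h h1 h2; apply: left_homotopic_trans h2 => //.
  by apply: left_homotopic_trans h => //; apply: left_homotopic_sym.
Qed.

Lemma transport_comp_ok b c d (y : transport c d) (x : transport b c) :
  transport_ok ((sval y).1 ∘ (sval x).1,
    fun t t'' => exists t', (sval x).2 t t' /\ (sval y).2 t' t'').
Proof.
case: x y => [[u S] [t1 t2 t3]] [[u' S'] [t1' t2' t3']] /=; split=> /=.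
- by move=> t; have [t' h] := t1 t; have [t'' h'] := t1' t'; exists t'', t'.
- by move=> t t'' [t' [h h']]; rewrite (t2' _ _ h') (t2 _ _ h) compA.
- move=> t s t'' s'' [t' [h h']] e e'; exists t'; split.
    by apply: (t3 _ _ _ _ h) => //; apply: left_homotopic_refl.
  by apply: (t3' _ _ _ _ h') => //; apply: left_homotopic_refl.
Qed.

Definition transport_cat : category.
refine (@Category E (@CatOn E transport
  (fun b => exist _ _ (transport_id_ok b))
  (fun b c d y x => exist _ _ (transport_comp_ok y x)) _ _ _)).
- move=> b c x; apply: transport_eq => /=; first exact: comp1m.
  case: x => [[u S] [t1 t2 t3]] t t' /=; split=> [[s [h h']]|h].
    by apply: (t3 _ _ _ _ h) => //; apply: left_homotopic_refl.
  by exists t'; split=> //; apply: left_homotopic_refl.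
- move=> b c x; apply: transport_eq => /=; first exact: compm1.
  case: x => [[u S] [t1 t2 t3]] t t' /=; split=> [[s [h h']]|h].
    by apply: (t3 _ _ _ _ h'); [apply: left_homotopic_sym|apply: left_homotopic_refl].
  by exists t; split=> //; apply: left_homotopic_refl.
- move=> b c d e z y x; apply: transport_eq => /=; first exact: compA.
  move=> t t'; split=> [[s [[s' [h h1]] h2]]|[s [h [s' [h1 h2]]]]].
    by exists s'; split=> //; exists s.
  by exists s'; split=> //; exists s.
Defined.

(** By [extension_homotopic], any two extensions [g] of [f] to the replacements have homotopic
    composites with [t]. *)
Definition induced b c (f : hom b c) (t : hom a (R b)) (t' : hom a (R c)) : Prop :=
  exists g : hom (R b) (R c), g ∘ r b = r c ∘ f /\ left_homotopic (g ∘ t) t'.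

Lemma induced_ok b c (f : hom b c) : transport_ok (loc f, induced f).
Proof.
split=> /=.
- move=> t; have [g e] := fibrant_extend (r c ∘ f) (ar b) (fR c).
  by exists (g ∘ t), g; split=> //; apply: left_homotopic_refl.
- by move=> t t' [g [e h]]; rewrite -(loc_homotopic h); apply: replacement_naturality.
- move=> t t1 t' t1' [g [e h]] h1 h2; exists g; split=> //.
  apply: left_homotopic_trans h2 => //; apply: left_homotopic_trans h => //.
  by apply: left_homotopic_comp; apply: left_homotopic_sym.
Qed.

Definition transport_functor : functor E transport_cat id.
refine (@Functor E transport_cat id (fun b c f => exist _ _ (induced_ok f)) _ _).
- move=> b; apply: transport_eq => /=; first exact: loc_id.
  move=> t t'; split=> [[g [e h]]|h].
    apply: left_homotopic_trans h => //; rewrite -{1}(comp1m t).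
    by apply: extension_homotopic (ar b) (fR b) _; rewrite // e comp1m compm1.
  by exists (idm _); rewrite comp1m compm1 comp1m.
- move=> b c d g f; apply: transport_eq => /=; first exact: loc_comp.
  move=> t t'; split=> [[k [e h]]|[s [[k [e h]] [k' [e' h']]]]].
    have [l el] := fibrant_extend (r c ∘ f) (ar b) (fR c).
    have [l' el'] := fibrant_extend (r d ∘ g) (ar c) (fR d).
    exists (l ∘ t); split; first by exists l; split=> //; apply: left_homotopic_refl.
    exists l'; split=> //; apply: left_homotopic_trans h => //; rewrite compA.
    apply: extension_homotopic (ar b) (fR d) _ => //.
    by rewrite e -compA el compA el' compA.
  exists (k' ∘ k); split; first by rewrite -compA e compA e' compA.
  apply: left_homotopic_trans h' => //; rewrite -compA.
  exact: left_homotopic_comp.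
Defined.

Lemma induced_bijective b c (f : hom b c) : weq f ->
  (forall t', exists t, induced f t t') /\
  (forall t s t' s', induced f t t' -> induced f s s' ->
     left_homotopic t' s' -> left_homotopic t s).
Proof.
move=> wf; have [g e] := fibrant_extend (r c ∘ f) (ar b) (fR c).
have [[_ wb] [_ wc]] := (ar b, ar c).
have wg : weq g by apply: mc_weq_left wb _; rewrite e; apply: mc_weq_comp.
have [sur inj] := weq_homotopy_bijective ca (fR b) (fR c) wg.
split=> [t'|t s t' s' [k [ek hk]] [l [el hl]] h].
  by have [t h] := sur t'; exists t, g.
apply: inj; apply: (@left_homotopic_trans _ _ ca _ _ (k ∘ t)).
  by apply: extension_homotopic (ar b) (fR c) _; rewrite // e ek.
apply: left_homotopic_trans (hk) _ => //; apply: left_homotopic_trans h _ => //.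
apply: (@left_homotopic_trans _ _ ca _ _ (l ∘ s)); first exact: left_homotopic_sym.
by apply: extension_homotopic (ar b) (fR c) _; rewrite // e el.
Qed.

Lemma transport_weq b c (f : hom b c) : weq f -> is_iso (transport_functor _ _ f).
Proof.
move=> wf; have [sur inj] := induced_bijective wf.
have [w [w1 w2]] := ho_weq H wf.
have [t1 t2 t3] := induced_ok f.
(* The inverse is the converse relation, paired with the inverse of the class of [f]; totality of
   the converse is the surjectivity of [induced_bijective]. *)
have ok : @transport_ok c b (w, fun t t' => induced f t' t).
  split=> [//|t t' h|t s t' s' h h1 h2] /=; last exact: t3 h h2 h1.
  by rewrite (t2 _ _ h) /= compA w1 comp1m.
exists (exist _ _ ok); split; apply: transport_eq => //= t t'; split.
- by move=> [s [h h']]; apply: inj h h' _; apply: left_homotopic_refl.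
- move=> h; have [s hs] := t1 t; exists s; split=> //.
  by apply: t3 hs h _; apply: left_homotopic_refl.
- move=> [s [[k [ek hk]] [l [el hl]]]]; apply: left_homotopic_trans hl => //.
  apply: left_homotopic_trans (left_homotopic_sym hk) _ => //.
  by apply: extension_homotopic (ar b) (fR c) _; rewrite // ek el.
- move=> h; have [s hs] := sur t; exists s; split=> //.
  by apply: t3 hs _ h; apply: left_homotopic_refl.
Qed.

End Replacement.

(** The functor to [transport_cat] inverts weak equivalences, hence factors through a functor [G] on
    the homotopy category. The first component of [G] is the identity by uniqueness, so [G u]
    relates [r a] to some [t'] with [v b ∘ loc t' = u], and the retraction [s] of [r b] turns [t']
    into a representative of [u]. For injectivity, equal classes have equal relations; evaluating
    them at [r a] shows [r b ∘ f] and [r b ∘ g] homotopic, and [s] removes [r b]. *)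
Lemma loc_surjective_injective b : fibrant b ->
  (forall u : @hom (ho H) a b, exists f : hom a b, loc f = u) /\
  (forall f g : hom a b, loc f = loc g -> left_homotopic f g).
Proof.
move=> fb; have [R [r [v [ar fR vr rv]]]] := fibrant_replacement.
have [G GP] := ho_factor H (transport_weq ar fR vr rv).
have [s sr] := fibrant_extend (idm b) (ar b) fb.
split=> [u|f g e].
  have @PG : functor (ho H) (ho H) id.
    refine (@Functor (ho H) (ho H) id
      (fun x y w => (sval (G x y w)).1) _ _).
      by move=> x; rewrite (fmap_id G).
    by move=> x y z g f; rewrite (fmap_comp G).
  pose ID : functor (ho H) (ho H) id :=
    @Functor (ho H) (ho H) id (fun x y w => w) (fun x => erefl) (fun x y z g f => erefl).
  have eu : PG a b u = u.
    by apply: (ho_unique (G := PG) (G' := ID)) => x y f /=; rewrite GP.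
  move: eu; rewrite /PG /=; case: (G a b u) => [[w S] [t1 t2 t3]] /= ew; subst w.
  have [t' h] := t1 (r a); exists (s ∘ t').
  have := t2 _ _ h; rewrite /= vr compm1 => <-; rewrite loc_comp.
  by rewrite -(compm1 (loc s)) -(rv b) compA -loc_comp sr loc_id comp1m.
have eG : transport_functor ar fR vr rv _ _ f = transport_functor ar fR vr rv _ _ g.
  by rewrite -!GP; congr (G _ _ _).
have [k ek] := fibrant_extend (r b ∘ f) (ar a) (fR b).
have : induced r f (r a) (k ∘ r a) by exists k; split=> //; apply: left_homotopic_refl.
have -> : induced r f = induced r g := congr1 (fun x => (sval x).2) eG.
move=> [l [el]]; rewrite el ek => h.
apply: left_homotopic_sym; have := left_homotopic_comp s h.
by rewrite !compA sr !comp1m.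
Qed.

End Representable.
End HomotopyCategory.

(** * Reduced matching objects *)

Lemma finite_fibers (T U : Type) (f : T -> U) (A : set U) :
  finite_set A -> (forall t, A (f t)) ->
  (forall u, A u -> finite_set [set t | f t = u]) -> finite_set [set: T].
Proof.
move=> fA fT ff; apply: sub_finite_set (bigcup_finite fA ff).
by move=> t _; exists (f t).
Qed.

Lemma finite_inj (T U : Type) (f : T -> U) (A : set U) :
  finite_set A -> (forall t, A (f t)) -> (forall s t, f s = f t -> s = t) ->
  finite_set [set: T].
Proof.
move=> fA fT inj; apply: finite_fibers fA fT _ => u _.
have [[t e]|n] := pselect (exists t, f t = u).
  apply: sub_finite_set (finite_set1 t) => s /= es; apply: inj; by rewrite es.
by apply: sub_finite_set (finite_set0 T) => s e; apply: n; exists s.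
Qed.

Section Arrows.
Variables (J : pointed_weak_lattice) (x : J) (k : nat) (y : J).

Lemma deg_finite m : finite_set [set t : J | deg t <= m].
Proof.
apply: sub_finite_set (bigcup_finite (finite_II m.+1) (fun d _ => @wl_finite_deg J d)).
by move=> t h; exists (deg t).
Qed.

(** Finiteness of the index sets makes the products and matching limits exist, only finite limits
    being given. *)
Lemma arrow_finite (p : pred nat) m : (forall d, p d -> d <= m) ->
  finite_set [set: arrow x k y p].
Proof.
move=> pm; apply: (finite_fibers (f := fun a => tgt a) (deg_finite m)).
  by move=> a; apply: pm; apply: arr_deg.
move=> t _; have [[pt d]|n] := pselect (in_bdry x k t /\ p (deg t)).
  apply: sub_finite_set (finite_image (fun g : hom y t =>
    @Arrow J x k y p (exist _ t pt) g d) (wl_finite_hom y t)).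
  case=> [[t' pt'] g d']; rewrite /tgt /= => e; subst t'.
  by exists g => //; rewrite (Prop_irrelevance pt' pt) (bool_irrelevance d' d).
apply: sub_finite_set (@finite_set0 _) => a e; apply: n; rewrite -e.
by split; [apply: (svalP (tgt_ a))|apply: arr_deg].
Qed.

Lemma tarrow_eq (p : pred nat) (a b : tarrow x k y p) : tarr a = tarr b -> a = b.
Proof.
by case: a b => [a ha] [b hb] /= e; subst b; rewrite (bool_irrelevance ha hb).
Qed.

Lemma tarrow_finite (p : pred nat) m : (forall d, p d -> d <= m) ->
  finite_set [set: tarrow x k y p].
Proof.
by move=> /arrow_finite fa; apply: (finite_inj fa _ (@tarrow_eq p)).
Qed.

Lemma tarrow_deg_finite m : finite_set [set: tarrow x k y (deg_eq m)].
Proof. by apply: (@tarrow_finite _ m) => d /eqP ->. Qed.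

Lemma under_finite m : finite_category (under x k y m).
Proof.
split; first exact: (@arrow_finite _ m).
move=> a b; apply: (finite_inj (f := fun g : under_hom a b => sval g)
  (@wl_finite_hom J (tgt a) (tgt b))) => //.
by move=> f g; apply: under_hom_eq.
Qed.

End Arrows.

Section Matching.
Variables (E : pointed_model_category) (J : pointed_weak_lattice).
Variables (x : J) (k : nat) (Y0 : J -> E).
Variable Y : functor (bdry x k) E (fun s => Y0 (sval s)).
Hypothesis pY : pointed_on Y.

Lemma reduced_matching_exists y m : inhabited (reduced_matching Y y m).
Proof.
have [L [c lc]] := mc_limits (under_functor Y y m) (under_finite x k y m).
have [A [ap pA]] := product_exists (fun a : arrow x k y (deg_le m) => Y0 (tgt a))
  (@arrow_finite J x k y _ m (fun d h => h)).
have [T [tp pT]] := product_exists (fun a : tarrow x k y (deg_le m) => Y0 (tgt a))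
  (@tarrow_finite J x k y _ m (fun d h => h)).
have [i iP] := product_ex pA c.
have /dep_choice [s sP] : forall a : arrow x k y (deg_le m),
    exists f : hom T (Y0 (tgt a)), (forall h, f = tp (@Tarrow _ _ _ _ _ a h)) /\
      (barred (arr a) -> is_zero_map f).
  move=> a; case: (orP (orbN (barred (arr a)))) => b.
    have [f zf] := zero_map_exists T (Y0 (tgt a)); exists f; split=> // h.
    by case: (negP h b).
  exists (tp (Tarrow b)); split=> [h|c1]; first by rewrite (bool_irrelevance h b).
  by case: (negP b c1).
have [u uP] := product_ex pA s.
have [p [p1 [p2 pP]]] := pullback_exists i u.
apply: inhabits; apply: (ReducedMatching lc pA pT iP _ _ pP).
- by case=> a h; rewrite uP (proj1 (sP a) h).
- by move=> a h; rewrite uP; apply: (proj2 (sP a)).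
Qed.

Section Components.
Variables (y : J) (m : nat) (M : reduced_matching Y y m).

Lemma rm_til_product : is_product (rm_til_pr M).
Proof. exact: rm_tilP. Qed.

Lemma rm_til_forget (a : tarrow x k y (deg_le m)) :
  rm_til_pr M a ∘ rm_forget M = rm_cmp M a.
Proof.
rewrite -rm_sect_til -compA -(pullback_comm (rm_pullback M)) compA.
by rewrite rm_inclP.
Qed.

Lemma rm_cmp_bar (a : arrow x k y (deg_le m)) :
  barred (arr a) -> is_zero_map (rm_cmp M a).
Proof.
move=> b; rewrite /rm_cmp -rm_inclP -compA (pullback_comm (rm_pullback M)) compA.
by apply: zero_map_compl; apply: rm_sect_bar.
Qed.

(** The inclusion of a limit into the product is monic, and [rm_forget] is a base change of it. *)
Lemma rm_forget_mono T (f g : hom T M) :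
  rm_forget M ∘ f = rm_forget M ∘ g -> f = g.
Proof.
move=> e; apply: (pullback_mono (rm_pullback M)) => //.
apply: (limit_mono (rm_limP M)) => a.
rewrite -(rm_inclP M a) -!compA !(compA (rm_incl M)).
by rewrite (pullback_comm (rm_pullback M)) -!compA e.
Qed.

Lemma rm_cmp_mono T (f g : hom T M) :
  (forall a : tarrow x k y (deg_le m), rm_cmp M a ∘ f = rm_cmp M a ∘ g) -> f = g.
Proof.
move=> e; apply: rm_forget_mono; apply: (product_mono rm_til_product) => a.
by rewrite !compA rm_til_forget.
Qed.

Lemma rm_cmp_nat (a b : arrow x k y (deg_le m)) (g : hom (tgt a) (tgt b)) :
  g ∘ arr a = arr b -> Y (tgt_ a) (tgt_ b) g ∘ rm_cmp M a = rm_cmp M b.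
Proof.
move=> e; rewrite /rm_cmp compA.
by have <- := proj1 (rm_limP M) a b (exist _ g e).
Qed.

(** With [rm_cmp_mono] this is the universal property of the reduced matching object, which
    represents natural families vanishing on barred arrows. *)
Lemma rm_ex T (t : forall a : arrow x k y (deg_le m), hom T (Y0 (tgt a))) :
  (forall (a b : arrow x k y (deg_le m)) (g : hom (tgt a) (tgt b)),
     g ∘ arr a = arr b -> Y (tgt_ a) (tgt_ b) g ∘ t a = t b) ->
  (forall a, barred (arr a) -> is_zero_map (t a)) ->
  exists h : hom T M, forall a, rm_cmp M a ∘ h = t a.
Proof.
move=> tn tb; have [|u [uP _]] := proj2 (rm_limP M) T t.
  by move=> a b [g e]; apply: tn.
have [v vP] := product_ex rm_til_product
  (fun a : tarrow x k y (deg_le m) => t a).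
have [|h [h1 h2]] := pullback_ex (rm_pullback M) (u := u) (v := v).
  apply: (product_mono (@rm_allP _ _ _ _ _ _ _ _ M)) => a.
  rewrite !compA rm_inclP uP; case: (orP (orbN (barred (arr a)))) => b.
    by apply: zero_map_eq (tb _ b) _; apply: zero_map_compl; apply: rm_sect_bar.
  have -> : rm_all_pr M a ∘ rm_sect M = rm_til_pr M (Tarrow b) := rm_sect_til M (Tarrow b).
  by symmetry; exact: (vP (Tarrow b)).
by exists h => a; rewrite /rm_cmp -compA h1 uP.
Qed.

End Components.

Lemma matching_map_exists (v : bdry x k) m (M : reduced_matching Y (sval v) m) :
  exists h : hom (Y0 (sval v)) M, is_matching_map h.
Proof.
have [||h hP] := @rm_ex _ _ M _ (fun a => Y v (tgt_ a) (arr a)).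
- by move=> a b g e; rewrite -(fmap_comp Y) -e.
- by move=> a b; apply: pY.
- by exists h.
Qed.

(** Reedy fibrancy speaks of some model of the matching object and the grid uses its own; the two
    are isomorphic compatibly with their components, hence with the matching maps. *)
Lemma matching_map_rlp (v : bdry x k) m (M M' : reduced_matching Y (sval v) m)
    (h : hom (Y0 (sval v)) M) (h' : hom (Y0 (sval v)) M') :
  is_matching_map h -> is_matching_map h' -> rlp h -> rlp h'.
Proof.
move=> hP hP' rh.
have ex (M1 M2 : reduced_matching Y (sval v) m) :
    exists f : hom M1 M2, forall a, rm_cmp M2 a ∘ f = rm_cmp M1 a.
  by apply: rm_ex; [apply: rm_cmp_nat|apply: rm_cmp_bar].
have [[f fP] [g gP]] := (ex M M', ex M' M).
have -> : h' = f ∘ h by apply: rm_cmp_mono => a; rewrite compA fP hP hP'.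
by apply: (rlp_iso (g := g)) => //; apply: rm_cmp_mono => a;
  rewrite compA ?fP ?gP compm1.
Qed.

Lemma reedy_matching_rlp (v : bdry x k) m (M : reduced_matching Y (sval v) m)
    (h : hom (Y0 (sval v)) M) :
  reedy_fibrant Y -> deg (sval v) = m.+1 -> is_matching_map h -> rlp h.
Proof.
move=> rY e hP; have [_] := rY v; rewrite e => /(_ isT) /= [M' [h' [hP' fh']]].
exact: matching_map_rlp hP' hP (fib_rlp fh').
Qed.

End Matching.

(** * Construction of a separation grid *)

(** The default [t0] turns data constrained only on a range of indices into a total function. *)
Lemma cond_ex (T : Type) (t0 : T) (c : Prop) (P : T -> Prop) :
  (c -> exists t, P t) -> exists t, c -> P t.
Proof.
by move=> H; have [/H [t Pt]|n] := pselect c; [exists t|exists t0].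
Qed.

(** [dcons t0 s 0] reduces to [t0], so types that mention the first term of the sequence need no
    transport along an equality. *)
Definition dcons (T : nat -> Type) (t0 : T 0) (s : forall n, T n.+1) n : T n :=
  match n with 0 => t0 | n'.+1 => s n' end.

Lemma dep_sequence_cons (T : nat -> Type) (R : forall n, T n -> T n.+1 -> Prop) (t0 : T 0) :
  (forall n t, exists t', R n t t') ->
  exists s : forall n, T n.+1, forall n, R n (dcons t0 s n) (s n).
Proof.
move=> /(dep_sequence t0) [s [<- sP]]; exists (fun n => s n.+1).
by case=> [|n] /=; apply: sP.
Qed.

Section Sequences.
Variable E : pointed_model_category.

Lemma zero_hom (a b : E) : inhabited (hom a b).
Proof. by have [f _] := zero_map_exists a b; apply: inhabits. Qed.

(** Composites of the one-step maps, with arbitrary values for [i < i'], since [gmap] takes all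
    pairs of positions. *)
Lemma composites_exist (C : nat -> E) (d : forall i, hom (C i.+1) (C i)) :
  exists D : forall i i', hom (C i) (C i'),
  [/\ forall i, D i i = idm (C i),
      forall i i', i' <= i -> D i.+1 i' = D i i' ∘ d i
    & forall i i' i'', i'' <= i' -> i' <= i -> D i' i'' ∘ D i i' = D i i''].
Proof.
have /dep_choice [z _] : forall p : nat * nat, exists f : hom (C p.1) (C p.2), True.
  by move=> p; have [f] := zero_hom (C p.1) (C p.2); exists f.
pose fix D i i' {struct i} : hom (C i) (C i') :=
  match pselect (i = i') with
  | left e => match e in _ = l return hom (C i) (C l) with erefl => idm (C i) end
  | right _ => match i return hom (C i) (C i') with
    | 0 => z (0, i')
    | l.+1 => D l i' ∘ d l
    end
  end.
have D1 i : D i i = idm (C i).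
  by case: i => [|i] /=; case: pselect => // e; rewrite (Prop_irrelevance e erefl).
have D2 i i' : i' <= i -> D i.+1 i' = D i i' ∘ d i.
  by move=> h /=; case: pselect => // e; exfalso; move: h; rewrite -e ltnn.
exists D; split=> // i i' i'' h; elim: i => [|i IH].
  by rewrite leqn0 => /eqP e; subst i'; rewrite D1 compm1.
rewrite leq_eqVlt => /orP [/eqP e|]; first by subst i'; rewrite D1 compm1.
by rewrite ltnS => h'; rewrite !D2 ?(leq_trans h h') // compA IH.
Qed.

(** Telescoping: each square [ch] raises by one row the place where a path leaves [C] for [T]. It is
    applied to column 0, with [T] the top row of a smaller grid or the sequence of its objects
    $G$. *)
Lemma tower_collapse n (C T : nat -> E) (D : forall i i', hom (C i) (C i'))
    (h : forall j, hom (T j.+1) (T j)) (c : forall j, hom (C j.+2) (T j))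
    Z (g : forall j, hom (T j) Z) :
  (forall i i', 0 < i' -> i' <= i -> i <= n.+2 -> D i i' ∘ D n.+3 i = D n.+3 i') ->
  (forall j, j < n -> c j ∘ D j.+3 j.+2 = h j ∘ c j.+1) ->
  (forall j, j < n -> g j ∘ h j = g j.+1) ->
  g 0 ∘ (c 0 ∘ D n.+3 2) = g n ∘ (c n ∘ D n.+3 n.+2).
Proof.
move=> Dc ch gh; have H j : j <= n ->
    g 0 ∘ (c 0 ∘ D n.+3 2) = g j ∘ (c j ∘ D n.+3 j.+2).
  elim: j => // j IH jn; rewrite IH ?(ltnW jn) //.
  by rewrite -(Dc j.+3 j.+2) // (compA (c j)) ch // -gh // !compA.
exact: H.
Qed.

Section ExtraObjects.
Variables (n : nat) (C : nat -> E) (D : forall i i', hom (C i) (C i')).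
Hypothesis Dcomp : forall i i' i'', 0 < i'' -> i'' <= i' -> i' <= i ->
  D i' i'' ∘ D i i' = D i i''.
Variables (B Q N : E) (Psi : hom B (C 1)) (QB : hom Q B) (QC : hom Q (C n.+1)).
Variable NQ : hom N Q.
Hypothesis QBC : Psi ∘ QB = D n.+1 1 ∘ QC.

(** The factorization through [G n.+1] must be chosen together with the family [G], before [G n] is
    at hand. Its fibration therefore ends in an auxiliary copy [Hn] of the same pullback, and is
    carried to [G n] by the isomorphism [u]. *)
Lemma extra_objects_exist :
  exists (G : nat -> E) (Gm : forall j, hom (G j.+1) (G j)) (GB : forall j, hom (G j) B)
    (GC : forall j, hom (G j) (C j.+1)) (QG : hom Q (G n)) (NG : hom N (G n.+1)),
  [/\ forall j, j <= n -> is_pullback Psi (D j.+1 1) (GB j) (GC j),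
      forall j, j < n -> GB j ∘ Gm j = GB j.+1 /\ GC j ∘ Gm j = D j.+2 j.+1 ∘ GC j.+1,
      GB n ∘ QG = QB /\ GC n ∘ QG = QC,
      acof NG /\ fib (Gm n)
    & Gm n ∘ NG = QG ∘ NQ].
Proof.
have [Hn [hB [hC Hp]]] := pullback_exists Psi (D n.+1 1).
have [QH [QH1 QH2]] := pullback_ex Hp QBC.
have [X [nX [tX [cn wn fX eX]]]] := mc_factor_acof (QH ∘ NQ).
have /choice [G /dep_choice [GB /dep_choice [GC /dep_choice [GN /dep_choice [GT GP]]]]] :
    forall j, exists Gj, exists GB : hom Gj B, exists GC : hom Gj (C j.+1),
      exists GN : hom N Gj, exists GT : hom Gj Hn,
      (j <= n -> is_pullback Psi (D j.+1 1) GB GC) /\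
      (j = n.+1 -> [/\ acof GN, fib GT & GT ∘ GN = QH ∘ NQ]).
  move=> j; case: (ltngtP j n.+1) => [jn|jn|->].
  - have [p [pa [pb pP]]] := pullback_exists Psi (D j.+1 1).
    have [[u] [v]] := (zero_hom N p, zero_hom p Hn).
    by exists p, pa, pb, u, v; split=> // e; move: jn; rewrite e ltnn.
  - have [[[u] [v]] [w]] := (zero_hom X B, zero_hom X (C j.+1), zero_hom N X).
    exists X, u, v, w, tX; split=> e; last by move: jn; rewrite e ltnn.
    by have := ltn_trans (leq_ltn_trans e (ltnSn n)) jn; rewrite ltnn.
  - have [[u] [v]] := (zero_hom X B, zero_hom X (C n.+2)).
    by exists X, u, v, nX, tX; split=> [|_]; [rewrite ltnn|split].
have Gpb j : j <= n -> is_pullback Psi (D j.+1 1) (GB j) (GC j) by case: (GP j).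
have [_ /(_ erefl) [aN fT TN]] := GP n.+1.
have [u [u1 u2]] := pullback_ex (Gpb n (leqnn n)) (pullback_comm Hp).
have [u' [u1' u2']] := pullback_ex Hp (pullback_comm (Gpb n (leqnn n))).
have uu' : u ∘ u' = idm (G n).
  by apply: (pullback_mono (Gpb n (leqnn n))); rewrite compA ?u1 ?u2 ?u1' ?u2' compm1.
have u'u : u' ∘ u = idm Hn.
  by apply: (pullback_mono Hp); rewrite compA ?u1' ?u2' ?u1 ?u2 compm1.
have [QG [QG1 QG2]] := pullback_ex (Gpb n (leqnn n)) QBC.
have /dep_choice [Gm GmP] : forall j, exists f : hom (G j.+1) (G j),
    (j < n -> GB j ∘ f = GB j.+1 /\ GC j ∘ f = D j.+2 j.+1 ∘ GC j.+1) /\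
    (forall e : n = j, f = eq_rect n (fun l => hom (G l.+1) (G l)) (u ∘ GT n.+1) j e).
  move=> j; case: (ltngtP n j) => [jn|jn|<-].
  - have [f] := zero_hom (G j.+1) (G j).
    by exists f; split=> // e; exfalso; move: jn; rewrite e ltnn.
  - have [|f fP] := pullback_ex (Gpb j (ltnW jn)) (u := GB j.+1)
        (v := D j.+2 j.+1 ∘ GC j.+1).
      by rewrite (pullback_comm (Gpb j.+1 jn)) compA Dcomp.
    by exists f; split=> // e; exfalso; move: jn; rewrite e ltnn.
  - by exists (u ∘ GT n.+1); split=> [|e]; rewrite ?ltnn // (Prop_irrelevance e erefl).
exists G, Gm, GB, GC, QG, (GN n.+1).
have eG : Gm n = u ∘ GT n.+1 := proj2 (GmP n) erefl.
split=> //; first by move=> j; case: (GmP j).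
  by split=> //; rewrite eG; apply: fib_of_rlp; apply: rlp_iso uu' u'u _; apply: fib_rlp.
rewrite eG -compA TN compA; congr (_ ∘ _).
by apply: (pullback_mono (Gpb n (leqnn n))); rewrite compA ?u1 ?u2 ?QG1 ?QG2.
Qed.

End ExtraObjects.

(** * Successive columns over a given column 0 *)

Section Columns.
Variables (m : nat) (Q P : E) (PQ : hom P Q).

Record column := Column {
  cob : nat -> E;
  cmap : forall i i', hom (cob i) (cob i');
  cQ : forall i, hom Q (cob i);
  cP : hom P (cob m.+1) }.

(* Only the positions [i >= j] of column [j] are meaningful. *)
Record valid (j : nat) (c : column) : Prop := Valid {
  v_id : forall i, 0 < i -> j <= i -> cmap c i i = idm (cob c i);
  v_comp : forall i i' i'', 0 < i'' -> j <= i'' -> i'' <= i' -> i' <= i ->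
    cmap c i' i'' ∘ cmap c i i' = cmap c i i'';
  v_Q : forall i i', 0 < i' -> j <= i' -> i' <= i -> i <= m ->
    cmap c i i' ∘ cQ c i = cQ c i';
  v_P : cmap c m.+1 m ∘ cP c = cQ c m ∘ PQ }.

(** This covers both kinds of columns. For column 1 the factored map [w] is $\overline\Psi$ on
    [W = B], with [r] the projection from [Q] to [B]; for later columns [w] is the map out of [Q]
    and [r] is the identity. *)
Record step_ok W (j : nat) (c c' : column) (w : hom W (cob c j.+1)) (r : hom Q W)
    (h : forall i, hom (cob c' i) (cob c i)) : Prop := StepOk {
  s_valid : valid j.+1 c';
  s_sq : forall i i', j < i' -> i' <= i -> h i' ∘ cmap c' i i' = cmap c i i' ∘ h i;
  s_Q : forall i, j < i -> i <= m -> h i ∘ cQ c' i = cQ c i;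
  s_P : h m.+1 ∘ cP c' = cP c;
  s_fib : fib (h j.+1);
  s_pullback : forall i, j.+1 < i ->
    is_pullback (h j.+1) (cmap c i j.+1) (cmap c' i j.+1) (h i);
  s_acof : exists f : hom W (cob c' j.+1),
    [/\ acof f, h j.+1 ∘ f = w & cQ c' j.+1 = f ∘ r] }.

Lemma column_step W (j : nat) (c : column) (w : hom W (cob c j.+1)) (r : hom Q W) :
  valid j c -> j < m -> w ∘ r = cQ c j.+1 ->
  exists (c' : column) (h : forall i, hom (cob c' i) (cob c i)), step_ok w r h.
Proof.
move=> [vi vc vQ vP] jm wr.
have [K [f [q [cf wf fq ew]]]] := mc_factor_acof w.
(* The corner [i = j.+1] counts as the pullback of [q] along an identity. Thus every row from there
   upwards is a pullback of [q], and maps into it are determined by their composites with [l] and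
   [h]. *)
have /choice [X /dep_choice [h /dep_choice [l XP]]] : forall i, exists X : E,
    exists h : hom X (cob c i), exists l : hom X K,
    (j < i -> is_pullback q (cmap c i j.+1) l h) /\
    (i = j.+1 -> fib h /\
       exists f' : hom W X, [/\ acof f', l ∘ f' = f & cmap c i j.+1 ∘ (h ∘ f') = w]).
  move=> i; case: (ltngtP i j.+1) => ij.
  - have [z] := zero_hom (cob c i) K.
    exists (cob c i), (idm _), z; split=> [//|e].
    by exfalso; move: ij; rewrite e ltnn.
  - have [p [pa [pb pP]]] := pullback_exists q (cmap c i j.+1).
    by exists p, pb, pa; split=> // e; exfalso; move: ij; rewrite e ltnn.
  - subst i; exists K, q, (idm K); rewrite vi //; split=> [_|_].
      exact: iso_pullback_id.
    by split=> //; exists f; rewrite !comp1m.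
have Xpb i : j < i -> is_pullback q (cmap c i j.+1) (l i) (h i) by case: (XP i).
have Xmono i T (u v : hom T (X i)) : j < i -> l i ∘ u = l i ∘ v -> h i ∘ u = h i ∘ v ->
  u = v by move=> ji; apply: (pullback_mono (Xpb i ji)).
have [_ /(_ erefl) [fh [f' [af' lf' hf']]]] := XP j.+1.
have /dep_choice [D DP] : forall p : nat * nat, exists d : hom (X p.1) (X p.2),
    j < p.2 -> p.2 <= p.1 -> l p.2 ∘ d = l p.1 /\ h p.2 ∘ d = cmap c p.1 p.2 ∘ h p.1.
  case=> [i i'] /=; have [z] := zero_hom (X i) (X i').
  have [|d dP] := @cond_ex _ z (j < i' /\ i' <= i)
      (fun d => l i' ∘ d = l i /\ h i' ∘ d = cmap c i i' ∘ h i);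
    last by exists d => a b; apply: dP.
  move=> [ji ii]; apply: (pullback_ex (Xpb i' ji)).
  rewrite (pullback_comm (Xpb i (leq_trans ji ii))) compA vc //.
have /dep_choice [eQ eQP] : forall i, exists e : hom Q (X i),
    j < i /\ i <= m -> l i ∘ e = f ∘ r /\ h i ∘ e = cQ c i.
  move=> i; have [z] := zero_hom Q (X i); apply: (cond_ex z) => [[ji im]].
  by apply: (pullback_ex (Xpb i ji)); rewrite compA -ew wr vQ // ltnW.
have [|eP [eP1 eP2]] := pullback_ex (Xpb m.+1 (ltnW jm)) (u := f ∘ (r ∘ PQ)) (v := cP c).
  rewrite !compA -ew wr -(vc m.+1 m) // ?(ltnW jm) //.
  by rewrite -compA vP compA vQ // ltnW.
have hD i i' : j < i' -> i' <= i -> h i' ∘ D (i, i') = cmap c i i' ∘ h i.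
  by move=> a b; case: (DP (i, i') a b).
have lD i i' : j < i' -> i' <= i -> l i' ∘ D (i, i') = l i.
  by move=> a b; case: (DP (i, i') a b).
have hQ i : j < i -> i <= m -> h i ∘ eQ i = cQ c i.
  by move=> a b; case: (eQP i (conj a b)).
have lQ i : j < i -> i <= m -> l i ∘ eQ i = f ∘ r.
  by move=> a b; case: (eQP i (conj a b)).
have j0 i : j < i -> 0 < i by apply: leq_ltn_trans.
exists (@Column X (fun i i' => D (i, i')) eQ eP), h; split=> //=.
- split=> //=.
  + move=> i _ ji; apply: Xmono => //; first by rewrite lD // compm1.
    by rewrite hD // vi ?compm1 ?comp1m ?j0 // ltnW.
  + move=> i i' i'' _ ji ii ii'.
    have ji' := leq_trans ji ii; apply: Xmono => //.
      by rewrite compA !lD // (leq_trans ii).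
    rewrite compA !hD ?(leq_trans ii) // -compA hD // compA vc ?j0 //.
    exact: ltnW.
  + move=> i i' _ ji ii im.
    have ji' := leq_trans ji ii; have im' := leq_trans ii im.
    apply: Xmono => //; first by rewrite compA lD // !lQ.
    by rewrite compA hD // -compA !hQ // vQ ?j0 // ltnW.
  + apply: Xmono => //; first by rewrite compA lD // eP1 (compA (l m)) lQ // compA. 
    by rewrite !compA hD // hQ // -compA eP2 vP.
- move=> i ji; have ji' := ltnW ji.
  apply: pullback_intro; first by rewrite hD.
  + move=> T u v e; have [|g [g1 g2]] := pullback_ex (Xpb i ji') (u := l j.+1 ∘ u) (v := v).
      rewrite compA (pullback_comm (Xpb j.+1 (leqnn _))) -compA e compA.
      by rewrite vi // comp1m.
    exists g; split=> //; apply: Xmono => //; first by rewrite compA lD.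
    by rewrite compA hD // -compA g2.
  + move=> T u v e1 e2; apply: Xmono => //.
    by rewrite -(lD i j.+1) // -!compA e1.
- have e1 : h j.+1 ∘ f' = w by move: hf'; rewrite vi // comp1m.
  exists f'; split=> //; apply: Xmono => //.
    by rewrite lQ // compA lf'.
  by rewrite hQ // compA e1.
Qed.

Lemma columns_exist B (c0 : column) (w : hom B (cob c0 1)) (r : hom Q B) :
  valid 0 c0 -> 0 < m -> w ∘ r = cQ c0 1 ->
  exists s : nat -> column, let S := dcons (T := fun _ => column) c0 s in
  exists h : forall j i, hom (cob (S j.+1) i) (cob (S j) i),
    step_ok w r (h 0) /\
    forall j, 0 < j -> j < m -> step_ok (cQ (S j) j.+1) (idm Q) (h j).
Proof.
move=> v0 m0 wr; have [c1 [h0 s0]] := column_step v0 m0 wr.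
(* [R j] relates columns [j + 1] and [j + 2]; column 1 is separate because it factors [w] instead of
   the map out of [Q]. *)
pose R j c c' := j.+1 < m -> valid j.+1 c -> exists h,
  @step_ok Q j.+1 c c' (cQ c j.+2) (idm Q) h.
have [|s sP] := @dep_sequence_cons (fun=> column) R c1.
  move=> j c; have [jm|n] := pselect (j.+1 < m /\ valid j.+1 c).
    have [c' [h hP]] := column_step (proj2 jm) (proj1 jm) (compm1 _).
    by exists c' => _ _; exists h.
  by exists c => a b; case: n.
have sv j : j < m -> valid j.+1 (dcons (T := fun _ => column) c1 s j).
  elim: j => [_|j IH jm]; first exact: s_valid s0.
  by have [h hP] := sP j jm (IH (ltnW jm)); apply: s_valid hP.
have /dep_choice [hs hsP] : forall j, exists h, j.+1 < m ->
    step_ok (cQ (dcons (T := fun _ => column) c1 s j) j.+2) (idm Q)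
      (h : forall i, hom (cob (s j) i) (cob (dcons (T := fun _ => column) c1 s j) i)).
  move=> j; have [z] : inhabited (forall i,
      hom (cob (s j) i) (cob (dcons (T := fun _ => column) c1 s j) i)).
    have /dep_choice [z _] := fun i => zero_map_exists (cob (s j) i)
      (cob (dcons (T := fun _ => column) c1 s j) i).
    exact: inhabits.
  by apply: (cond_ex z) => jm; apply: sP => //; apply: sv; apply: ltnW.
exists (dcons (T := fun _ => column) c1 s) => S.
exists (dcons (T := fun j => forall i, hom (cob (S j.+1) i) (cob (S j) i)) h0 hs).
by split=> //; case=> // j _ jm; apply: hsP.
Qed.

End Columns.
End Sequences.

(** * Grids of one size, and the map from $L$ to $D$ in column 0 *)

Section Pieces.
Variables (E : pointed_model_category) (J : pointed_weak_lattice).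
Variables (x : J) (k : nat) (Y0 : J -> E).
Variable Y : functor (bdry x k) E (fun s => Y0 (sval s)).
Variable M : forall y m, reduced_matching Y y m.

(* The fields of [grid_data] at [(y, m)], except [gCF] and [gCG], which also involve
   the grids of size [m - 1], and [gM] and [gmb], which are fixed beforehand. *)
Record piece (y : J) (m : nat) := Piece {
  pF : nat -> nat -> E;
  pmap : forall j i j' i', hom (pF j i) (pF j' i');
  pA_pr : forall a : tarrow x k y (deg_eq m), hom (pF 0 m.+1) (Y0 (tgt a));
  pL_pr : forall a : tarrow x k y (deg_eq m), hom (pF 0 m) (M (tgt a) m.-1);
  pD_pr : forall a : tarrow x k y (deg_eq m), hom (pF 0 1) (rm_til (M (tgt a) m.-1));
  pLD : hom (pF 0 m) (pF 0 1);
  pPsi : hom (rm_til (M y m.-1)) (pF 0 1);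
  pQ : E;
  pQB : hom pQ (rm_til (M y m.-1));
  pQL : hom pQ (pF 0 m);
  pN : E;
  pNM : hom pN (M y m.-1);
  pNQ : hom pN pQ;
  pP : E;
  pPQ : hom pP pQ;
  pPA : hom pP (pF 0 m.+1);
  pMQ : hom (M y m) pQ;
  pMN : hom (M y m) pN;
  pMP : hom (M y m) pP;
  pG : nat -> E;
  pGmap : forall j, hom (pG j.+1) (pG j);
  pGB : forall j, hom (pG j) (rm_til (M y m.-1));
  pGF : forall j, hom (pG j) (pF 0 j.+1);
  pQG : hom pQ (pG m.-2);
  pNG : hom pN (pG m.-1);
  piota : hom (rm_til (M y m.-1)) (pF 1 1);
  pQF : forall j i, hom pQ (pF j i);
  pPF : hom pP (pF m.-1 m.+1) }.

Definition layer (m : nat) := forall y, piece y m.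

Definition column_maps (R : forall m, layer m) (y : J) (m : nat) : Type :=
  forall j (a : tarrow x k y (deg_eq m)),
    (hom (pF (R m y) 0 j.+1) (pF (R m.-1 (tgt a)) j m) *
     hom (pF (R m y) 0 j.+1) (pG (R m.-1 (tgt a)) j))%type.

Variable mb : forall (v : bdry x k) m, hom (Y0 (sval v)) (M (sval v) m).

Definition assemble (R : forall m, layer m) (C : forall y m, column_maps R y m) :
    grid_data Y :=
  @GridData E J x k Y0 Y M mb
    (fun y m => pF (R m y)) (fun y m => pmap (R m y))
    (fun y m => pA_pr (R m y)) (fun y m => pL_pr (R m y)) (fun y m => pD_pr (R m y))
    (fun y m => pLD (R m y)) (fun y m => pPsi (R m y))
    (fun y m => pQ (R m y)) (fun y m => pQB (R m y)) (fun y m => pQL (R m y))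
    (fun y m => pN (R m y)) (fun y m => pNM (R m y)) (fun y m => pNQ (R m y))
    (fun y m => pP (R m y)) (fun y m => pPQ (R m y)) (fun y m => pPA (R m y))
    (fun y m => pMQ (R m y)) (fun y m => pMN (R m y)) (fun y m => pMP (R m y))
    (fun y m => pG (R m y)) (fun y m => pGmap (R m y)) (fun y m => pGB (R m y))
    (fun y m => pGF (R m y)) (fun y m => pQG (R m y)) (fun y m => pNG (R m y))
    (fun y m => piota (R m y)) (fun y m => pQF (R m y)) (fun y m => pPF (R m y))
    (fun y m j a => (C y m j a).1) (fun y m j a => (C y m j a).2).

Lemma default_layer m : inhabited (layer m).
Proof.
have [z _] := pm_zero E.
have /dep_choice [f _] : forall ab : E * E, exists f : hom ab.1 ab.2, True.
  by move=> [a b]; have [f] := zero_hom a b; exists f.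
apply: inhabits => y.
exact: (@Piece y m (fun _ _ => z) (fun _ _ _ _ => f (z, z)) (fun a => f (z, _))
  (fun a => f (z, _)) (fun a => f (z, _)) (f (z, z)) (f (_, z)) z (f (z, _)) (f (z, z))
  z (f (z, _)) (f (z, z)) z (f (z, z)) (f (z, z)) (f (_, z)) (f (_, z)) (f (_, z))
  (fun _ => z) (fun _ => f (z, z)) (fun _ => f (z, _)) (fun _ => f (z, z)) (f (z, z))
  (f (z, z)) (f (_, z)) (fun _ _ => f (z, z)) (f (z, z))).
Qed.

(** Grid laws can only be stated for a family of layers of all sizes; a single layer is completed by
    default ones. *)
Lemma family_through m (t : layer m) : exists R : forall m, layer m, R m = t.
Proof.
have /dep_choice [d _] : forall m, exists d : layer m, True.
  by move=> m'; have [d] := default_layer m'; exists d.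
exists (fun m' => match pselect (m = m') with
  | left e => match e in _ = l return layer l with erefl => t end
  | right _ => d m'
  end).
by case: pselect => // e; rewrite (Prop_irrelevance e erefl).
Qed.

(* [grid_laws] speaks of grids of all sizes but constrains one size only: it is
   required for every family of layers through [t]. *)
Definition good (m : nat) (t : layer m) : Prop :=
  forall n, n.+2 = m -> forall (R : forall m, layer m) (C : forall y m, column_maps R y m),
    R m = t -> forall y, grid_laws (assemble C) y n.

(* Column 0 of size [m + 1], over the grids [t] of size [m]. *)
Record column_laws (m : nat) (t : layer m) (y : J) (C : nat -> E)
    (D : forall i i', hom (C i) (C i'))
    (Lp : forall a : tarrow x k y (deg_eq m.+1), hom (C m.+1) (M (tgt a) m))
    (Dp : forall a : tarrow x k y (deg_eq m.+1), hom (C 1) (rm_til (M (tgt a) m)))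
    (CF : forall j (a : tarrow x k y (deg_eq m.+1)), hom (C j.+1) (pF (t (tgt a)) j m.+1))
    (CG : forall j (a : tarrow x k y (deg_eq m.+1)), hom (C j.+1) (pG (t (tgt a)) j)) :
    Prop := ColumnLaws {
  cl_product : forall j, 1 <= j <= m.-1 ->
    is_product
      (X := fun i : tarrow x k y (deg_eq m.+1) + tarrow x k y (deg_eq m.+1) =>
        match i with
        | inl a => pF (t (tgt a)) j m.+1
        | inr a => pG (t (tgt a)) j
        end)
      (P := C j.+1)
      (fun i => match i with inl a => CF j a | inr a => CG j a end);
  cl_top_F : forall a : tarrow x k y (deg_eq m.+1), CF m.-1 a ∘ D m.+1 m.-1.+1
      = pPF (t (tgt a)) ∘ (pMP (t (tgt a)) ∘ Lp a);
  cl_top_G : forall a : tarrow x k y (deg_eq m.+1), CG m.-1 a ∘ D m.+1 m.-1.+1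
      = pNG (t (tgt a)) ∘ (pMN (t (tgt a)) ∘ Lp a);
  cl_step_F : forall j (a : tarrow x k y (deg_eq m.+1)), 1 <= j -> j.+1 <= m.-1 ->
    CF j a ∘ D j.+2 j.+1 = pmap (t (tgt a)) j.+1 m.+1 j m.+1 ∘ CF j.+1 a;
  cl_step_G : forall j (a : tarrow x k y (deg_eq m.+1)), 1 <= j -> j.+1 <= m.-1 ->
    CG j a ∘ D j.+2 j.+1 = pGmap (t (tgt a)) j ∘ CG j.+1 a;
  cl_bottom_F : forall (a : tarrow x k y (deg_eq m.+1))
      (b : tarrow x k (tgt a) (deg_le m)) (h : deg_eq m (deg (tgt b))),
    rm_til_pr (M (tgt a) m) b ∘ (Dp a ∘ D 2 1)
      = pA_pr (t (tgt a)) (trelax h) ∘ (pmap (t (tgt a)) 1 m.+1 0 m.+1 ∘ CF 1 a);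
  cl_bottom_G : forall (a : tarrow x k y (deg_eq m.+1)) (b : tarrow x k (tgt a) (deg_le m))
      (h : deg_le m.-1 (deg (tgt b))),
    rm_til_pr (M (tgt a) m) b ∘ (Dp a ∘ D 2 1)
      = rm_til_pr (M (tgt a) m.-1) (trelax h)
        ∘ (pGB (t (tgt a)) 0 ∘ (pGmap (t (tgt a)) 0 ∘ CG 1 a)) }.


Arguments column_laws {m} t {y C} D Lp Dp CF CG.

(** What the evaluation of column 0 uses of the smaller grid at [v]: its top row and its objects
    $G$, entered from $\overline{\mathbf M}^v$, return the components of $\overline{\mathbf
    M}^v$. *)
Record tower_facts (v : J) (n : nat) (p : piece v n.+2) : Prop := TowerFacts {
  tf_A : forall (b : tarrow x k v (deg_le n.+2)) (h : deg_eq n.+2 (deg (tgt b))),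
    pA_pr p (trelax h) ∘ (pmap p n.+1 n.+3 0 n.+3 ∘ (pPF p ∘ pMP p))
      = rm_cmp (M v n.+2) b;
  tf_F : forall j, 0 < j -> j < n.+1 ->
    pmap p j n.+3 0 n.+3 ∘ pmap p j.+1 n.+3 j n.+3 = pmap p j.+1 n.+3 0 n.+3;
  tf_G : forall j, j < n -> pGB p j ∘ pGmap p j = pGB p j.+1;
  tf_B : forall (b : tarrow x k v (deg_le n.+2)) (h : deg_le n.+1 (deg (tgt b))),
    rm_til_pr (M v n.+1) (trelax h) ∘ (pGB p n ∘ (pGmap p n ∘ (pNG p ∘ pMN p)))
      = rm_cmp (M v n.+2) b }.

(** The equality is tested on the factors of $D$. A factor at [b] of top degree is reached through
    the top row of the grid of [tgt a], one of lower degree through its objects $G$. Telescoping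
    moves the exit from column 0 to the row just below $L$, where the two routes are
    $\overline{\mathbf M}\to\overline{\mathbf P}\to A$ and $\overline{\mathbf M}\to\overline{\mathbf
    N}\to\overline{\mathbf Q}\to B$. *)
Lemma column_forget n (t : layer n.+2) (y : J) (C : nat -> E)
    (D : forall i i', hom (C i) (C i')) Lp Dp CF CG :
  (forall a : tarrow x k y (deg_eq n.+3), tower_facts (t (tgt a))) ->
  (forall i i' i'', 0 < i'' -> i'' <= i' -> i' <= i -> i <= n.+3 ->
     D i' i'' ∘ D i i' = D i i'') ->
  column_laws t D Lp Dp CF CG ->
  forall a : tarrow x k y (deg_eq n.+3),
    Dp a ∘ D n.+3 1 = rm_forget (M (tgt a) n.+2) ∘ Lp a.
Proof.
move=> tf Dc cl a; have [tA tF tG tB] := tf a; set v := tgt a in tA tF tG tB *.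
apply: (product_mono (rm_til_product (M v n.+2))) => b.
rewrite [RHS]compA rm_til_forget -(Dc n.+3 2 1) // (compA (Dp a)) compA.
have [h|h] : deg (tgt b) <= n.+1 \/ deg (tgt b) == n.+2.
- have h : deg (tgt b) <= n.+2 := arr_deg b; move: (deg (tgt b)) h => d; lia.
- rewrite (cl_bottom_G cl (b := b) h) -/v.
  pose g j : hom (pG (t v) j.+1) (Y0 (tgt b)) :=
    rm_til_pr (M v n.+1) (trelax (q := deg_le n.+1) h) ∘ (pGB (t v) j ∘ pGmap (t v) j).
  transitivity (g 0 ∘ (CG 1 a ∘ D n.+3 2)); first by rewrite /g !compA.
  rewrite (@tower_collapse E n C (fun j => pG (t v) j.+1) D
    (fun j => pGmap (t v) j.+1) (fun j => CG j.+1 a) _ g).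
  + have /= -> := cl_top_G cl a.
    transitivity (rm_til_pr (M v n.+1) (trelax (q := deg_le n.+1) h) ∘
      (pGB (t v) n ∘ (pGmap (t v) n ∘ (pNG (t v) ∘ pMN (t v)))) ∘ Lp a).
      by rewrite /g !compA.
    by rewrite (tB b h).
  + by move=> i i' i0 ii i2; apply: Dc => //; lia.
  + by move=> j jn; have := cl_step_G cl a (j := j.+1) isT jn.
  + by move=> j jn; rewrite /g -(tG j) // !compA.
- rewrite (cl_bottom_F cl (b := b) h) -/v.
  pose g j : hom (pF (t v) j.+1 n.+3) (Y0 (tgt b)) :=
    pA_pr (t v) (trelax (q := deg_eq n.+2) h) ∘ pmap (t v) j.+1 n.+3 0 n.+3.
  transitivity (g 0 ∘ (CF 1 a ∘ D n.+3 2)); first by rewrite /g !compA.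
  rewrite (@tower_collapse E n C (fun j => pF (t v) j.+1 n.+3) D
    (fun j => pmap (t v) j.+2 n.+3 j.+1 n.+3) (fun j => CF j.+1 a) _ g).
  + have /= -> := cl_top_F cl a.
    transitivity (pA_pr (t v) (trelax (q := deg_eq n.+2) h) ∘
      (pmap (t v) n.+1 n.+3 0 n.+3 ∘ (pPF (t v) ∘ pMP (t v))) ∘ Lp a).
      by rewrite /g !compA.
    by rewrite (tA b h).
  + by move=> i i' i0 ii i2; apply: Dc => //; lia.
  + by move=> j jn; have := cl_step_F cl a (j := j.+1) isT jn.
  + by move=> j jn; rewrite /g -compA tF.
Qed.

End Pieces.

(** Makes the lemmas on layers under construction applicable to a given grid. *)
Definition piece_of (E : pointed_model_category) (J : pointed_weak_lattice) (x : J)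
    (k : nat) (Y0 : J -> E) (Y : functor (bdry x k) E (fun s => Y0 (sval s)))
    (S : grid_data Y) (y : J) (m : nat) : piece (gM S) y m :=
  @Piece E J x k Y0 Y (gM S) y m (gF S y m) (gmap S y m) (@gA_pr _ _ _ _ _ _ S y m)
    (@gL_pr _ _ _ _ _ _ S y m) (@gD_pr _ _ _ _ _ _ S y m) (gLD S y m) (gPsi S y m)
    (gQ S y m) (gQB S y m) (gQL S y m) (gN S y m) (gNM S y m) (gNQ S y m) (gP S y m)
    (gPQ S y m) (gPA S y m) (gMQ S y m) (gMN S y m) (gMP S y m) (gG S y m)
    (gGmap S y m) (gGB S y m) (gGF S y m) (gQG S y m) (gNG S y m) (giota S y m)
    (gQF S y m) (gPF S y m).

Arguments column_laws {E J x k Y0 Y M m} t {y C} D Lp Dp CF CG.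

(** * Column 0 *)

Section Existence.
Variables (E : pointed_model_category) (J : pointed_weak_lattice).
Variables (x : J) (k : nat) (Y0 : J -> E).
Variable Y : functor (bdry x k) E (fun s => Y0 (sval s)).
Variable M : forall y m, reduced_matching Y y m.
Variable mb : forall (v : bdry x k) m, hom (Y0 (sval v)) (M (sval v) m).

Section Cells.
Variables (m : nat) (t : layer M m) (y : J).
Hypothesis m_gt0 : 0 < m.

Local Notation top := (tarrow x k y (deg_eq m.+1)).

(** The rows of column 0 are products of four different kinds. Carrying projections of every kind,
    those foreign to the row being fillers, makes the column one family indexed by the row. *)
Record cell := Cell {
  c_ob :> E;
  c_A : forall a : top, hom c_ob (Y0 (tgt a));
  c_L : forall a : top, hom c_ob (M (tgt a) m);
  c_D : forall a : top, hom c_ob (rm_til (M (tgt a) m));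
  c_F : forall j (a : top), hom c_ob (pF (t (tgt a)) j m.+1);
  c_G : forall j (a : top), hom c_ob (pG (t (tgt a)) j) }.

Definition c_FG_ob j (i : top + top) : E :=
  match i with
  | inl a => pF (t (tgt a)) j m.+1
  | inr a => pG (t (tgt a)) j
  end.

Definition c_FG (c : cell) j i : hom c (c_FG_ob j i) :=
  match i with inl a => c_F c j a | inr a => c_G c j a end.

Lemma cell_exists i : exists c : cell,
  [/\ i = m.+2 -> is_product (c_A c), i = m.+1 -> is_product (c_L c),
      i = 1 -> is_product (c_D c) & 1 < i -> i < m.+1 -> is_product (c_FG c i.-1)].
Proof.
have [z] : inhabited (forall ab : E * E, hom ab.1 ab.2).
  have /dep_choice [f _] := fun ab : E * E => zero_map_exists ab.1 ab.2.
  exact: inhabits.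
pose zr a b : hom a b := z (a, b).
pose mk P := @Cell P (fun _ => zr _ _) (fun _ => zr _ _) (fun _ => zr _ _)
  (fun _ _ => zr _ _) (fun _ _ => zr _ _).
have ft := tarrow_deg_finite x k y m.+1.
have [e|n2] := eqVneq i m.+2.
  have [P [pr H]] := product_exists (fun a : top => Y0 (tgt a)) ft.
  exists (@Cell P pr (c_L (mk P)) (c_D (mk P)) (c_F (mk P)) (c_G (mk P))).
  by split=> //; lia.
have [e|n1] := eqVneq i m.+1.
  have [P [pr H]] := product_exists
    (fun a : top => M (tgt a) m : E) ft.
  exists (@Cell P (c_A (mk P)) pr (c_D (mk P)) (c_F (mk P)) (c_G (mk P))).
  by split=> //; lia.
have [e|n0] := eqVneq i 1.
  have [P [pr H]] := product_exists
    (fun a : top => rm_til (M (tgt a) m)) ft.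
  exists (@Cell P (c_A (mk P)) (c_L (mk P)) pr (c_F (mk P)) (c_G (mk P))).
  by split=> //; lia.
have [e|nr] := boolP ((1 < i) && (i < m.+1)); last first.
  by exists (mk (Y0 y)); split; lia.
have [|P [pr H]] := product_exists (c_FG_ob i.-1).
  apply: (sub_finite_set _ (_ : finite_set ((inl @` setT) `|` (inr @` setT)))).
    by move=> [a|a] _; [left|right]; exists a.
  by rewrite finite_setU; split; apply: finite_image.
have /dep_choice [cF cFP] : forall ja : nat * top,
    exists f : hom P (pF (t (tgt ja.2)) ja.1 m.+1),
    forall e : i.-1 = ja.1,
      f = eq_rect i.-1 (fun j => hom P (pF (t (tgt ja.2)) j m.+1)) (pr (inl ja.2)) _ e.
  move=> [j a] /=; have [e'|n'] := eqVneq i.-1 j.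
    by subst j; exists (pr (inl a)) => e'; rewrite (Prop_irrelevance e' erefl).
  by exists (zr _ _) => e'; move: n'; rewrite {1}e' eqxx.
have /dep_choice [cG cGP] : forall ja : nat * top,
    exists f : hom P (pG (t (tgt ja.2)) ja.1),
    forall e : i.-1 = ja.1,
      f = eq_rect i.-1 (fun j => hom P (pG (t (tgt ja.2)) j)) (pr (inr ja.2)) _ e.
  move=> [j a] /=; have [e'|n'] := eqVneq i.-1 j.
    by subst j; exists (pr (inr a)) => e'; rewrite (Prop_irrelevance e' erefl).
  by exists (zr _ _) => e'; move: n'; rewrite {1}e' eqxx.
exists (@Cell P (c_A (mk P)) (c_L (mk P)) (c_D (mk P))
  (fun j a => cF (j, a)) (fun j a => cG (j, a))).
split=> [||| _ _]; try lia.
have -> : c_FG (@Cell P (c_A (mk P)) (c_L (mk P)) (c_D (mk P))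
  (fun j a => cF (j, a)) (fun j a => cG (j, a))) i.-1 = pr; last exact: H.
apply/functional_extensionality_dep => -[a|a] /=.
  by rewrite (cFP (i.-1, a) erefl).
by rewrite (cGP (i.-1, a) erefl).
Qed.

(** The grid has size [m + 1], so $A$, $L$ and $D$ sit in rows [m + 2], [m + 1] and 1, and the
    products of the $F\times G$ fill rows 2 to [m]. For [m = 1] there are no such rows and $L$ lies
    directly above $D$. *)
Lemma column_exists :
  exists (C : nat -> E) (D : forall i i', hom (C i) (C i'))
    (Ap : forall a : top, hom (C m.+2) (Y0 (tgt a)))
    (Lp : forall a : top, hom (C m.+1) (M (tgt a) m))
    (Dp : forall a : top, hom (C 1) (rm_til (M (tgt a) m)))
    (CF : forall j (a : top), hom (C j.+1) (pF (t (tgt a)) j m.+1))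
    (CG : forall j (a : top), hom (C j.+1) (pG (t (tgt a)) j)),
  [/\ is_product Ap, is_product Lp, is_product Dp,
      [/\ forall i, D i i = idm (C i)
        & forall i i' i'', i'' <= i' -> i' <= i -> D i' i'' ∘ D i i' = D i i'']
    & [/\ forall a : top, Lp a ∘ D m.+2 m.+1 = mb (tgt_ a) m ∘ Ap a,
        m = 1 -> forall a : top, Dp a ∘ D m.+1 1 = rm_forget (M (tgt a) m) ∘ Lp a
      & 1 < m -> column_laws t D Lp Dp CF CG]].
Proof.
have [c cP] := choice cell_exists.
have pA i : i = m.+2 -> is_product (c_A (c i)) by case: (cP i).
have pL i : i = m.+1 -> is_product (c_L (c i)) by case: (cP i).
have pD i : i = 1 -> is_product (c_D (c i)) by case: (cP i).
have pFG i : 1 < i -> i < m.+1 -> is_product (c_FG (c i) i.-1) by case: (cP i).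
have exFG i T j (u : forall a : top, hom T (pF (t (tgt a)) j m.+1))
    (v : forall a : top, hom T (pG (t (tgt a)) j)) : i = j.+1 -> 0 < j -> j < m ->
    exists h : hom T (c i), forall a : top, c_F (c i) j a ∘ h = u a /\ c_G (c i) j a ∘ h = v a.
  move=> e j0 jm; subst i.
  have [h hP] := product_ex (pFG j.+1 j0 jm) (fun i : _ + _ =>
    match i return hom T (c_FG_ob j i) with inl a => u a | inr a => v a end).
  by exists h => a; split; [apply: (hP (inl a))|apply: (hP (inr a))].
have /dep_choice [d dP] : forall i, exists d : hom (c i.+1) (c i),
  [/\ i = m.+1 -> forall a : top, c_L (c i) a ∘ d = mb (tgt_ a) m ∘ c_A (c i.+1) a,
      i = m -> 1 < i -> forall a : top,
        c_F (c i) m.-1 a ∘ d = pPF (t (tgt a)) ∘ (pMP (t (tgt a)) ∘ c_L (c i.+1) a) /\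
        c_G (c i) m.-1 a ∘ d = pNG (t (tgt a)) ∘ (pMN (t (tgt a)) ∘ c_L (c i.+1) a),
      forall j, i = j.+1 -> 0 < j -> j < m.-1 -> forall a : top,
        c_F (c i) j a ∘ d = pmap (t (tgt a)) j.+1 m.+1 j m.+1 ∘ c_F (c i.+1) j.+1 a /\
        c_G (c i) j a ∘ d = pGmap (t (tgt a)) j ∘ c_G (c i.+1) j.+1 a,
      i = 1 -> 1 < m -> forall (a : top)
          (b : tarrow x k (tgt a) (deg_le m)),
        (forall h : deg_eq m (deg (tgt b)), rm_til_pr (M (tgt a) m) b ∘ (c_D (c i) a ∘ d)
           = pA_pr (t (tgt a)) (trelax h)
             ∘ (pmap (t (tgt a)) 1 m.+1 0 m.+1 ∘ c_F (c i.+1) 1 a)) /\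
        (forall h : deg_le m.-1 (deg (tgt b)), rm_til_pr (M (tgt a) m) b ∘ (c_D (c i) a ∘ d)
           = rm_til_pr (M (tgt a) m.-1) (trelax h)
             ∘ (pGB (t (tgt a)) 0 ∘ (pGmap (t (tgt a)) 0 ∘ c_G (c i.+1) 1 a)))
    & i = 1 -> m = 1 -> forall a : top,
        c_D (c i) a ∘ d = rm_forget (M (tgt a) m) ∘ c_L (c i.+1) a].
  move=> i; have [e|n1] := eqVneq i m.+1.
    have [d dP] := product_ex (pL i e) (fun a : top => mb (tgt_ a) m ∘ c_A (c i.+1) a).
    by exists d; split=> //; lia.
  have [e|n0] := eqVneq i 1.
    have [em|nm] := eqVneq m 1.
      have [d dP] := product_ex (pD i e)
        (fun a : top => rm_forget (M (tgt a) m) ∘ c_L (c i.+1) a).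
      by exists d; split=> //; lia.
    have /dep_choice [u uP] : forall a : top,
        exists u : hom (c i.+1) (rm_til (M (tgt a) m)),
        forall b : tarrow x k (tgt a) (deg_le m),
        (forall h : deg_eq m (deg (tgt b)), rm_til_pr (M (tgt a) m) b ∘ u
           = pA_pr (t (tgt a)) (trelax h)
             ∘ (pmap (t (tgt a)) 1 m.+1 0 m.+1 ∘ c_F (c i.+1) 1 a)) /\
        (forall h : deg_le m.-1 (deg (tgt b)), rm_til_pr (M (tgt a) m) b ∘ u
           = rm_til_pr (M (tgt a) m.-1) (trelax h)
             ∘ (pGB (t (tgt a)) 0 ∘ (pGmap (t (tgt a)) 0 ∘ c_G (c i.+1) 1 a))).
      move=> a; have /dep_choice [w wP] : forall b : tarrow x k (tgt a) (deg_le m),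
          exists w : hom (c i.+1) (Y0 (tgt b)),
          (forall h : deg_eq m (deg (tgt b)), w
             = pA_pr (t (tgt a)) (trelax h)
               ∘ (pmap (t (tgt a)) 1 m.+1 0 m.+1 ∘ c_F (c i.+1) 1 a)) /\
          (forall h : deg_le m.-1 (deg (tgt b)), w
             = rm_til_pr (M (tgt a) m.-1) (trelax h)
               ∘ (pGB (t (tgt a)) 0 ∘ (pGmap (t (tgt a)) 0 ∘ c_G (c i.+1) 1 a))).
        (* A factor of $D$ belongs to $A^v_m$ or to $B^v_m$ according to the degree of its target,
           and never to both. *)
        move=> b; have [h|h] : deg_eq m (deg (tgt b)) \/ deg_le m.-1 (deg (tgt b)).
        - have : deg_le m (deg (tgt b)) := arr_deg b.
          by rewrite /deg_eq /deg_le; move: (deg _) => z; lia.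
        - exists (pA_pr (t (tgt a)) (trelax h)
            ∘ (pmap (t (tgt a)) 1 m.+1 0 m.+1 ∘ c_F (c i.+1) 1 a)).
          split=> h'; first by rewrite (bool_irrelevance h' h).
          exfalso; move: h h'; rewrite /deg_eq /deg_le; move: (deg _) => z; lia.
        - exists (rm_til_pr (M (tgt a) m.-1) (trelax h)
            ∘ (pGB (t (tgt a)) 0 ∘ (pGmap (t (tgt a)) 0 ∘ c_G (c i.+1) 1 a))).
          split=> h'; last by rewrite (bool_irrelevance h' h).
          exfalso; move: h h'; rewrite /deg_eq /deg_le; move: (deg _) => z; lia.
      have [u uP] := product_ex (rm_til_product (M (tgt a) m)) w.
      by exists u => b; rewrite uP; apply: wP.
    have [d dP] := product_ex (pD i e) u.
    exists d; split; try (by lia).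
    by move=> _ _ a b; rewrite dP; apply: uP.
  have [e|nm] := eqVneq i m.
    have [|||d dP] := @exFG i (c i.+1) m.-1
      (fun a : top => pPF (t (tgt a)) ∘ (pMP (t (tgt a)) ∘ c_L (c i.+1) a))
      (fun a : top => pNG (t (tgt a)) ∘ (pMN (t (tgt a)) ∘ c_L (c i.+1) a)); try lia.
    by exists d; split=> //; lia.
  have [ie|nr] := boolP ((1 < i) && (i < m)).
    have [|||d dP] := @exFG i (c i.+1) i.-1
      (fun a : top => pmap (t (tgt a)) i.-1.+1 m.+1 i.-1 m.+1 ∘ c_F (c i.+1) i.-1.+1 a)
      (fun a : top => pGmap (t (tgt a)) i.-1 ∘ c_G (c i.+1) i.-1.+1 a); try lia.
    exists d; split; try (by lia).
    by move=> j e _ _; subst i.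
  have [z] := zero_hom (c i.+1) (c i).
  by exists z; split; lia.
have [D [D1 D2 D3]] := composites_exist d.
have Dd i : D i.+1 i = d i by rewrite D2 // D1 comp1m.
exists (fun i => c i : E), D, (c_A (c m.+2)), (c_L (c m.+1)), (c_D (c 1)).
exists (fun j => c_F (c j.+1) j), (fun j => c_G (c j.+1) j).
split; [exact: pA|exact: pL|exact: pD|by split|split].
- by move=> a; rewrite Dd; case: (dP m.+1) => /(_ erefl).
- move=> e a; have H l : l = 1 ->
      c_D (c 1) a ∘ D l.+1 1 = rm_forget (M (tgt a) m) ∘ c_L (c l.+1) a.
    by move=> ->; rewrite Dd; case: (dP 1) => _ _ _ _ /(_ erefl e a).
  exact: H.
- move=> m1; split.
  + move=> j /andP [j0 jm]; have jm' : j < m by lia.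
    exact: (pFG j.+1 j0 jm').
  (* [m.-1.+1] is [m] only up to a proof, so the row is generalized before the map is identified
     with [d]. *)
  + move=> a; have H l l' : l = m -> l' = m -> c_F (c l) m.-1 a ∘ D l'.+1 l
        = pPF (t (tgt a)) ∘ (pMP (t (tgt a)) ∘ c_L (c l'.+1) a).
      move=> el el'; have -> : l' = l by rewrite el.
      have l1 : 1 < l by rewrite el.
      by have [_ /(_ el l1 a) [h _] _ _ _] := dP l; rewrite Dd.
    by apply: H => //; lia.
  + move=> a; have H l l' : l = m -> l' = m -> c_G (c l) m.-1 a ∘ D l'.+1 l
        = pNG (t (tgt a)) ∘ (pMN (t (tgt a)) ∘ c_L (c l'.+1) a).
      move=> el el'; have -> : l' = l by rewrite el.
      have l1 : 1 < l by rewrite el.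
      by have [_ /(_ el l1 a) [_ h] _ _ _] := dP l; rewrite Dd.
    by apply: H => //; lia.
  + move=> j a j0 jm; have [_ _ /(_ j erefl j0 jm a) [H _] _ _] := dP j.+1.
    by rewrite Dd.
  + move=> j a j0 jm; have [_ _ /(_ j erefl j0 jm a) [_ H] _ _] := dP j.+1.
    by rewrite Dd.
  + move=> a b h; have [_ _ _ /(_ erefl m1 a b) [H _] _] := dP 1.
    by rewrite Dd H.
  + move=> a b h; have [_ _ _ /(_ erefl m1 a b) [_ H] _] := dP 1.
    by rewrite Dd H.
Qed.

End Cells.
End Existence.

(** * All positions of a grid *)

Record grid_over (E : pointed_model_category) (n : nat) (Q P B : E) (PQ : hom P Q)
    (c : column n.+2 Q P) (Psi : hom B (cob c 1)) (QB : hom Q B)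
    (s : nat -> column n.+2 Q P)
    (S : nat -> column n.+2 Q P := dcons (T := fun=> column n.+2 Q P) c s)
    (gm : forall j i j' i', hom (cob (S j) i) (cob (S j') i'))
    (iota : hom B (cob (S 1) 1)) : Prop := GridOver {
  go_col : forall i i', gm 0 i 0 i' = cmap c i i';
  go_id : forall j i, in_grid n.+2 j i -> gm j i j i = idm (cob (S j) i);
  go_comp : forall j i j' i' j'' i'',
    in_grid n.+2 j i -> in_grid n.+2 j' i' -> in_grid n.+2 j'' i'' ->
    j'' <= j' <= j -> i'' <= i' <= i ->
    gm j' i' j'' i'' ∘ gm j i j' i' = gm j i j'' i'';
  go_iota : [/\ acof iota, fib (gm 1 1 0 1), gm 1 1 0 1 ∘ iota = Psi
    & cQ (S 1) 1 = iota ∘ QB];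
  go_pullback : forall j i, j.+1 < n.+2 -> j.+2 <= i <= n.+3 ->
    is_pullback (gm j.+1 j.+1 j j.+1) (gm j i j j.+1)
      (gm j.+1 i j.+1 j.+1) (gm j.+1 i j i);
  go_compat : forall j i j' i', in_grid n.+2 j i -> in_grid n.+2 j' i' ->
    j' <= j -> i' <= i -> i <= n.+2 -> gm j i j' i' ∘ cQ (S j) i = cQ (S j') i';
  go_acof : forall j, 1 <= j <= n -> acof (cQ (S j.+1) j.+1);
  go_fib : forall j, 1 <= j <= n -> fib (gm j.+1 j.+1 j j.+1);
  go_PQ : gm n.+1 n.+3 n.+1 n.+2 ∘ cP (S n.+1) = cQ (S n.+1) n.+2 ∘ PQ;
  go_PA : gm n.+1 n.+3 0 n.+3 ∘ cP (S n.+1) = cP c }.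

(** A grid map goes along row [i] to column [j'] and then down that column. That composites are
    again of this form rests on the squares [Hsq], which exchange the two directions. *)
Lemma grid_over_exists (E : pointed_model_category) (n : nat) (Q P B : E) (PQ : hom P Q)
    (c : column n.+2 Q P) (Psi : hom B (cob c 1)) (QB : hom Q B) :
  (forall i, cmap c i i = idm (cob c i)) -> valid PQ 0 c -> Psi ∘ QB = cQ c 1 ->
  exists s gm iota, @grid_over E n Q P B PQ c Psi QB s gm iota.
Proof.
move=> D1 v0 eQ; have [s [h [h0 hS]]] := columns_exist v0 (ltn0Sn _) eQ.
exists s; set S := dcons (T := fun=> column n.+2 Q P) c s.
have {}hS j : 0 < j -> j < n.+2 -> step_ok PQ (cQ (S j) j.+1) (idm Q) (h j) := hS j.
have vS j : j < n.+2 -> valid PQ j (S j).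
  by case: j => // -[|j] jn; [exact: (s_valid h0)|exact: (s_valid (hS j.+1 isT (ltnW jn)))].
have sq j i i' : j < n.+2 -> j < i' -> i' <= i ->
    h j i' ∘ cmap (S j.+1) i i' = cmap (S j) i i' ∘ h j i.
  by case: j => [|j] jn; [exact: (s_sq h0)|exact: (s_sq (hS j.+1 isT jn))].
have sQ j i : j < n.+2 -> j < i -> i <= n.+2 -> h j i ∘ cQ (S j.+1) i = cQ (S j) i.
  by case: j => [|j] jn; [exact: (s_Q h0)|exact: (s_Q (hS j.+1 isT jn))].
have sP j : j < n.+2 -> h j n.+3 ∘ cP (S j.+1) = cP (S j).
  by case: j => [|j] jn; [exact: (s_P h0)|exact: (s_P (hS j.+1 isT jn))].
have sfib j : j < n.+2 -> fib (h j j.+1).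
  by case: j => [|j] jn; [exact: (s_fib h0)|exact: (s_fib (hS j.+1 isT jn))].
have spb j i : j < n.+2 -> j.+1 < i -> is_pullback (h j j.+1) (cmap (S j) i j.+1)
    (cmap (S j.+1) i j.+1) (h j i).
  by case: j => [|j] jn; [exact: (s_pullback h0)|exact: (s_pullback (hS j.+1 isT jn))].
have /dep_choice [H HP] : forall i, exists H : forall j j', hom (cob (S j) i) (cob (S j') i),
    [/\ forall j, H j j = idm (cob (S j) i),
        forall j j', j' <= j -> H j.+1 j' = H j j' ∘ h j i
      & forall j j' j'', j'' <= j' -> j' <= j -> H j' j'' ∘ H j j' = H j j''].
  by move=> i; apply: (composites_exist (fun j => h j i)).
have H1 i j : H i j j = idm _ by case: (HP i).
have H2 i j j' : j' <= j -> H i j.+1 j' = H i j j' ∘ h j i by case: (HP i) => _ + _; apply.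
have H3 i j j' j'' : j'' <= j' -> j' <= j -> H i j' j'' ∘ H i j j' = H i j j''.
  by case: (HP i) => _ _; apply.
have Hh i j : H i j.+1 j = h j i by rewrite H2 // H1 comp1m.
have Hsq i i' j j' : j < n.+2 -> j <= i' -> j' <= j -> 0 < i' -> i' <= i ->
    H i' j j' ∘ cmap (S j) i i' = cmap (S j') i i' ∘ H i j j'.
  elim: j => [|j IH] jn ji jj i0 ii.
    by move: jj; rewrite leqn0 => /eqP ->; rewrite !H1 comp1m compm1.
  have [->|n'] := eqVneq j' j.+1; first by rewrite !H1 comp1m compm1.
  have jj' : j' <= j by rewrite -ltnS ltn_neqAle n'.
  by rewrite !H2 // -compA sq ?(ltnW jn) // !compA IH // ltnW.
have HQ i j j' : j < n.+2 -> j <= i -> j' <= j -> i <= n.+2 ->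
    H i j j' ∘ cQ (S j) i = cQ (S j') i.
  elim: j => [|j IH] jn ji jj i2.
    by move: jj; rewrite leqn0 => /eqP ->; rewrite H1 comp1m.
  have [->|n'] := eqVneq j' j.+1; first by rewrite H1 comp1m.
  have jj' : j' <= j by rewrite -ltnS ltn_neqAle n'.
  by rewrite H2 // -compA sQ ?(ltnW jn) // IH // ltnW.
have HPA j : j < n.+2 -> H n.+3 j 0 ∘ cP (S j) = cP c.
  elim: j => [|j IH] jn; first by rewrite H1 comp1m.
  by rewrite H2 // -compA sP ?(ltnW jn) // IH // ltnW.
have vid j i : j < n.+2 -> 0 < i -> j <= i -> cmap (S j) i i = idm _.
  by move=> jn i0 ji; apply: (v_id (vS j jn)).
exists (fun j i j' i' => cmap (S j') i i' ∘ H i j j').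
have [iota [i1 i2 i3]] := s_acof h0; exists iota.
split.
- by move=> i i'; rewrite H1 compm1.
- by move=> j i /and4P [jn i0 ji _]; rewrite H1 vid // comp1m.
- move=> j i j' i' j'' i'' /and4P [jn i0 ji im] /and4P [jn' i0' ji' im'].
  move=> /and4P [jn'' i0'' ji'' im''] /andP [j1 j2] /andP [k1 k2].
  rewrite -compA (compA (H i' j' j'')) Hsq // -compA H3 // compA.
  by rewrite (v_comp (vS j'' jn'')).
- by split=> //; rewrite Hh (vid 0) // comp1m //; apply: sfib.
- move=> j i jn /andP [ji im]; rewrite !H1 !Hh !compm1.
  rewrite (vid j j.+1) ?(ltnW jn) // comp1m (vid j i) ?comp1m; [|lia..].
  by apply: spb => //; apply: ltnW.
- move=> j i j' i' /and4P [jn i0 ji im] /and4P [jn' i0' ji' im'] jj ii i2'.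
  by rewrite -compA HQ // (v_Q (vS j' jn')).
- move=> j /andP [j0 jn]; have [|f [f1 f2 f3]] := s_acof (hS j j0 _); first by lia.
  by rewrite f3 compm1.
- move=> j /andP [j0 jn]; rewrite Hh vid ?comp1m; [|lia..].
  by apply: sfib; lia.
- by rewrite H1 compm1; apply: (v_P (vS n.+1 _)).
- transitivity (cmap (S 0) n.+3 n.+3 ∘ cP c); last by rewrite vid // comp1m.
  rewrite -compA; exact: (congr1 (fun z => cmap (S 0) n.+3 n.+3 ∘ z) (HPA n.+1 (ltnSn _))).
Qed.

Lemma laws_tower (E : pointed_model_category) (J : pointed_weak_lattice) (x : J)
    (k : nat) (Y0 : J -> E) (Y : functor (bdry x k) E (fun s => Y0 (sval s)))
    (S : grid_data Y) n v : grid_laws S v n -> tower_facts (piece_of S v n.+2).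
Proof.
move=> gl; split.
- case=> [[u f d] o] h /=; rewrite (compA (gmap _ _ _ _ _ _ _)) (gPF_A gl).
  exact: (gMP_A gl (a := trelax (a := Tarrow (tarr := Arrow (tgt_ := u) f d) o) h) d).
- move=> j j0 jn; apply: (gmap_comp gl); rewrite /in_grid; lia.
- by move=> j jn; apply: (gGmap_B gl).
- case=> [[u f d] o] h /=.
  have e1 := gNG_law gl; have e2 := gQG_B gl; have e3 := gMN_Q gl.
  have e4 := gMQ_B gl (b := trelax (a := Tarrow (tarr := Arrow (tgt_ := u) f d) o) h) d.
  move: e1 e2 e3 e4 => /= e1 e2 e3 <-.
  by rewrite (compA (gGmap _ _ _ _)) e1 -(compA (gQG _ _ _)) e3 (compA (gGB _ _ _ _)) e2.
Qed.

(** * Passage from one size to the next *)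

Section GridExistence.
Variables (E : pointed_model_category) (J : pointed_weak_lattice).
Variables (x : J) (k : nat) (Y0 : J -> E).
Variable Y : functor (bdry x k) E (fun s => Y0 (sval s)).
Variable M : forall y m, reduced_matching Y y m.
Variable mb : forall (v : bdry x k) m, hom (Y0 (sval v)) (M (sval v) m).
Hypothesis mbP : forall v m, is_matching_map (mb v m).

Section MatchingObjects.
Variables (n : nat) (y : J).
Local Notation B := (rm_til (M y n.+1)).
Local Notation top := (tarrow x k y (deg_eq n.+2)).
Variables (C1 L A : E).
Variable Dp : forall a : top, hom C1 (rm_til (M (tgt a) n.+1)).
Variable Lp : forall a : top, hom L (M (tgt a) n.+1).
Variable Ap : forall a : top, hom A (Y0 (tgt a)).
Variables (LD : hom L C1) (AL : hom A L).
Hypotheses (pD : is_product Dp) (pL : is_product Lp) (pA : is_product Ap).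
Hypothesis LDP : forall a, Dp a ∘ LD = rm_forget (M (tgt a) n.+1) ∘ Lp a.
Hypothesis ALP : forall a, Lp a ∘ AL = mb (tgt_ a) n.+1 ∘ Ap a.

Lemma Psi_exists : exists Psi : hom B C1,
  (forall (a : top) (b : tarrow x k (tgt a) (deg_le n.+1)) (h : ~~ barred (arr (after b))),
     rm_til_pr (M (tgt a) n.+1) b ∘ (Dp a ∘ Psi) = rm_til_pr (M y n.+1) (Tarrow h)) /\
  (forall (a : top) (b : tarrow x k (tgt a) (deg_le n.+1)), barred (arr (after b)) ->
     is_zero_map (rm_til_pr (M (tgt a) n.+1) b ∘ (Dp a ∘ Psi))).
Proof.
have /dep_choice [u uP] : forall a : top, exists u : hom B (rm_til (M (tgt a) n.+1)),
    forall b : tarrow x k (tgt a) (deg_le n.+1),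
    (forall h : ~~ barred (arr (after b)),
      rm_til_pr (M (tgt a) n.+1) b ∘ u = rm_til_pr (M y n.+1) (Tarrow h)) /\
    (barred (arr (after b)) -> is_zero_map (rm_til_pr (M (tgt a) n.+1) b ∘ u)).
  move=> a; have /dep_choice [w wP] : forall b : tarrow x k (tgt a) (deg_le n.+1),
      exists w : hom B (Y0 (tgt b)),
      (forall h : ~~ barred (arr (after b)), w = rm_til_pr (M y n.+1) (Tarrow h)) /\
      (barred (arr (after b)) -> is_zero_map w).
    move=> b; case: (orP (orbN (barred (arr (after b))))) => h.
      have [f zf] := zero_map_exists B (Y0 (tgt b)); exists f; split=> // h'.
      by case: (negP h' h).
    exists (rm_til_pr (M y n.+1) (Tarrow h)); split=> [h'|h'].
      by rewrite (bool_irrelevance h' h).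
    by case: (negP h h').
  have [u uP] := product_ex (rm_til_product (M (tgt a) n.+1)) w.
  by exists u => b; rewrite uP; apply: wP.
have [Psi PsiP] := product_ex pD u.
by exists Psi; split=> a b; rewrite PsiP; [apply: (proj1 (uP a b))|apply: (proj2 (uP a b))].
Qed.

Lemma matching_to_B : exists f : hom (M y n.+2) B,
  forall (b : tarrow x k y (deg_le n.+1)) (h : deg_le n.+2 (deg (tgt b))),
    rm_til_pr (M y n.+1) b ∘ f = rm_cmp (M y n.+2) (relax h).
Proof.
have [f fP] := product_ex (rm_til_product (M y n.+1))
  (fun b => rm_cmp (M y n.+2) (relax (a := b) (leqW (arr_deg b)))).
by exists f => b h; rewrite fP (bool_irrelevance h (leqW (arr_deg b))).
Qed.

Lemma matching_to_L : exists f : hom (M y n.+2) L,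
  forall (a : top) (b : arrow x k (tgt a) (deg_le n.+1)) (h : deg_le n.+2 (deg (tgt b))),
    rm_cmp (M (tgt a) n.+1) b ∘ (Lp a ∘ f) = rm_cmp (M y n.+2) (relax (a := after b) h).
Proof.
have /dep_choice [u uP] : forall a : top, exists u : hom (M y n.+2) (M (tgt a) n.+1),
    forall b : arrow x k (tgt a) (deg_le n.+1), rm_cmp (M (tgt a) n.+1) b ∘ u
      = rm_cmp (M y n.+2) (relax (a := after b) (leqW (arr_deg b))).
  move=> a; apply: rm_ex.
  - move=> b b' g e; apply: (@rm_cmp_nat _ _ _ _ _ _ _ _ (M y n.+2)
      (relax (a := after b) _) (relax (a := after b') _)).
    by rewrite /= compA e.
  - move=> b h; apply: (@rm_cmp_bar _ _ _ _ _ _ _ _ _ (relax (a := after b) _)).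
    by apply: barred_comp; rewrite h.
have [f fP] := product_ex pL u.
by exists f => a b h; rewrite fP uP (bool_irrelevance h (leqW (arr_deg b))).
Qed.

Lemma matching_to_A : exists f : hom (M y n.+2) A,
  forall (a : top) (h : deg_le n.+2 (deg (tgt a))),
    Ap a ∘ f = rm_cmp (M y n.+2) (relax h).
Proof.
have H (a : top) : deg_le n.+2 (deg (tgt a)) by rewrite /deg_le (eqP (arr_deg a)).
have [f fP] := product_ex pA (fun a => rm_cmp (M y n.+2) (relax (H a))).
by exists f => a h; rewrite fP (bool_irrelevance h (H a)).
Qed.

Lemma matching_to_M : exists f : hom (M y n.+2) (M y n.+1),
  forall (b : arrow x k y (deg_le n.+1)) (h : deg_le n.+2 (deg (tgt b))),
    rm_cmp (M y n.+1) b ∘ f = rm_cmp (M y n.+2) (relax h).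
Proof.
have [||f fP] := @rm_ex _ _ _ _ _ _ _ _ (M y n.+1) (M y n.+2)
  (fun b => rm_cmp (M y n.+2) (relax (a := b) (leqW (arr_deg b)))).
- by move=> b b' g e; apply: (@rm_cmp_nat _ _ _ _ _ _ _ _ (M y n.+2)
    (relax (a := b) _) (relax (a := b') _)).
- by move=> b h; apply: (@rm_cmp_bar _ _ _ _ _ _ _ _ _ (relax (a := b) _)).
- by exists f => b h; rewrite fP (bool_irrelevance h (leqW (arr_deg b))).
Qed.

Lemma matching_objects_exist :
  exists (Psi : hom B C1) (Q : E) (QB : hom Q B) (QL : hom Q L)
    (N : E) (NM : hom N (M y n.+1)) (NQ : hom N Q) (P : E) (PQ : hom P Q) (PA : hom P A)
    (MQ : hom (M y n.+2) Q) (MN : hom (M y n.+2) N) (MP : hom (M y n.+2) P),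
  [/\ forall (a : top) (b : tarrow x k (tgt a) (deg_le n.+1))
        (h : ~~ barred (arr (after b))),
        rm_til_pr (M (tgt a) n.+1) b ∘ (Dp a ∘ Psi) = rm_til_pr (M y n.+1) (Tarrow h),
      forall (a : top) (b : tarrow x k (tgt a) (deg_le n.+1)), barred (arr (after b)) ->
        is_zero_map (rm_til_pr (M (tgt a) n.+1) b ∘ (Dp a ∘ Psi)),
      [/\ is_pullback Psi LD QB QL, is_pullback (rm_forget (M y n.+1)) QB NM NQ
        & is_pullback QL AL PQ PA],
      [/\ forall (b : tarrow x k y (deg_le n.+1)) (h : deg_le n.+2 (deg (tgt b))),
            rm_til_pr (M y n.+1) b ∘ (QB ∘ MQ) = rm_cmp (M y n.+2) (relax h)
        & forall (a : top) (b : arrow x k (tgt a) (deg_le n.+1))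
            (h : deg_le n.+2 (deg (tgt b))),
            rm_cmp (M (tgt a) n.+1) b ∘ (Lp a ∘ (QL ∘ MQ))
              = rm_cmp (M y n.+2) (relax (a := after b) h)]
    & [/\ forall (b : arrow x k y (deg_le n.+1)) (h : deg_le n.+2 (deg (tgt b))),
            rm_cmp (M y n.+1) b ∘ (NM ∘ MN) = rm_cmp (M y n.+2) (relax h),
          NQ ∘ MN = MQ, PQ ∘ MP = MQ
        & forall (a : top) (h : deg_le n.+2 (deg (tgt a))),
            Ap a ∘ (PA ∘ MP) = rm_cmp (M y n.+2) (relax h)]].
Proof.
have [Psi [Psi1 Psi2]] := Psi_exists.
have [Q [QB [QL pQ]]] := pullback_exists Psi LD.
have [N [NM [NQ pN]]] := pullback_exists (rm_forget (M y n.+1)) QB.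
have [P [PQ [PA pP]]] := pullback_exists QL AL.
have [fB fBP] := matching_to_B; have [fL fLP] := matching_to_L.
have [fA fAP] := matching_to_A; have [fM fMP] := matching_to_M.
have [|MQ [MQB MQL]] := pullback_ex pQ (u := fB) (v := fL).
  (* The two maps into $D$ agree factor by factor: both vanish where the composite arrow is barred,
     and elsewhere both are the component of the matching object at that composite. *)
  apply: (product_mono pD) => a; rewrite compA; rewrite (compA (Dp a)) LDP.
  apply: (product_mono (rm_til_product (M (tgt a) n.+1))) => b.
  have hb : deg_le n.+2 (deg (tgt b)) := leqW (arr_deg b).
  rewrite -(compA (rm_forget _)) (compA _ (rm_forget _)) rm_til_forget (fLP a b hb).
  rewrite compA; case: (orP (orbN (barred (arr (after b))))) => h.
    apply: zero_map_eq; first by apply: zero_map_compl; apply: Psi2.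
    exact: (@rm_cmp_bar _ _ _ _ _ _ _ _ _ (relax (a := after b) hb)).
  by rewrite Psi1; apply: (fBP (Tarrow h)).
have [|MN [MNM MNQ]] := pullback_ex pN (u := fM) (v := MQ).
  rewrite MQB; apply: (product_mono (rm_til_product (M y n.+1))) => b.
  have hb : deg_le n.+2 (deg (tgt b)) := leqW (arr_deg b).
  by rewrite compA rm_til_forget fMP fBP.
have [|MP [MPQ MPA]] := pullback_ex pP (u := MQ) (v := fA).
  rewrite MQL; apply: (product_mono pL) => a; rewrite [RHS]compA ALP.
  apply: rm_cmp_mono => b; have hb : deg_le n.+2 (deg (tgt b)) := leqW (arr_deg b).
  have ha : deg_le n.+2 (deg (tgt a)) by rewrite /deg_le (eqP (arr_deg a)).
  rewrite (fLP a b hb) -(compA (mb _ _)) (compA (rm_cmp _ _)) mbP (fAP a ha).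
  by symmetry; apply: (rm_cmp_nat (M y n.+2) (a := relax ha) (b := relax (a := after b) hb)).
exists Psi, Q, QB, QL, N, NM, NQ, P, PQ, PA, MQ, MN, MP.
by split=> //; split=> //; rewrite ?MQB ?MQL ?MNM ?MPA.
Qed.

End MatchingObjects.

Lemma default_columns (R : forall m, layer M m) :
  inhabited (forall y m, column_maps R y m).
Proof.
have /dep_choice [f _] := fun ab : E * E => zero_map_exists ab.1 ab.2.
by apply: inhabits => y m j a; split; [apply: (f (_, _))|apply: (f (_, _))].
Qed.

Lemma good_tower n (t : layer M n.+2) : good mb t -> forall v, tower_facts (t v).
Proof.
move=> gt v; have [R e] := family_through t; have [C] := default_columns R.
by have [] := laws_tower (gt n erefl R C e v); rewrite /= e; split.
Qed.

(** The laws hold for every family through [p] because, once the matching objects and matching maps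
    are fixed, they involve no other piece; only column 0 refers to the layer [t] below. *)
Lemma piece_exists n (t : layer M n.+1) y : good mb t ->
  exists p : piece M y n.+2,
  [/\ forall (R : forall m, layer M m) (C : forall y m, column_maps R y m),
        R n.+2 y = p -> grid_laws (assemble mb C) y n,
      pLD p = pmap p 0 n.+2 0 1
    & 0 < n -> exists CF CG,
        column_laws t (C := pF p 0) (fun i i' => pmap p 0 i 0 i') (pL_pr p) (pD_pr p) CF CG].
Proof.
move=> gt; have [C [D [Ap [Lp [Dp [CF [CG [pA pL pD [D1 D2] [AL n0 cl]]]]]]]]] :=
  column_exists mb t y (ltn0Sn n).
have LDP a : Dp a ∘ D n.+2 1 = rm_forget (M (tgt a) n.+1) ∘ Lp a.
  (* For size two the map from $L$ to $D$ is forgetful by construction; for larger sizes this is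
     derived from the laws of the layer below. *)
  case: n t gt C D Ap Lp Dp CF CG pA pL pD D1 D2 AL n0 cl a => [|n] t gt C D Ap Lp
    Dp CF CG pA pL pD D1 D2 AL n0 cl a; first exact: n0.
  apply: (column_forget _ _ (cl isT)) => [b|i i' i'' _ h h' _]; last exact: D2.
  exact: good_tower.
have [Psi [Q [QB [QL [N [NM [NQ [P [PQ [PA [MQ [MN [MP H]]]]]]]]]]]]] :=
  matching_objects_exist pD pL pA LDP AL.
have {H} [Psi1 Psi2 [pQ pN pP] [MQ1 MQ2] [MN1 MN2 MP1 MP2]] := H.
have QBC : Psi ∘ QB = D n.+1 1 ∘ (D n.+2 n.+1 ∘ QL).
  by rewrite compA D2 // (pullback_comm pQ).
have [G [Gm [GB [GC [QG [NG [G1 G2 [G3 G4] [G5 G6] G7]]]]]]] :=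
  extra_objects_exist (fun i i' i'' _ => @D2 i i' i'') NQ QBC.
pose c := @Column E n.+2 Q P C D (fun i => D n.+2 i ∘ QL) PA.
have vc : valid PQ 0 c.
  split=> //=.
  - by move=> i i' i'' _ _; apply: D2.
  - by move=> i i' _ _ h h'; rewrite compA D2.
  - by rewrite -(pullback_comm pP) D1 comp1m.
have [s [gm [iota go]]] := grid_over_exists (c := c) D1 vc (pullback_comm pQ).
(* [s n] is column [n + 1], the last one, in which the map out of $\overline{\mathbf P}$ ends. *)
pose p := @Piece E J x k Y0 Y M y n.+2
  (fun j => cob (dcons (T := fun=> column n.+2 Q P) c s j)) gm Ap Lp Dp (gm 0 n.+2 0 1)
  Psi Q QB QL N NM NQ P PQ PA MQ MN MP G Gm GB GC QG NG iota
  (fun j => cQ (dcons (T := fun=> column n.+2 Q P) c s j)) (cP (s n)).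
have eD : (fun i i' => gm 0 i 0 i') = D :> (forall i i', hom (C i) (C i')).
  apply/functional_extensionality_dep => i; apply/functional_extensionality_dep => i'.
  exact: (go_col go).
exists p; split=> //; last first.
  by move=> n1; exists CF, CG; have := cl n1; rewrite -{1}eD.
move=> R Cm e; have [o1 o2 o3 [o4 o5 o6 o7] o8 o9 o10 o11 o12 o13] := go.
split; rewrite /= ?e /=.
- by [].
- by [].
- by [].
- by move=> a; apply: mbP.
- by move=> a; rewrite o1 AL.
- by move=> a; rewrite o1 LDP.
- by [].
- by [].
- by rewrite o1.
- by [].
- by rewrite o1.
- by [].
- by [].
- by [].
- by [].
- by [].
- by [].
- by [].
- by [].
- by move=> j jn; rewrite o1; apply: G1.
- by move=> j jn; case: (G2 j jn).
- by move=> j jn; rewrite o1; case: (G2 j jn).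
- by [].
- by rewrite o1.
- by [].
- by [].
- by [].
- by [].
- by [].
- by [].
- by [].
- by rewrite D1 comp1m.
- by [].
- by [].
- by [].
- by [].
- by [].
- by [].
Qed.

End GridExistence.

(** A grid of size [m] at [y] uses grids of size [m - 1] at other objects, so the recursion builds a
    whole layer, one grid for each [y], at a time. Matching objects are fixed beforehand, so that
    all layers share them. *)
Lemma separation_grid_exists (E : pointed_model_category) (J : pointed_weak_lattice)
    (x : J) (k : nat) (Y0 : J -> E) (Y : functor (bdry x k) E (fun s => Y0 (sval s))) :
  pointed_on Y -> inhabited (separation_grid Y).
Proof.
move=> pY.
have /dep_choice [M0 _] : forall ym : J * nat, exists M : reduced_matching Y ym.1 ym.2, True.
  by move=> [y m]; have [M] := reduced_matching_exists Y y m; exists M.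
pose M y m := M0 (y, m).
have /dep_choice [mb0 mb0P] : forall vm : bdry x k * nat,
    exists h : hom (Y0 (sval vm.1)) (M (sval vm.1) vm.2), is_matching_map h.
  by move=> [v m]; apply: matching_map_exists.
pose mb v m := mb0 (v, m).
have mbP v m : is_matching_map (mb v m) := mb0P (v, m).
have [d0] := default_layer M 0.
pose stacked m (t : layer M m) (t' : layer M m.+1) := 0 < m -> forall y,
  pLD (t' y) = pmap (t' y) 0 m.+1 0 1 /\
  (1 < m -> exists CF CG, column_laws t (C := pF (t' y) 0)
    (fun i i' => pmap (t' y) 0 i 0 i') (pL_pr (t' y)) (pD_pr (t' y)) CF CG).
have [|s [_ sP]] := @dep_sequence (layer M)
    (fun m t t' => good mb t -> good mb t' /\ stacked m t t') d0.
  move=> [|m] t.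
    (* Layers of sizes 0 and 1 are fillers: [good] is vacuous below size two. *)
    by have [d] := default_layer M 1; exists d => _; split.
  have [gt|ngt] := pselect (good mb t); last first.
    by have [d] := default_layer M m.+2; exists d.
  have /dep_choice [p pP] := fun y => piece_exists mbP y gt.
  exists p => _; split.
    move=> n [e]; subst n => R C e y; have [+ _ _] := pP y.
    by apply; rewrite e.
  by move=> _ y; have [_ e H] := pP y.
have gs m : good mb (s m) by elim: m => [|m IH] //; case: (sP m IH).
have /dep_choice [C0 C0P] : forall ym : J * nat, exists c : column_maps s ym.1 ym.2,
    match ym.2 as m return column_maps s ym.1 m -> Prop with
    | 0 => fun _ => True
    | m.+1 => fun c => 1 < m -> column_laws (s m) (C := pF (s m.+1 ym.1) 0)
        (fun i i' => pmap (s m.+1 ym.1) 0 i 0 i') (pL_pr (s m.+1 ym.1))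
        (pD_pr (s m.+1 ym.1)) (fun j a => (c j a).1) (fun j a => (c j a).2)
    end c.
  move=> [y m] /=; have [C] := default_columns s.
  case: m => [|m]; first by exists (C y 0).
  apply: (cond_ex (C y m.+1)) => m1.
  have [_ /(_ (ltnW m1) y) [_ /(_ m1) [CF [CG cl]]]] := sP m (gs m).
  by exists (fun j a => (CF j a, CG j a)).
pose S := assemble mb (fun y m => C0 (y, m)).
apply: inhabits; apply: (@SeparationGrid _ _ _ _ _ _ S).
- by move=> y n _; apply: (gs n.+2 n).
- by move=> y _; have [_ /(_ isT y) [e _]] := sP 1 (gs 1).
- by move=> y n _; have [] := C0P (y, n.+3) isT.
Qed.

(** * The operations *)

Section Degrees.
Variable J : weak_lattice.

Lemma is_id_eq (s t : J) (f : hom s t) : is_id f ->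
  forall e : s = t, f = eq_rect s (fun u => hom s u) (idm s) t e.
Proof. by case=> a e; rewrite (Prop_irrelevance e erefl). Qed.

Lemma endo_id (s : J) (f : hom s s) : f = idm s.
Proof.
have [/is_id_eq /(_ erefl) //|n] := pselect (is_id f).
by have := wl_decreasing n; rewrite ltnn.
Qed.

Lemma deg_lt (s t : J) (f : hom s t) : s <> t -> deg t < deg s.
Proof. by move=> n; apply: (wl_decreasing (f := f)) => i; apply: n; case: i. Qed.

End Degrees.

(** A zero object [z'] of the homotopy category need not be the zero object [z] of [E]. The map [u]
    also factors through [z], and its part from [z] to [b] is represented by a map of [E] because
    [z] is cofibrant and [b] fibrant; hence [u] is the class of a zero map. *)
Lemma loc_zero (E : pointed_model_category) (H : homotopy_category E) (a b : E)
    (f : hom a b) (u : @hom (ho H) a b) : fibrant b ->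
  is_zero_map f -> is_zero_map u -> loc H f = u.
Proof.
move=> fb zf [z' [p [i [zz' ->]]]].
have [z [zz fz cz]] := zero_object_bifibrant E.
have [q [_ _]] := proj1 zz a.
have [t [_ _]] := proj1 zz' (z : ho H).
have [g gP] := (loc_surjective_injective H cz fb).1 (i ∘ t).
rewrite (terminal_eq p (t ∘ loc H q) (proj1 zz')) compA -gP -loc_comp.
congr (loc H _); apply: zero_map_eq zf _.
by have [w [_ _]] := proj2 zz b; exists z, q, g.
Qed.

(** In size two this is a clause of the grid. Beyond that the targets [tgt a], of degree [k], are
    admissible for size [k - 1], so [column_forget] applies to the given grid. *)
Lemma column0_gLD (E : pointed_model_category) (J : pointed_weak_lattice) (x : J)
    (k0 : nat) (Y0 : J -> E) (Y : functor (bdry x k0.+2) E (fun s => Y0 (sval s)))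
    (S : separation_grid Y) : k0.+2 < deg x ->
  gmap S x k0.+2 0 k0.+2 0 1 = gLD S x k0.+2.
Proof.
move=> kx; have ad : admissible x k0.+2 x k0.+2 by split=> //; left.
have gl := sg_laws S ad.
have h : forall a, gD_pr S (y := x) (m := k0.+2) a ∘ gmap S x k0.+2 0 k0.+2 0 1
    = rm_forget (gM S (tgt a) k0.+1) ∘ gL_pr S (y := x) (m := k0.+2) a; last first.
  by apply: (product_mono (gD_product gl)) => a; rewrite h (gLD_law gl).
case: k0 Y S kx gl ad => [|k1] Y S kx gl ad a.
  by rewrite (sg_column0_two S ad) (gLD_law gl).
apply: (column_forget (M := gM S) (n := k1) (t := fun y => piece_of S y k1.+2)
  (C := gF S x k1.+3 0) (D := fun i i' => gmap S x k1.+3 0 i 0 i')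
  (CF := fun j a => gCF S j a) (CG := fun j a => gCG S j a)).
- move=> b; apply: laws_tower; apply: sg_laws; split; last by right; apply: svalP.
  by rewrite (eqP (arr_deg b)).
- by move=> i i' i'' *; apply: (gmap_comp gl); rewrite /in_grid; lia.
- by have [] := sg_column0 S ad; split.
Qed.

(** * Equivalence of strict lifts, operations and extensions *)

Section Main.
Variables (E : pointed_model_category) (H : homotopy_category E).
Variables (J : pointed_weak_lattice) (Y0 : J -> E) (Yt : functor J (ho H) Y0).
Variables (x : J) (k0 : nat).
Local Notation k := k0.+2.
Variable Yk : functor (bdry x k) E (fun s => Y0 (sval s)).
Variable Yx : functor (sub x k0.+1) E (fun s => Y0 (sval s)).
Hypothesis pYt : pointed_functor Yt.
Hypothesis bif : forall s : J, fibrant (Y0 s) /\ cofibrant (Y0 s).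
Hypothesis k_lt : k < deg x.
Hypotheses (pYk : pointed_on Yk) (rYk : reedy_fibrant Yk) (lYk : lifts Yt Yk).
Hypotheses (pYx : pointed_on Yx) (lYx : lifts Yt Yx) (YxYk : agree Yx Yk).

Local Notation X := (Y0 x).
Let cX : cofibrant X := proj2 (bif x).

Lemma Yx_at_bar t (f : hom x t) d : barred f -> is_zero_map (Yx_at (k := k) Yx f d).
Proof.
by move=> b; apply: (pYx (s := exist (in_sub x k0.+1) x _) (t := exist _ t _)).
Qed.

Lemma loc_Yx_at t (f : hom x t) d : loc H (Yx_at (k := k) Yx f d) = Yt x t f.
Proof.
exact: (lYx (s := exist (in_sub x k0.+1) x _) (t := exist _ t _)).
Qed.

Lemma Yk_Yx_at (u v : bdry x k) (f : hom x (sval u)) (g : hom (sval u) (sval v)) d d' :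
  Yk u v g ∘ Yx_at (k := k) Yx f d = Yx_at (k := k) Yx (g ∘ f) d'.
Proof.
case: u v f g d d' => [u pu] [v pv] /= f g d d'.
rewrite /Yx_at -(YxYk (or_intror (conj (inhabits f) d))
  (or_intror (conj (inhabits (g ∘ f)) d'))).
symmetry; exact: (@fmap_comp _ _ _ Yx (exist (in_sub x k0.+1) x (or_introl erefl))
  (exist _ u _) (exist _ v _) g f).
Qed.

Section Grid.
Variable S : separation_grid Yk.

Lemma laws_x : grid_laws S x k0.
Proof. by apply: sg_laws; split=> //; left. Qed.

Lemma gLD_mono T (f g : hom T (gF S x k 0 k)) : gLD S x k ∘ f = gLD S x k ∘ g -> f = g.
Proof.
move=> e; apply: (product_mono (gL_product laws_x)) => a; apply: rm_forget_mono.
by rewrite !compA -!(gLD_law laws_x) -!compA e.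
Qed.

Lemma gLD_gmap : gmap S x k 0 k 0 1 = gLD S x k.
Proof. exact: column0_gLD. Qed.

Lemma gAL_rlp : rlp (gmap S x k 0 k.+1 0 k).
Proof.
apply: (rlp_product (gA_product laws_x) (gL_product laws_x) (gAL_law laws_x)) => a.
apply: (reedy_matching_rlp rYk); last exact: (gmb_canonical laws_x).
exact: (eqP (arr_deg a)).
Qed.

Lemma gmap_gmap j i j' i' j'' i'' T (u : hom T (gF S x k j i)) :
  [&& j < k, i <= k.+1, j <= i, j' <= i', j'' <= i'', 0 < i'', j'' <= j', j' <= j,
      i'' <= i' & i' <= i] ->
  gmap S x k j' i' j'' i'' ∘ (gmap S x k j i j' i' ∘ u) = gmap S x k j i j'' i'' ∘ u.
Proof.
move=> h; rewrite compA (gmap_comp laws_x) //; move: h; rewrite /in_grid; lia.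
Qed.

Lemma gmap_same j i T (u : hom T (gF S x k j i)) : [&& j < k, i <= k.+1, j <= i & 0 < i] ->
  gmap S x k j i j i ∘ u = u.
Proof.
by move=> h; rewrite (gmap_id laws_x) ?comp1m //; move: h; rewrite /in_grid; lia.
Qed.

Lemma gmap_gQF j i j' i' T (u : hom T (gQ S x k)) :
  [&& j < k, i <= k, j <= i, j' <= i', 0 < i', j' <= j & i' <= i] ->
  gmap S x k j i j' i' ∘ (gQF S x k j i ∘ u) = gQF S x k j' i' ∘ u.
Proof.
move=> h; rewrite compA (gQF_compat laws_x) //; move: h; rewrite /in_grid; lia.
Qed.

Lemma gmap_corner_rlp j : j < k0.+1 -> rlp (gmap S x k j.+1 j.+1 j j.+1).
Proof.
case: j => [_|j jk]; apply: fib_rlp; first exact: (giota_fib laws_x).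
by apply: (gQF_fib laws_x); lia.
Qed.

Lemma gmap_pullback j i : j < k0.+1 -> j.+2 <= i -> i <= k.+1 ->
  is_pullback (gmap S x k j.+1 j.+1 j j.+1) (gmap S x k j i j j.+1)
      (gmap S x k j.+1 i j.+1 j.+1) (gmap S x k j.+1 i j i).
Proof. by move=> jk ji ik; apply: (gF_pullback laws_x); lia. Qed.

Lemma gmap_step_rlp j i : j < k0.+1 -> j.+2 <= i -> i <= k.+1 -> rlp (gmap S x k j.+1 i j i).
Proof.
move=> jk ji ik; apply: (rlp_pullback (gmap_pullback jk ji ik)).
exact: gmap_corner_rlp.
Qed.

Lemma matching_component (a : tarrow x k x (deg_eq k)) (b : arrow x k (tgt a) (deg_le k0.+1))
    T (s : hom T (gF S x k 0 k.+1)) :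
  rm_cmp (gM S (tgt a) k0.+1) b ∘ (gL_pr S a ∘ (gmap S x k 0 k.+1 0 k ∘ s))
    = Yk (tgt_ a) (tgt_ b) (arr b) ∘ (gA_pr S a ∘ s).
Proof.
rewrite (compA (gL_pr S a)) (gAL_law laws_x) -(compA (gmb _ _ _)).
rewrite (compA (rm_cmp _ _)).
exact: (congr1 (fun z => z ∘ (gA_pr S a ∘ s)) (gmb_canonical laws_x (a := a) b)).
Qed.

Lemma maps_from_x_exist : inhabited (@maps_from_x E J x k Y0 Yk H Yt Yx S).
Proof.
have gl := laws_x.
have [sl slP] := product_ex (rm_til_product (gM S x k0.+1))
  (fun b => Yx_at (k := k) Yx (arr b) (arr_deg b)).
have /dep_choice [s sP] : forall a : tarrow x k x (deg_eq k),
    exists f : hom X (Y0 (tgt a)), loc H f = Yt x (tgt a) (arr a).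
  by move=> a; apply: (loc_surjective_injective H cX (proj1 (bif _))).1.
have [sk skP] := product_ex (gA_product gl) s.
have /dep_choice [l lP] : forall a : tarrow x k x (deg_eq k),
    exists l : hom X (gM S (tgt a) k0.+1),
    forall b, rm_cmp (gM S (tgt a) k0.+1) b ∘ l
      = Yx_at (k := k) Yx (arr b ∘ arr a) (arr_deg b).
  move=> a; apply: rm_ex.
    move=> b b' g e; rewrite (Yk_Yx_at _ _ _ (arr_deg b')).
    move: (arr_deg b') => d; move: (arr b' ∘ arr a) (congr1 (fun z => z ∘ arr a) e).
    by rewrite -compA => z <-.
  by move=> b h; apply: Yx_at_bar; apply: barred_comp; rewrite h.
have [L LP] := product_ex (gL_product gl) l.
have [|et [etB etL]] := pullback_ex (gQ_pullback gl) (u := sl) (v := L).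
  apply: (product_mono (gD_product gl)) => a.
  rewrite [RHS]compA (gLD_law gl) -[RHS]compA LP.
  apply: (product_mono (rm_til_product (gM S (tgt a) k0.+1))) => b.
  rewrite [RHS]compA rm_til_forget lP.
  (* A factor of $D$ is indexed by two unbarred arrows whose composite may be barred; there both
     [gPsi] and [Yx] give zero. *)
  case: (orP (orbN (barred (arr (after b))))) => h.
    apply: zero_map_eq (Yx_at_bar _ h).
    rewrite !compA; apply: zero_map_compl; rewrite -compA.
    exact: (gPsi_bar gl).
  have e := gPsi_til gl h; rewrite !compA in e *; rewrite -!compA in e *.
  rewrite !compA -(compA _ _ (gPsi _ _ _)) e.
  exact: (slP (Tarrow h)).
apply: inhabits; apply: (@MapsFromX E J x k Y0 Yk H Yt Yx S sl _ sk _ et etB).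
- by [].
- by move=> a; rewrite skP; apply: sP.
- by move=> a b; rewrite etL LP lP.
Qed.

Section Operation.
Variable o : @maps_from_x E J x k Y0 Yk H Yt Yx S.
Local Notation lh := left_homotopic.
Local Notation gm := (gmap S x k).
Local Notation QF := (gQF S x k).
Let gl := laws_x.

Lemma loc_component (a : tarrow x k x (deg_eq k)) :
  loc H (gA_pr S a ∘ sigma_k o) = Yt x (tgt a) (arr a).
Proof. exact: sigma_kP. Qed.

Lemma QF0_eta : QF 0 k ∘ eta o = gQL S x k ∘ eta o.
Proof. by rewrite (gQF_L gl). Qed.

Lemma QF1_eta : QF 1 1 ∘ eta o = giota S x k ∘ sigma_lt o.
Proof. by rewrite (gQF_iota gl) -compA eta_B. Qed.

(** On each factor of $D$ both maps represent the value of [Yt] at the composite arrow, so they are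
    homotopic, over one cylinder [K] for all factors. This is what makes the first separated
    operation nonempty. *)
Lemma D_homotopic :
  lh (gLD S x k ∘ (gQL S x k ∘ eta o)) (gLD S x k ∘ (gm 0 k.+1 0 k ∘ sigma_k o)).
Proof.
have [K] := cylinder_exists X; apply/left_homotopicP; exists K.
apply: (homotopic_by_product (gD_product gl)) => a.
rewrite !(compA (gD_pr S a)) (gLD_law gl) -!(compA (rm_forget _)).
apply: (homotopic_by_product (rm_til_product (gM S (tgt a) k0.+1))) => b.
rewrite !(compA (rm_til_pr _ _)) rm_til_forget.
apply/(left_homotopic_by cX) => //; first exact: (proj1 (bif _)).
apply: (loc_surjective_injective H cX (proj1 (bif _))).2.
rewrite matching_component (eta_L o b) loc_Yx_at loc_comp loc_component (fmap_comp Yt).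
by congr (_ ∘ _); symmetry; apply: (lYk (arr b)).
Qed.

(* Equivalently, [s] is the $A$-component of a lift of [eta] to
   $\overline{\mathbf P}^x_k$. *)
Definition strict_lift (s : hom X (gF S x k 0 k.+1)) : Prop :=
  lh (sigma_k o) s /\ gm 0 k.+1 0 k ∘ s = gQL S x k ∘ eta o.

Lemma total_maps_L theta : total_maps o theta ->
  gm 1 k 0 k ∘ theta = gm 0 k.+1 0 k ∘ sigma_k o.
Proof.
move=> [_ /= e]; apply: gLD_mono; rewrite -e -gLD_gmap !gmap_gmap //; lia.
Qed.

Lemma strict_lift_of_total : total_vanishes o -> exists s, strict_lift s.
Proof.
move=> [theta tm /(homotopy_class_eq cX) h].
have [|s [s1 s2]] := homotopy_lifting cX (f := sigma_k o) (g := gQL S x k ∘ eta o) gAL_rlp.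
  rewrite -(total_maps_L tm) -QF0_eta -(gmap_gQF (j := 1) (i := k)); last lia.
  exact: left_homotopic_comp.
by exists s.
Qed.

Lemma total_of_strict_lift s : strict_lift s -> total_vanishes o.
Proof.
move=> [s1 s2].
have [|theta [t1 t2]] := homotopy_lifting cX (f := QF 1 k ∘ eta o)
    (g := gm 0 k.+1 0 k ∘ sigma_k o) (@gmap_step_rlp 0 k isT isT (leqnSn _)).
  rewrite gmap_gQF; last lia.
  rewrite QF0_eta -s2; apply: left_homotopic_comp.
  exact: left_homotopic_sym.
exists theta; last by apply/(homotopy_class_eq cX); apply: left_homotopic_sym.
split=> /=.
  apply/homotopicE => //; rewrite -QF1_eta -(gmap_gQF (j := 1) (i := k)); last lia.
  by apply: left_homotopic_comp; apply: left_homotopic_sym.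
rewrite -gLD_gmap -t2 !gmap_gmap //; lia.
Qed.

(** Together [s] and [eta] define a map [p] to $\overline{\mathbf P}^x_k$, and through it strictly
    compatible maps [t j] into the top row, with [t 0 = s] and lower composites equal to those of
    [eta]. The $\kappa_j$ are deformations of the [t j] that start from [sigma_k] in column 0; each
    operation vanishes because its $\theta$ is homotopic to the corresponding composite of [t]. *)
Lemma sequence_of_strict_lift s : strict_lift s -> sequence_vanishes o.
Proof.
move=> [s1 s2].
have [|p [p1 p2]] := pullback_ex (gP_pullback gl) (u := eta o) (v := s); first by rewrite s2.
pose t j := gm k0.+1 k.+1 j k.+1 ∘ (gPF S x k ∘ p).
have tQ j i : j <= k0.+1 -> j <= i -> 0 < i -> i <= k -> gm j k.+1 j i ∘ t j = QF j i ∘ eta o.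
  move=> jk ji i0 ik; rewrite gmap_gmap; last lia.
  rewrite -(@gmap_gmap k0.+1 k.+1 k0.+1 k); last lia.
  rewrite (compA (gm _ _ _ _) (gPF S x k)) (gPF_Q gl) -compA p1 gmap_gQF //; lia.
have t0 : t 0 = s by rewrite /t compA (gPF_A gl).
have tS j : j < k0.+1 -> gm j.+1 k.+1 j k.+1 ∘ t j.+1 = t j.
  by move=> jk; rewrite gmap_gmap //; lia.
pose R j (c : hom X (gF S x k j k.+1)) (c' : hom X (gF S x k j.+1 k.+1)) :=
  j < k0.+1 -> lh (t j) c -> lh (t j.+1) c' /\ gm j.+1 k.+1 j k.+1 ∘ c' = c.
have [|kap [kap0 kapP]] := dep_sequence (R := R) (sigma_k o).
  move=> j c; have [z] := zero_hom X (gF S x k j.+1 k.+1).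
  have [[jk h]|n] := pselect (j < k0.+1 /\ lh (t j) c); last first.
    by exists z => jk h; case: n.
  have [|c' [c1 c2]] := homotopy_lifting cX (f := t j.+1) (g := c)
      (@gmap_step_rlp j k.+1 jk (leqW jk) (leqnn _)); first by rewrite tS.
  by exists c'.
have kapt j : j <= k0.+1 -> lh (t j) (kap j).
  elim: j => [_|j IH jk]; first by rewrite t0 kap0; apply: left_homotopic_sym.
  by have [] := kapP j jk (IH (ltnW jk)).
have kapS j : j < k0.+1 -> gm j.+1 k.+1 j k.+1 ∘ kap j.+1 = kap j.
  by move=> jk; have [] := kapP j jk (kapt j (ltnW jk)).
exists kap, (fun i => gm i.+1 k.+1 i.+1 i.+2 ∘ kap i.+1); split=> // i ik.
have ti l : i < l -> l <= k -> lh (gm i.+1 k.+1 i.+1 l ∘ kap i.+1) (QF i.+1 l ∘ eta o).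
  move=> il lk; rewrite -tQ //; last by lia.
  by apply: left_homotopic_comp; apply: left_homotopic_sym => //; apply: kapt.
split.
- split.
    by apply/homotopicE => //; rewrite gmap_gmap; [apply: ti; lia|lia].
  by rewrite gmap_gmap; [rewrite -(kapS i ik) gmap_gmap //; lia|lia].
- by apply/homotopicE => //; apply: ti; lia.
- by split=> //; apply: kapS.
Qed.

Lemma total_of_sequence : sequence_vanishes o -> total_vanishes o.
Proof.
move=> [kap [th [kap0 kapP]]].
have kapE j : j <= k0.+1 -> gm j k.+1 0 k.+1 ∘ kap j = sigma_k o.
  elim: j => [_|j IH jk]; first by rewrite kap0 gmap_same //; lia.
  have [_ _ [e _]] := kapP j jk; rewrite -(IH (ltnW jk)) -e gmap_gmap //; lia.
(* The operation of highest order, [i = k0], has its $\theta$ in $F^{k-1,k}$. *)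
have [_ v [e1 e2]] := kapP k0 (leqnn _).
have {}v : lh (th k0) (QF k0.+1 k ∘ eta o) by apply/homotopicE.
exists (gm k0.+1 k 1 k ∘ th k0); last first.
  apply/(homotopy_class_eq cX); rewrite -(@gmap_gQF k0.+1 k); last lia.
  exact: left_homotopic_comp.
split=> /=.
  apply/homotopicE => //; rewrite -QF1_eta gmap_gmap; last lia.
  rewrite -(@gmap_gQF k0.+1 k 1 1); last lia.
  exact: left_homotopic_comp.
rewrite -gLD_gmap !gmap_gmap; try lia.
rewrite -e2 gmap_gmap; last lia.
rewrite -(kapE k0.+1) // gmap_gmap //; lia.
Qed.

(** The homotopy [h] is lifted along the fibration at the corner, giving a map that lies strictly
    over $\kappa$; the pullback square below row [i.+2] then yields $\theta$. At the start [h] is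
    [D_homotopic], afterwards it is the vanishing of the preceding operation. *)
Lemma separated_nonempty i (f : hom X (gF S x k i i.+1))
    (c : hom X (gF S x k i k.+1)) : i < k0.+1 ->
  f = gm i k.+1 i i.+1 ∘ c -> lh (gm i.+1 i.+1 i i.+1 ∘ (QF i.+1 i.+1 ∘ eta o)) f ->
  separated_operation o c !=set0.
Proof.
move=> ik fc h.
have [g [g1 g2]] := homotopy_lifting cX (gmap_corner_rlp ik) h.
have [|th [t1 t2]] := pullback_ex (@gmap_pullback i i.+2 ik (leqnn _) (leqW ik))
    (u := g) (v := gm i k.+1 i i.+2 ∘ c).
  by rewrite g2 fc gmap_gmap //; lia.
exists (homotopy_class th), th => //; split=> //.
by apply/homotopicE => //; rewrite t1; apply: left_homotopic_sym.
Qed.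

Lemma separatesP : separates o.
Proof.
split.
- apply: (@separated_nonempty 0 (gLD S x k ∘ (gm 0 k.+1 0 k ∘ sigma_k o))) => //.
    by rewrite -gLD_gmap gmap_gmap //; lia.
  rewrite QF1_eta compA (giota_law gl) -eta_B compA (pullback_comm (gQ_pullback gl)) -compA.
  exact: D_homotopic.
- move=> i c th ik [_ e].
  have pb1 := @gmap_pullback i k.+1 ik (leqW ik) (leqnn _).
  have pb2 := @gmap_pullback i i.+2 ik (leqnn _) (leqW ik).
  have [|c' [c1 c2]] := pullback_ex pb1 (u := gm i.+1 i.+2 i.+1 i.+1 ∘ th) (v := c).
    rewrite gmap_gmap; last lia.
    rewrite -(@gmap_gmap i.+1 i.+2 i i.+2); last lia.
    by rewrite e gmap_gmap //; lia.
  have c3 : gm i.+1 k.+1 i.+1 i.+2 ∘ c' = th.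
    apply: (pullback_mono pb2); first by rewrite gmap_gmap //; lia.
    by rewrite e -c2 !gmap_gmap //; lia.
  exists c'; split=> // c'' [d1 d2]; apply: (pullback_mono pb1); last by rewrite c2 d1.
  rewrite c1 -d2 gmap_gmap //; lia.
- move=> i c th c' ik _ /homotopicE v [_ d2].
  apply: (@separated_nonempty i.+1 th) => //.
  rewrite gmap_gQF; last lia.
  by apply: left_homotopic_sym => //; apply: v.
Qed.

Definition strict_extension (Yxk : functor (sub x k) E (fun s => Y0 (sval s))) : Prop :=
  [/\ pointed_on Yxk, lifts Yt Yxk, agree Yxk Yk & agree Yxk Yx].

Lemma bdry_sub (u : bdry x k) : in_sub x k (sval u).
Proof. by case: u => u []. Qed.

Lemma strict_lift_of_extension Yxk : strict_extension Yxk -> exists s, strict_lift s.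
Proof.
move=> [pY lY aYk aYx].
have aY (u v : bdry x k) (f : hom (sval u) (sval v)) : Yk u v f
    = Yxk (exist _ (sval u) (bdry_sub u)) (exist _ (sval v) (bdry_sub v)) f.
  by case: u v f => [u pu] [v pv] f; symmetry; apply: aYk.
have [s sP] := product_ex (gA_product gl) (fun a : tarrow x k x (deg_eq k) =>
  Yxk (exist _ x (or_introl erefl)) (exist _ (tgt a) (bdry_sub (tgt_ a))) (arr a)).
exists s; split.
  have [K] := cylinder_exists X; apply/left_homotopicP; exists K.
  apply: (homotopic_by_product (gA_product gl)) => a.
  apply/(left_homotopic_by cX) => //; first exact: (proj1 (bif _)).
  apply: (loc_surjective_injective H cX (proj1 (bif _))).2.
  rewrite loc_component sP; symmetry.
  exact: (lY (exist (in_sub x k) x (or_introl erefl)) (exist _ _ (bdry_sub (tgt_ a)))).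
apply: (product_mono (gL_product gl)) => a; apply: rm_cmp_mono => b.
rewrite matching_component sP (eta_L o b) /Yx_at.
rewrite aY -(aYx _ _ (or_introl erefl) (bdry_sub (tgt_ b))); symmetry.
exact: (@fmap_comp _ _ _ Yxk (exist (in_sub x k) x (or_introl erefl))
  (exist _ _ (bdry_sub (tgt_ a))) (exist _ _ (bdry_sub (tgt_ b))) (arr b) (arr a)).
Qed.

Section Extension.
Variables (s : hom X (gF S x k 0 k.+1)) (ls : strict_lift s).

(** The values of the extension on arrows from [x] to objects of degree [k]: a component of [s] on
    unbarred arrows, zero on barred ones. Unbarred arrows to other degrees receive fillers. *)
Lemma top_exists : exists top : forall (u : bdry x k) (f : hom x (sval u)),
    hom X (Y0 (sval u)),
  (forall u f (d : deg_eq k (deg (sval u))) (h : ~~ barred f),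
     top u f = gA_pr S (Tarrow (tarr := Arrow (tgt_ := u) f d) h) ∘ s) /\
  (forall u f, barred f -> is_zero_map (top u f)).
Proof.
have /dep_choice [top0 top0P] : forall uf : {u : bdry x k & hom x (sval u)},
    exists g : hom X (Y0 (sval (projT1 uf))),
    (forall (d : deg_eq k (deg (sval (projT1 uf)))) (h : ~~ barred (projT2 uf)),
       g = gA_pr S (Tarrow (tarr := Arrow (tgt_ := projT1 uf) (projT2 uf) d) h) ∘ s) /\
    (barred (projT2 uf) -> is_zero_map g).
  move=> [u f] /=; case: (orP (orbN (barred f))) => h.
    have [z zz] := zero_map_exists X (Y0 (sval u)); exists z; split=> // d h'.
    by case: (negP h' h).
  have [d|n] := pselect (deg_eq k (deg (sval u))).
    exists (gA_pr S (Tarrow (tarr := Arrow (tgt_ := u) f d) h) ∘ s).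
    split=> [d' h'|h']; last by case: (negP h h').
    by rewrite (bool_irrelevance d' d) (bool_irrelevance h' h).
  have [z _] := zero_map_exists X (Y0 (sval u)); exists z; split=> // h'.
  by case: (negP h h').
exists (fun u f => top0 (existT _ u f)).
by split=> u f; have [h1 h2] := top0P (existT _ u f).
Qed.

Lemma deg_le_of_hom (t u : J) (f : hom t u) : deg u <= deg t.
Proof.
have [->//|/eqP n] := eqVneq (deg u) (deg t).
by apply: ltnW; apply: (deg_lt f) => e; apply: n; rewrite e.
Qed.

(** No arrow leads from the boundary back to [x], whose degree exceeds [k]. *)
Lemma in_bdry_target (t u : J) (f : hom t u) : in_bdry x k t -> in_sub x k u -> in_bdry x k u.
Proof.
move=> [[//|[_ dt]] nt] pu; split=> // e; subst u.
by have := leq_trans (deg_le_of_hom f) dt; rewrite leqNgt k_lt.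
Qed.

Lemma in_sub_lower (t : J) : in_bdry x k t -> deg t <> k -> in_sub x k0.+1 t.
Proof. by move=> [[//|[i dt]] _] n; right; split=> //; move: dt n; lia. Qed.

Lemma sub_lower_deg (t : J) : in_sub x k0.+1 t -> t <> x -> deg t <= k0.+1.
Proof. by move=> [|[]]. Qed.

Lemma extension_of_strict_lift : exists Yxk, strict_extension Yxk.
Proof.
have [top [topA topZ]] := top_exists.
(* [F] is defined on arrows of [J], to keep membership proofs out of its type. Where the two given
   functors overlap [Yx] is taken, which agrees with [Yk] by [YxYk]; the other values outside [top]
   are fillers. *)
pose F (t u : J) (f : hom t u) : hom (Y0 t) (Y0 u) :=
  match pselect (in_sub x k0.+1 t /\ in_sub x k0.+1 u) with
  | left (conj ht hu) => Yx (exist _ t ht) (exist _ u hu) f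
  | right _ =>
    match pselect (in_bdry x k t), pselect (in_bdry x k u) with
    | left ht, left hu => Yk (exist _ t ht) (exist _ u hu) f
    | _, left hu => match pselect (x = t) with
      | left e => (match e in _ = t' return hom t' u -> hom (Y0 t') (Y0 u) with
                   | erefl => top (exist _ u hu) end) f
      | right _ => sval (cid (zero_map_exists (Y0 t) (Y0 u)))
      end
    | _, _ => sval (cid (zero_map_exists (Y0 t) (Y0 u)))
    end
  end.
have Fx t u (ht : in_sub x k0.+1 t) (hu : in_sub x k0.+1 u) f :
    F t u f = Yx (exist _ t ht) (exist _ u hu) f.
  rewrite /F; case: pselect => [[ht' hu']|[]//].
  by rewrite (Prop_irrelevance ht' ht) (Prop_irrelevance hu' hu).
have Fk t u (ht : in_bdry x k t) (hu : in_bdry x k u) f :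
    F t u f = Yk (exist _ t ht) (exist _ u hu) f.
  rewrite /F; case: pselect => [[ht' hu']|_]; first exact: YxYk.
  case: pselect => // ht'; case: pselect => // hu'.
  by rewrite (Prop_irrelevance ht' ht) (Prop_irrelevance hu' hu).
have Ft u (hu : in_bdry x k u) f : deg u = k -> F x u f = top (exist _ u hu) f.
  move=> du; rewrite /F; case: pselect => [[hx' hu']|_].
    by have := sub_lower_deg hu' (proj2 hu); rewrite du ltnn.
  case: pselect => [[_ /(_ erefl)]|_] //; case: pselect => // hu'; case: pselect => // e.
  by rewrite (Prop_irrelevance e erefl) (Prop_irrelevance hu' hu).
have Fid t : in_sub x k t -> F t t (idm t) = idm (Y0 t).
  move=> pt; have [e|n] := pselect (t = x).
    subst t; rewrite (Fx x x (or_introl erefl) (or_introl erefl)).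
    exact: (fmap_id Yx (exist (in_sub x k0.+1) x (or_introl erefl))).
  rewrite (Fk t t (conj pt n) (conj pt n)).
  exact: (fmap_id Yk (exist (in_bdry x k) t (conj pt n))).
have Fcomp r t u (g : hom t u) (f : hom r t) : in_sub x k r -> in_sub x k t ->
    in_sub x k u -> F r u (g ∘ f) = F t u g ∘ F r t f.
  move=> pr pt pu; have [er|nr] := pselect (r = x); last first.
    have br : in_bdry x k r by split.
    have bt := in_bdry_target f br pt; have bu := in_bdry_target g bt pu.
    rewrite (Fk _ _ br bu) (Fk _ _ bt bu) (Fk _ _ br bt).
    exact: (@fmap_comp _ _ _ Yk (exist (in_bdry x k) r br) (exist _ t bt) (exist _ u bu)).
  subst r; have [et|nt] := pselect (t = x).
    by subst t; rewrite (endo_id f) compm1 Fid // compm1.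
  have bt : in_bdry x k t by split.
  have bu := in_bdry_target g bt pu.
  have hx : in_sub x k0.+1 x by left.
  have [dt|dt] := pselect (deg t = k); last first.
    have ht := in_sub_lower bt dt.
    have hu : in_sub x k0.+1 u.
      apply: in_sub_lower => // du; have := deg_le_of_hom g; rewrite du.
      by have := sub_lower_deg ht nt; lia.
    rewrite (Fx _ _ hx hu) (Fx _ _ ht hu) (Fx _ _ hx ht).
    exact: (@fmap_comp _ _ _ Yx (exist (in_sub x k0.+1) x hx) (exist _ t ht) (exist _ u hu)).
  have [e|ntu] := pselect (t = u).
    by subst u; rewrite (endo_id g) comp1m Fid // comp1m.
  have du : deg u <= k0.+1 by have := deg_lt g ntu; rewrite dt.
  have hu : in_sub x k0.+1 u by right; split=> //; exact: (inhabits (g ∘ f)).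
  (* This is the one composite not handled within a single given functor: [t] has degree [k], so [f]
     is sent to a component of [s], while the composite is a value of [Yx]. For unbarred [f] the
     equation is the agreement of [s] and [eta] in $L$. *)
  rewrite (Fk _ _ bt bu) (Ft _ bt) //.
  have -> : F x u (g ∘ f) = Yx_at (k := k) Yx (g ∘ f) du.
    exact: (Fx x u (or_introl erefl) (or_intror (conj (inhabits (g ∘ f)) du))).
  case: (orP (orbN (barred f))) => h.
    apply: zero_map_eq; first by apply: Yx_at_bar; apply: barred_comp; rewrite h orbT.
    by apply: zero_map_compr; exact: (topZ (exist _ t bt) f h).
  have d : deg_eq k (deg (sval (exist (in_bdry x k) t bt))) by apply/eqP.
  rewrite (topA _ _ d h).
  have := matching_component
    (a := Tarrow (tarr := Arrow (tgt_ := exist _ t bt) f d) h)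
    (Arrow (tgt_ := exist _ u bu) g du) s.
  rewrite (proj2 ls) => <-; symmetry.
  exact: (eta_L o (a := Tarrow (tarr := Arrow (tgt_ := exist _ t bt) f d) h)
    (Arrow (tgt_ := exist _ u bu) g du)).
pose Yxk : functor (sub x k) E (fun t => Y0 (sval t)) :=
  @Functor (sub x k) E (fun t => Y0 (sval t)) (fun t u f => F (sval t) (sval u) f)
    (fun t => Fid (sval t) (svalP t))
    (fun r t u g f => Fcomp _ _ _ g f (svalP r) (svalP t) (svalP u)).
exists Yxk; split.
- move=> [t pt] [u pu] f /= bf; have [e|nt] := pselect (t = x); last first.
    have bt : in_bdry x k t by split.
    have bu := in_bdry_target f bt pu; rewrite (Fk _ _ bt bu).
    exact: (@pYk (exist _ t bt) (exist _ u bu)).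
  subst t; have hx : in_sub x k0.+1 x by left.
  have [hu|nu] := pselect (in_sub x k0.+1 u).
    by rewrite (Fx _ _ hx hu); apply: (@pYx (exist _ x hx) (exist _ u hu)).
  have bu : in_bdry x k u by split=> // e; apply: nu; rewrite e.
  have du : deg u = k by apply: contrapT => n; apply: nu; apply: in_sub_lower.
  by rewrite (Ft _ bu) //; exact: (topZ (exist _ u bu) f bf).
- move=> [t pt] [u pu] f /=; have [e|nt] := pselect (t = x); last first.
    have bt : in_bdry x k t by split.
    have bu := in_bdry_target f bt pu; rewrite (Fk _ _ bt bu).
    exact: (lYk (s := exist _ t bt) (t := exist _ u bu)).
  subst t; have hx : in_sub x k0.+1 x by left.
  have [hu|nu] := pselect (in_sub x k0.+1 u).
    by rewrite (Fx _ _ hx hu); apply: (lYx (s := exist _ x hx) (t := exist _ u hu)).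
  have bu : in_bdry x k u by split=> // e; apply: nu; rewrite e.
  have du : deg u = k by apply: contrapT => n; apply: nu; apply: in_sub_lower.
  (* On a barred arrow the chosen value is zero in [E] and that of [Yt] is zero in the homotopy
     category; [loc_zero] compares them. *)
  rewrite (Ft _ bu) //; case: (orP (orbN (barred f))) => h.
    apply: loc_zero; [exact: (proj1 (bif _))|exact: (topZ (exist _ u bu) f h)|exact: pYt].
  have d : deg_eq k (deg (sval (exist (in_bdry x k) u bu))) by apply/eqP.
  rewrite (topA _ _ d h).
  have := loc_component (Tarrow (tarr := Arrow (tgt_ := exist _ u bu) f d) h).
  move=> <-; symmetry; apply: loc_homotopic.
  by apply: left_homotopic_comp; case: ls.
- by move=> t u ht hu ht' hu' f /=; apply: Fk.
- by move=> t u ht hu ht' hu' f /=; apply: Fx.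
Qed.

End Extension.

Lemma separation_theorem : separates o /\
  [<-> exists Yxk, strict_extension Yxk; total_vanishes o; sequence_vanishes o].
Proof.
split; first exact: separatesP.
tfae.
- by move=> [Yxk /strict_lift_of_extension [s /total_of_strict_lift]].
- by move=> /strict_lift_of_total [s /sequence_of_strict_lift].
- move=> /total_of_sequence /strict_lift_of_total [s ls].
  exact: extension_of_strict_lift ls.
Qed.

End Operation.
End Grid.
End Main.

Theorem theorem6p12 (E : pointed_model_category) (H : homotopy_category E)
    (J : pointed_weak_lattice) (Y0 : J -> E) (Yt : functor J (ho H) Y0)
    (x : J) (n k : nat)
    (Yk : functor (bdry x k) E (fun s => Y0 (sval s)))
    (Yx : functor (sub x k.-1) E (fun s => Y0 (sval s))) :
  pointed_functor Yt ->
  (forall s : J, fibrant (Y0 s) /\ cofibrant (Y0 s)) ->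
  2 <= k -> k <= n -> n < deg x ->
  pointed_on Yk -> reedy_fibrant Yk -> lifts Yt Yk ->
  pointed_on Yx -> lifts Yt Yx -> agree Yx Yk ->
  inhabited (separation_grid Yk) /\
  forall S : separation_grid Yk,
    inhabited (maps_from_x Yt Yx S) /\
    forall o : maps_from_x Yt Yx S,
      separates o /\
      [<-> (* (1) *)
           exists Yxk : functor (sub x k) E (fun s => Y0 (sval s)),
             [/\ pointed_on Yxk, lifts Yt Yxk, agree Yxk Yk & agree Yxk Yx];
           (* (2) *)
           total_vanishes o;
           (* (3) *)
           sequence_vanishes o].
Proof.
(* With [k] of the form [k0.+2] the predecessor [k.-1] computes, and the size of the grid has the
   form required by [grid_laws]. *)
move=> pYt bif; case: k Yk Yx => [|[|k0]] // Yk Yx _ kn nx pYk rYk lYk pYx lYx YxYk.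
have k_lt := leq_ltn_trans kn nx.
split; first exact: separation_grid_exists.
move=> S; split; first exact: maps_from_x_exist.
by move=> o; apply: separation_theorem.
Qed.
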